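(* Let $n\ge3$, $1\le p\le\infty$, $\alpha\ge0$, let $v\in h^p(\mathbb{R}^n_+)$ and let $x$ be an arbitrary point in $\mathbb{R}^n_+$. The sharp coefficient $\mathcal{C}_{\alpha,n,p}(x)$ in the inequality $$\left|\nabla\big(x_n^{n\alpha-1}v(x)\big)\right|\le\mathcal{C}_{\alpha,n,p}(x)\,\|v\|_p$$ is given by $$\mathcal{C}_{\alpha,n,p}(x)=C_{\alpha,n,p}\,x_n^{\,n\alpha-2-(n-1)/p},$$ where $$C_{\alpha,n,1}=\frac{2n}{\omega_n}\sup_{|\boldsymbol z|=1}\ \sup_{\sigma\in\mathbb{S}^{n-1}_+}\big|\big(\alpha\boldsymbol e_n-(\boldsymbol e_\sigma,\boldsymbol e_n)\boldsymbol e_\sigma,\ \boldsymbol z\big)\big|\,(\boldsymbol e_\sigma,\boldsymbol e_n)^{n},$$ $$C_{\alpha,n,p}=\frac{2n}{\omega_n}\sup_{|\boldsymbol z|=1}\left\{\int_{\mathbb{S}^{n-1}_+}\big|\big(\alpha\boldsymbol e_n-(\boldsymbol e_\sigma,\boldsymbol e_n)\boldsymbol e_\sigma,\ \boldsymbol z\big)\big|^{\frac{p}{p-1}}(\boldsymbol e_\sigma,\boldsymbol e_n)^{\frac{n}{p-1}}\,d\sigma\right\}^{\frac{p-1}{p}}$$ for $1<p<\infty$, and $$C_{\alpha,n,\infty}=\frac{2n}{\omega_n}\sup_{|\boldsymbol z|=1}\int_{\mathbb{S}^{n-1}_+}\big|\big(\alpha\boldsymbol e_n-(\boldsymbol e_\sigma,\boldsymbol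 e_n)\boldsymbol e_\sigma,\ \boldsymbol z\big)\big|\,d\sigma.$$ In particular, the sharp constant $C_{0,n,p}$ in the inequality $$\left|\nabla\left\{\frac{v(x)}{x_n}\right\}\right|\le C_{0,n,p}\,x_n^{-2-(n-1)/p}\,\|v\|_p$$ is given by $C_{0,n,1}=2n/\omega_n$, $C_{0,n,\infty}=1$ and $$C_{0,n,p}=\frac{2n}{\omega_n}\left\{\frac{\pi^{\frac{n-1}{2}}\,\Gamma\left(\frac{3p+n-1}{2(p-1)}\right)}{\Gamma\left(\frac{(n+2)p}{2(p-1)}\right)}\right\}^{\frac{p-1}{p}}$$ for $1<p<\infty$. The constant $C_{0,n,p}$ is sharp also in the weaker inequality obtained from the last inequality by replacing $\nabla\{v/x_n\}$ by $\partial\{v/x_n\}/\partial x_n$.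
   Context: $\mathbb{R}^n_+=\{x=(x',x_n):x'\in\mathbb{R}^{n-1},\ x_n>0\}$; $\mathbb{S}^{n-1}$ is the unit sphere in $\mathbb{R}^n$; $\mathbb{S}^{n-1}_+=\{x\in\mathbb{S}^{n-1}:x_n>0\}$; $d\sigma$ is surface measure; $\omega_n=2\pi^{n/2}/\Gamma(n/2)$. $\boldsymbol e_\sigma$ is the unit vector from the origin to $\sigma\in\mathbb{S}^{n-1}$, $\boldsymbol e_n$ is the unit vector of the $n$-th coordinate axis, $(\cdot,\cdot)$ is the Euclidean inner product; $\boldsymbol z$ ranges over $\mathbb{R}^n$ with $|\boldsymbol z|=1$. $h^p(\mathbb{R}^n_+)$ is the Hardy space of (real) harmonic functions on $\mathbb{R}^n_+$ representable as the Poisson integral $v(x)=\frac{2}{\omega_n}\int_{\mathbb{R}^{n-1}}\frac{x_n}{|y-x|^n}v(y')\,dy'$, $y=(y',0)$, with boundary values $v(y')$ in $L^p(\mathbb{R}^{n-1})$; $\|v\|_p$ is the $L^p(\mathbb{R}^{n-1})$-norm of the boundary values. For $p=\infty$, $(n-1)/p=0$. ''Sharp coefficient (constant)'' at a given $x$ means the smallest one for which the inequality holds for all $v\in h^p(\mathbb{R}^n_+)$. *)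

(* Defs.v *)
From HB Require Import structures.
From mathcomp Require Import all_boot all_order all_algebra.
From mathcomp Require Import all_classical all_reals all_analysis.
From mathcomp Require Import measurable_realfun.

Set Implicit Arguments.
Unset Strict Implicit.
Unset Printing Implicit Defensive.

Import Order.TTheory GRing.Theory Num.Theory.
Import numFieldNormedType.Exports.

Local Open Scope classical_set_scope.
Local Open Scope ring_scope.

(** R^n is ['rV[R]_n]; the library provides its topology, while the Borel
    sigma-algebra is generated here by the coordinate functions, exactly as the
    library does for tuples. *)

Definition rV_display : measure_display. Proof. exact: default_measure_display. Qed.

Section rV_measurable.
Context {R : realType} (n : nat).

Let coors : 'I_n -> 'rV[R]_n -> measurableTypeR R := fun i x => x ord0 i.

Let rV_set0 : g_sigma_preimage coors set0.
Proof. exact: sigma_algebra0. Qed.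

Let rV_setC A : g_sigma_preimage coors A -> g_sigma_preimage coors (~` A).
Proof. exact: sigma_algebraC. Qed.

Let rV_bigcup (F : _^nat) : (forall i, g_sigma_preimage coors (F i)) ->
  g_sigma_preimage coors (\bigcup_i (F i)).
Proof. exact: sigma_algebra_bigcup. Qed.

HB.instance Definition _ := @isMeasurable.Build rV_display
  'rV[R]_n (g_sigma_preimage coors) rV_set0 rV_setC rV_bigcup.

End rV_measurable.

Lemma measurable_coord (R : realType) n (i : 'I_n) :
  measurable_fun [set: 'rV[R]_n] (fun x : 'rV[R]_n => x ord0 i).
Proof.
move=> _ Y mY; rewrite setTI; apply: sub_sigma_algebra => /=.
rewrite -bigcup_seq/=; exists i => /=; first by rewrite mem_index_enum.
by exists Y => //; rewrite setTI.
Qed.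

Lemma measurable_fun_coordP d (T : measurableType d) (R : realType) n
    (f : T -> 'rV[R]_n) :
  (forall i, measurable_fun [set: T] (fun t => f t ord0 i)) ->
  measurable_fun [set: T] f.
Proof.
move=> mf; have : g_sigma_preimage
    (fun i => (fun x : 'rV[R]_n => x ord0 i : measurableTypeR R) \o f)
    `<=` measurable.
  apply: smallest_sub; first exact: sigma_algebra_measurable.
  case: n => [|n] in f mf *; first by rewrite big_ord0.
  rewrite -bigcup_mkord_ord; apply: bigcup_sub => i Ii.
  by move=> A [B mB <-]; exact: mf.
rewrite g_sigma_preimage_comp => sub _ A mA; apply: sub; exists A => //.
Qed.

(** The point (y', t) of R^{m+1}, for y' in R^m and t in R. *)
Definition rV_rcons (R : realType) m (y : 'rV[R]_m) (t : R) : 'rV[R]_m.+1 :=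
  \row_i oapp (y ord0) t (unlift ord_max i).

Definition rV_last (R : realType) m (x : 'rV[R]_m.+1) : R := x ord0 ord_max.

Definition rV_belast (R : realType) m (x : 'rV[R]_m.+1) : 'rV[R]_m :=
  \row_j x ord0 (lift ord_max j).

Lemma rV_rconsK (R : realType) m (x : 'rV[R]_m.+1) :
  rV_rcons (rV_belast x) (rV_last x) = x.
Proof.
apply/rowP => i; rewrite mxE; case: unliftP => [j ->|->] //=.
by rewrite mxE.
Qed.

Lemma rV_belastK (R : realType) m (y : 'rV[R]_m) t :
  rV_belast (rV_rcons y t) = y.
Proof. by apply/rowP => i; rewrite !mxE liftK. Qed.

Lemma rV_lastK (R : realType) m (y : 'rV[R]_m) t :
  rV_last (rV_rcons y t) = t.
Proof. by rewrite /rV_last mxE unlift_none. Qed.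

Lemma measurable_rV_rcons (R : realType) m :
  measurable_fun [set: ('rV[R]_m * measurableTypeR R)%type]
    (fun yt => rV_rcons yt.1 yt.2).
Proof.
apply: measurable_fun_coordP => i; case: (unliftP ord_max i) => [j ->|->].
- under eq_fun do rewrite mxE liftK /=.
  exact: (measurableT_comp (@measurable_coord R m j) measurable_fst).
- by under eq_fun do rewrite mxE unlift_none /=; exact: measurable_snd.
Qed.

Lemma measurable_rV_uncons (R : realType) m :
  measurable_fun [set: 'rV[R]_m.+1]
    (fun x => (rV_belast x, rV_last x) : ('rV[R]_m * measurableTypeR R)%type).
Proof.
apply: measurable_fun_pair; last exact: measurable_coord.
by apply: measurable_fun_coordP => i; under eq_fun do rewrite mxE;
  exact: measurable_coord.
Qed.

Section lebesgue_rV.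
Context {R : realType}.

Section step.
Context (m : nat) (mu : {sigma_finite_measure set 'rV[R]_m -> \bar R}).

Definition lebesgue_rV_step : set 'rV[R]_m.+1 -> \bar R :=
  pushforward (mu \x (@lebesgue_measure R))%E
    (fun yt : 'rV[R]_m * measurableTypeR R => rV_rcons yt.1 yt.2).

Let step0 : lebesgue_rV_step set0 = 0%E.
Proof. by rewrite /lebesgue_rV_step /pushforward preimage_set0 measure0. Qed.

Let step_ge0 A : (0 <= lebesgue_rV_step A)%E.
Proof. by rewrite /lebesgue_rV_step /pushforward measure_ge0. Qed.

Let step_sigma_additive : semi_sigma_additive lebesgue_rV_step.
Proof.
apply: (@measure_semi_sigma_additive _ _ _
  (measure_function_pushforward__canonical__measure_function_Measure
    (mu \x (@lebesgue_measure R))%E (@measurable_rV_rcons R m))).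
Qed.

HB.instance Definition _ := isMeasure.Build _ _ _ lebesgue_rV_step
  step0 step_ge0 step_sigma_additive.

Let step_sigma_finite : sigma_finite setT lebesgue_rV_step.
Proof.
have /sigma_finiteP[F [TF ndF Foo]] := sigma_finiteT mu.
have /sigma_finiteP[G [TG ndG Goo]] := sigma_finiteT (@lebesgue_measure R).
pose u (x : 'rV[R]_m.+1) : 'rV[R]_m * measurableTypeR R :=
  (rV_belast x, rV_last x).
exists (fun k => u @^-1` (F k `*` G k)).
  rewrite -preimage_bigcup -[LHS](preimage_setT u); congr (u @^-1` _).
  rewrite -setXTT TF TG predeqE => -[x y]; split.
    move=> [/= [n _ Fnx] [k _ Gky]]; exists (maxn n k) => //; split.
    - by move: x Fnx; exact/subsetPset/ndF/leq_maxl.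
    - by move: y Gky; exact/subsetPset/ndG/leq_maxr.
  by move=> [n _ []/= ? ?]; split; exists n.
move=> k; have [mF Fk] := Foo k; have [mG Gk] := Goo k; split.
  rewrite -[X in measurable X]setTI; apply: measurable_rV_uncons => //.
  exact: measurableX.
rewrite /lebesgue_rV_step /pushforward -comp_preimage.
rewrite [X in X @^-1` _](_ : _ = id) ?preimage_id//; last first.
  by apply/funext => -[y t]; rewrite /u /= rV_belastK rV_lastK.
by rewrite product_measure1E// lte_mul_pinfty// ge0_fin_numE.
Qed.

HB.instance Definition _ := Measure_isSigmaFinite.Build _ _ _ lebesgue_rV_step
  step_sigma_finite.

End step.

(** Lebesgue measure on R^m: the m-fold product of [lebesgue_measure] (for
    m = 0, the unit mass on the one-point space). *)
Fixpoint lebesgue_rV m : {sigma_finite_measure set 'rV[R]_m -> \bar R} :=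
  if m is k.+1 then lebesgue_rV_step (lebesgue_rV k)
  else \d_(0 : 'rV[R]_0).

End lebesgue_rV.
Arguments lebesgue_rV R m : clear implicits.

Definition dotr (R : realType) n (u v : 'rV[R]_n) : R :=
  \sum_(i < n) u ord0 i * v ord0 i.

(** The library norm [`|x|] on row vectors is the sup norm, hence: *)
Definition enorm (R : realType) n (u : 'rV[R]_n) : R := Num.sqrt (dotr u u).

Definition halfspace (R : realType) m : set 'rV[R]_m.+1 :=
  [set x | 0 < rV_last x].
Arguments halfspace R m : clear implicits.

Definition sphere (R : realType) n : set 'rV[R]_n := [set z | enorm z = 1].
Arguments sphere R n : clear implicits.

Definition hemisphere (R : realType) m : set 'rV[R]_m.+1 :=
  sphere R m.+1 `&` halfspace R m.
Arguments hemisphere R m : clear implicits.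

Definition unit_ball (R : realType) n : set 'rV[R]_n := [set x | enorm x <= 1].
Arguments unit_ball R n : clear implicits.

Definition e_last (R : realType) m : 'rV[R]_m.+1 := delta_mx ord0 ord_max.
Arguments e_last R m : clear implicits.

(** At the origin this is [0], which is not on the sphere. *)
Definition radial_proj (R : realType) n (x : 'rV[R]_n) : 'rV[R]_n :=
  (enorm x)^-1 *: x.

Lemma measurable_enorm (R : realType) n :
  measurable_fun [set: 'rV[R]_n] (@enorm R n).
Proof.
have msqrt : measurable_fun [set: R] (@Num.sqrt R).
  by apply: continuous_measurable_fun; exact: sqrt_continuous.
apply: (measurableT_comp msqrt).
by apply: measurable_sum => i; apply: measurable_funM; exact: measurable_coord.
Qed.

Lemma measurable_radial_proj (R : realType) n :
  measurable_fun [set: 'rV[R]_n] (@radial_proj R n).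
Proof.
apply: measurable_fun_coordP => i; under eq_fun do rewrite mxE.
apply: measurable_funM; last exact: measurable_coord.
under eq_fun do rewrite -powR_inv1 ?sqrtr_ge0//.
exact: (measurableT_comp (measurable_powR _) (@measurable_enorm R n)).
Qed.

Lemma measurable_unit_ball (R : realType) n : measurable (unit_ball R n).
Proof.
have -> : unit_ball R n = @enorm R n @^-1` `]-oo, 1].
  by apply/seteqP; split => x /=; rewrite in_itv.
by rewrite -[X in measurable X]setTI; exact: measurable_enorm.
Qed.

(** Surface measure on the unit sphere of R^n, as the cone measure
      sigma(A) = n * |{ r s : s in A, 0 < r <= 1 }|   (A a subset of S^{n-1}),
    that is, the measure of the polar decomposition dx = r^{n-1} dr dsigma; its
    total mass is n |B^n| = omega_n. It is defined on all Borel sets of R^n and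
    carried by the sphere. *)
Section surface_measure.
Context {R : realType} (n : nat).

Definition surface_measure (A : set 'rV[R]_n) : \bar R :=
  (n%:R%:E * lebesgue_rV R n (@radial_proj R n @^-1` A `&` unit_ball R n))%E.

Let surf0 : surface_measure set0 = 0%E.
Proof. by rewrite /surface_measure preimage_set0 set0I measure0 mule0. Qed.

Let surf_ge0 A : (0 <= surface_measure A)%E.
Proof. by rewrite mule_ge0// lee_fin. Qed.

Let surf_sigma_additive : semi_sigma_additive surface_measure.
Proof.
exact: (@measure_semi_sigma_additive _ _ _
  (mscale (n%:R%:nng : {nonneg R})
    (measure_function_pushforward__canonical__measure_function_Measure
      (mrestr (lebesgue_rV R n) (@measurable_unit_ball R n))
      (@measurable_radial_proj R n)))).
Qed.

HB.instance Definition _ := isMeasure.Build _ _ _ surface_measure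
  surf0 surf_ge0 surf_sigma_additive.

End surface_measure.
Arguments surface_measure R n : clear implicits.

Definition Gamma (R : realType) (s : R) : R :=
  \int[@lebesgue_measure R]_(t in `]0, +oo[) (t `^ (s - 1) * expR (- t)).

Definition omega (R : realType) (n : nat) : R :=
  2 * pi `^ (n%:R / 2) / Gamma (n%:R / 2).
Arguments omega R n : clear implicits.

Section differential_operators.
Context {R : realType} (n : nat).
Implicit Types (f : 'rV[R]_n -> R) (x : 'rV[R]_n).

Definition partial (i : 'I_n) f x : R := 'D_(delta_mx ord0 i) f x.

Definition grad f x : 'rV[R]_n := \row_i partial i f x.

Definition laplacian f x : R := \sum_(i < n) partial i (partial i f) x.

(** C^2 with vanishing Laplacian; [D] is meant to be open. The derivability
    conditions make [partial], which is total, the genuine partial derivative. *)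
Definition harmonic_on (D : set 'rV[R]_n) f : Prop :=
  forall x, D x ->
  [/\ forall i, derivable f x (delta_mx ord0 i),
      forall i j, derivable (partial i f) x (delta_mx ord0 j),
      forall i j, {for x, continuous (partial j (partial i f))} &
      laplacian f x = 0].

End differential_operators.

Section hardy.
Context {R : realType} (m : nat).
Implicit Types (v : 'rV[R]_m.+1 -> R) (f : 'rV[R]_m -> R) (p : \bar R).

Definition poisson f (x : 'rV[R]_m.+1) : R :=
  2 / omega R m.+1 *
  \int[lebesgue_rV R m]_y
    (rV_last x / enorm (rV_rcons y 0 - x) ^+ m.+1 * f y).

(** [v] is in h^p of the half-space, with boundary values [f]. *)
Definition hardy p v f : Prop :=
  [/\ harmonic_on (halfspace R m) v,
      f \in Lfun (lebesgue_rV R m) p &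
      forall x, halfspace R m x -> v x = poisson f x].

Definition Lp_norm p f : R := fine ('N[lebesgue_rV R m]_p[EFin \o f])%E.

(** [C] is the smallest constant such that [Q v <= C * w * ||v||_p] for all [v]
    in h^p, where [Q v] is a quantity attached to [v] at a fixed point. *)
Definition is_sharp p (Q : ('rV[R]_m.+1 -> R) -> R) (w C : R) : Prop :=
  let admissible := [set K : R |
    forall v f, hardy p v f -> Q v <= K * w * Lp_norm p f] in
  admissible C /\ lbound admissible C.

End hardy.

Section constant.
Context {R : realType} (m : nat).
Let n := m.+1.

(** (alpha e_n - (e_s, e_n) e_s, z) *)
Definition direction_form (alpha : R) (s z : 'rV[R]_m.+1) : R :=
  dotr (alpha *: e_last R m - dotr s (e_last R m) *: s) z.

(** The suprema are real ones, of nonempty bounded sets; a point s of the sphere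
    is identified with its unit vector. The value at [-oo] is irrelevant. *)
Definition sharp_const (alpha : R) (p : \bar R) : R :=
  2 * n%:R / omega R n *
  match p with
  | r%:E =>
    if r == 1 then
      sup [set sup [set `|direction_form alpha s z| *
                        dotr s (e_last R m) ^+ n | s in hemisphere R m]
          | z in sphere R n]
    else
      sup [set (\int[surface_measure R n]_(s in hemisphere R m)
                  (`|direction_form alpha s z| `^ (r / (r - 1)) *
                   dotr s (e_last R m) `^ (n%:R / (r - 1))))
               `^ ((r - 1) / r)
          | z in sphere R n]
  | +oo%E =>
      sup [set \int[surface_measure R n]_(s in hemisphere R m)
                 `|direction_form alpha s z|
          | z in sphere R n]
  | -oo%E => 0
  end.

End constant.
Arguments sharp_const {R} m alpha p.

(** (n - 1) / p with n - 1 = m, read as 0 for p = +oo. *)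
Definition dim_over (R : realType) (m : nat) (p : \bar R) : R :=
  if p is r%:E then m%:R / r else 0.

(* Main.v *)
Require Import Defs.
From mathcomp Require Import all_boot all_order all_algebra.
From mathcomp Require Import all_classical all_reals all_analysis.
From mathcomp Require Import measurable_realfun ess_sup_inf.
From mathcomp Require Import ring lra.

Set Implicit Arguments.
Unset Strict Implicit.
Unset Printing Implicit Defensive.

Import Order.TTheory GRing.Theory Num.Theory.
Import numFieldNormedType.Exports.

Local Open Scope classical_set_scope.
Local Open Scope ring_scope.

(** The gradient at a point is an integral operator applied to the boundary
values, with an explicit kernel; the sharp coefficient is a dual norm of that
kernel, maximised over directions, and a change of variables turns the norm
into an integral over the hemisphere.

Let n = m + 1.  On the half-space v = (2 / omega_n) x_n u, where
u(x) = \int |x - y|^-n f(y) dy over R^m, so x_n^(n alpha - 1) v equals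
(2 / omega_n) x_n^(n alpha) u.  Differentiating under the integral sign, one
finds for every z that (grad (x_n^(n alpha - 1) v), z) is
(2 n / omega_n) x_n^(n alpha - 1) times the integral of f against
   k_z(y) = |x - y|^-n (alpha e_n - (e_s, e_n) e_s, z),
e_s being the direction of x - y, which always points into the upper
hemisphere ([dotr_grad], [grad_kernel]).  The norm of the gradient is the
maximum over unit z of these scalar products.

For fixed z the best bound for |\int k_z f| by the L^p norm of f is the norm of
k_z in the conjugate space ([potential_le], [potential_ge]).  The upper bound is
Hoelder's inequality.  The lower bound tests with f = sign(k) |k|^(q - 1) for
1 < p < oo, with sign(k) for p = oo, and for p = 1 with sign(k) on small cubes,
k being continuous.  These test functions may be used because every f in L^p is
the boundary function of an element of h^p: its Poisson integral is harmonic
([harmonic_poisson]), and it converges because the Poisson kernel is dominated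
by (1 + |y|^2)^(-n/2), which lies in every L^q.

The map from y to e_s is the gnomonic projection of R^m onto the hemisphere; it
carries dy to x_n^m (e_s, e_n)^-n dsigma ([integral_halfspace_hemisphere]).
Since |x - y| = x_n / (e_s, e_n), the conjugate norm of k_z becomes a power of
x_n times the expression inside the supremum of the statement
([kernel_norm_r], [kernel_norm_y], [kernel_le1] with [kernel_attained]).

For alpha = 0 the form is - (e_s, e_n) (e_s, z), and z = e_n is an optimal
direction: by Young's inequality |s_n|^a |(s, z)|^q is at most a convex
combination of |s_n|^(a + q) and |(s, z)|^(a + q), and the last two have the
same integral because the sphere is invariant under the reflection exchanging z
and e_n ([le_integral_hemisphere_dotr]).  Optimality of e_n is also why the
constant stays sharp for the derivative in x_n alone.  What remains is the
integral of a power of s_n over the hemisphere; the gnomonic projection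
transforms it into \int (1 + |u|^2)^-b du, and writing the integrand as a
superposition of Gaussians gives the quotient of Gamma values
([integral_japan]). *)

(** * Lebesgue measure under affine maps of the line *)

Section affine1.
Context {R : realType}.
Local Open Scope ereal_scope.
Let mu := @lebesgue_measure R.

Lemma measurable_affine1 (c d : R) :
  measurable_fun [set: measurableTypeR R] (fun t : measurableTypeR R => (c * t + d)%R : measurableTypeR R).
Proof. by apply: measurable_funD => //; exact: measurable_funM. Qed.

(** Both sides are measures of A, and they agree on half-open intervals, which
determine Lebesgue measure. *)
Lemma lebesgue_measure_affine (c d : R) (A : set (measurableTypeR R)) :
  (c != 0)%R -> measurable A ->
  mu ((fun t : R => (c * t + d)%R) @^-1` A) = `|c|^-1%:E * mu A.
Proof.
move=> c0 mA.
have nc0 : (0 <= `|c|)%R by [].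
pose nu : {measure set (measurableTypeR R) -> \bar R} :=
  mscale (NngNum nc0)
   (measure_function_pushforward__canonical__measure_function_Measure mu (measurable_affine1 c d)).
have H : forall X, ocitv X -> mu X = nu X.
  move=> _ [[a b]] _ <-.
  change (mu `]a, b]%classic =
    `|c|%:E * mu ((fun t : R => c * t + d)%R @^-1` `]a, b]%classic)).
  rewrite /mu.
  have [c_gt0|c_lt0|/eqP] := ltgtP 0%R c; last by rewrite eq_sym (negbTE c0).
  - rewrite (_ : _ @^-1` _ = [set` `](a - d) / c, (b - d) / c]])%R; last first.
      apply/seteqP; split => t /=; rewrite !in_itv/= ltr_pdivrMr// ler_pdivlMr//;
      by rewrite mulrC ltrBlDr lerBrDr.
    rewrite !lebesgue_measure_itv/= !lte_fin ltr_pM2r ?invr_gt0// ltrD2r.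
    case: ifP => _; last by rewrite mule0.
    rewrite -!EFinB -EFinM; congr (_%:E); rewrite gtr0_norm//.
    by field; rewrite gt_eqF.
  - rewrite (_ : _ @^-1` _ = [set` `[(b - d) / c, (a - d) / c[])%R; last first.
      apply/seteqP; split => t /=; rewrite !in_itv/= ltr_ndivlMr// ler_ndivrMr//;
      by rewrite mulrC ltrBlDr lerBrDr andbC.
    rewrite !lebesgue_measure_itv/= !lte_fin ltr_nM2r ?invr_lt0// ltrD2r.
    case: ifP => _; last by rewrite mule0.
    rewrite -!EFinB -EFinM; congr (_%:E); rewrite ltr0_norm//.
    by field; rewrite lt_eqF.
have -> : mu A = `|c|%:E * mu ((fun t : R => (c * t + d)%R) @^-1` A).
  exact: (lebesgue_measure_unique H mA).
by rewrite muleA -EFinM mulVf ?normr_eq0// mul1e.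
Qed.

Lemma integral_affine1 (c d : R) (h : measurableTypeR R -> \bar R) :
  (c != 0)%R -> measurable_fun setT h -> (forall t, 0 <= h t) ->
  \int[mu]_t h (c * t + d)%R = `|c|^-1%:E * \int[mu]_t h t.
Proof.
move=> c0 mh h0.
have ic0 : (0 <= `|c|^-1)%R by rewrite invr_ge0.
rewrite -[in RHS](ge0_integral_mscale mu measurableT (NngNum ic0))//.
rewrite -(ge0_integral_pushforward (measurable_affine1 c d) mu measurableT)//.
pose nu : {measure set (measurableTypeR R) -> \bar R} :=
  measure_function_pushforward__canonical__measure_function_Measure mu (measurable_affine1 c d).
apply: (@eq_measure_integral _ _ _ setT (mscale (NngNum ic0) mu) nu) => A mA _.
exact (lebesgue_measure_affine d c0 mA).
Qed.

End affine1.

(** * Lebesgue measure on R^m *)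

Section lebesgue_rV_theory.
Context {R : realType}.
Local Notation leb := (lebesgue_rV R).
Local Notation mu := (@lebesgue_measure R).
Local Open Scope ereal_scope.

Lemma integralZl_setT d (T : measurableType d) (m : {measure set T -> \bar R})
    (k : R) (f : T -> \bar R) :
  measurable_fun setT f -> (forall x, 0 <= f x) -> (0 <= k)%R ->
  \int[m]_x (k%:E * f x) = k%:E * \int[m]_x f x.
Proof. by move=> mf f0 k0; apply: ge0_integralZl. Qed.

Lemma measurable_funZ_rV d (T : measurableType d) n (c : T -> R) (f : T -> 'rV[R]_n) :
  measurable_fun setT c -> measurable_fun setT f ->
  measurable_fun setT (fun t => c t *: f t)%R.
Proof.
move=> mc mf; apply: measurable_fun_coordP => i; under eq_fun do rewrite mxE.
by apply: measurable_funM => //; apply: (measurableT_comp (@measurable_coord R n i)).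
Qed.

Lemma measurable_funD_rV d (T : measurableType d) n (f g : T -> 'rV[R]_n) :
  measurable_fun setT f -> measurable_fun setT g ->
  measurable_fun setT (fun t => f t + g t)%R.
Proof.
move=> mf mg; apply: measurable_fun_coordP => i; under eq_fun do rewrite mxE.
by apply: measurable_funD; apply: (measurableT_comp (@measurable_coord R n i)).
Qed.

Lemma measurable_funB_rV d (T : measurableType d) n (f g : T -> 'rV[R]_n) :
  measurable_fun setT f -> measurable_fun setT g ->
  measurable_fun setT (fun t => f t - g t)%R.
Proof.
move=> mf mg; apply: measurable_fun_coordP => i; under eq_fun do rewrite !mxE.
by apply: measurable_funB; apply: (measurableT_comp (@measurable_coord R n i)).
Qed.

Lemma measurable_fun_rcons d (T : measurableType d) n (f : T -> 'rV[R]_n) (g : T -> R) :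
  measurable_fun setT f -> measurable_fun setT g ->
  measurable_fun setT (fun t => rV_rcons (f t) (g t)).
Proof.
move=> mf mg.
apply: (measurableT_comp (@measurable_rV_rcons R n)
   (measurable_fun_pair mf mg)).
Qed.

Lemma measurable_dotr d (T : measurableType d) n (f g : T -> 'rV[R]_n) :
  measurable_fun setT f -> measurable_fun setT g ->
  measurable_fun setT (fun t => dotr (f t) (g t)).
Proof.
move=> mf mg; apply: measurable_sum => i.
by apply: measurable_funM; apply: (measurableT_comp (@measurable_coord R n i)).
Qed.

Lemma integral_lebesgue_rVS m (F : 'rV[R]_m.+1 -> \bar R) :
  measurable_fun setT F -> (forall x, 0 <= F x) ->
  \int[leb m.+1]_x F x = \int[leb m]_y \int[mu]_t F (rV_rcons y t).
Proof.
move=> mF F0.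
transitivity (\int[leb m \x mu]_z F (rV_rcons z.1 z.2)).
  rewrite -(ge0_integral_pushforward (@measurable_rV_rcons R m) (leb m \x mu)%E measurableT)//.
rewrite fubini_tonelli1//; last first.
  by apply: (measurableT_comp mF); exact: measurable_rV_rcons.
Qed.

(** The last coordinate is integrated last: this order suits the slicing of the
half-ball by horizontal hyperplanes in [integral_gnomonic]. *)
Lemma integral_lebesgue_rVS_swap m (F : 'rV[R]_m.+1 -> \bar R) :
  measurable_fun setT F -> (forall x, 0 <= F x) ->
  \int[leb m.+1]_x F x = \int[mu]_t \int[leb m]_y F (rV_rcons y t).
Proof.
move=> mF F0; rewrite integral_lebesgue_rVS//.
apply: (fubini_tonelli (m1 := leb m) (m2 := mu) (fun z => F (rV_rcons z.1 z.2))) => //.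
by apply: (measurableT_comp mF); exact: measurable_rV_rcons.
Qed.

Lemma measurable_fun_slice m (F : 'rV[R]_m.+1 -> \bar R) :
  measurable_fun setT F -> (forall x, 0 <= F x) ->
  measurable_fun setT (fun y => \int[mu]_t F (rV_rcons y t)).
Proof.
move=> mF F0.
apply: (measurable_fun_fubini_tonelli_F (m2 := mu) (fun z => F (rV_rcons z.1 z.2))) => //.
by apply: (measurableT_comp mF); exact: measurable_rV_rcons.
Qed.

Lemma rV_rcons_affine m (y : 'rV[R]_m) t c (a : 'rV[R]_m.+1) :
  (c *: rV_rcons y t + a = rV_rcons (c *: y + rV_belast a) (c * t + rV_last a))%R.
Proof.
apply/rowP => i; rewrite !mxE; case: unliftP => [j ->|->] /=; last by [].
by rewrite !mxE.
Qed.

Lemma integral_affine n (c : R) (a : 'rV[R]_n) (F : 'rV[R]_n -> \bar R) :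
  (c != 0)%R -> measurable_fun setT F -> (forall x, 0 <= F x) ->
  \int[leb n]_x F (c *: x + a)%R = (`|c|^-1 ^+ n)%:E * \int[leb n]_x F x.
Proof.
move=> c0; elim: n a F => [|n IH] a F mF F0.
  rewrite expr0 mul1e; apply: eq_integral => x _; congr (F _).
  by apply/rowP; case.
have maff : measurable_fun setT (fun x : 'rV[R]_n.+1 => c *: x + a)%R.
  by apply: measurable_funD_rV => //; exact: measurable_funZ_rV.
rewrite integral_lebesgue_rVS//; last exact: measurableT_comp.
rewrite integral_lebesgue_rVS//.
have mFs y : measurable_fun setT (fun t : measurableTypeR R => F (rV_rcons y t)).
  by apply: (measurableT_comp mF); exact: measurable_fun_rcons.
transitivity (\int[leb n]_x (`|c|^-1%:E * \int[mu]_t F (rV_rcons (c *: x + rV_belast a)%R t))).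
  apply: eq_integral => y _; under eq_integral do rewrite rV_rcons_affine.
  by rewrite (integral_affine1 _ c0 (mFs (c *: y + rV_belast a)%R)).
rewrite integralZl_setT; last 3 first.
- have mg : measurable_fun setT (fun x : 'rV[R]_n => c *: x + rV_belast a)%R.
    by apply: measurable_funD_rV => //; exact: measurable_funZ_rV.
  exact: (measurableT_comp (measurable_fun_slice mF F0) mg).
- by move=> x; exact: integral_ge0.
- by rewrite invr_ge0.
rewrite (IH _ (fun y => \int[mu]_t F (rV_rcons y t))) ?exprS ?EFinM ?muleA//.
  exact: measurable_fun_slice.
by move=> y; exact: integral_ge0.
Qed.

Lemma integral_translate n (a : 'rV[R]_n) (F : 'rV[R]_n -> \bar R) :
  measurable_fun setT F -> (forall x, 0 <= F x) ->
  \int[leb n]_x F (x + a)%R = \int[leb n]_x F x.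
Proof.
move=> mF F0; have := integral_affine a (oner_neq0 _) mF F0.
rewrite normr1 invr1 expr1n mul1e => <-.
by apply: eq_integral => x _; rewrite scale1r.
Qed.

Lemma integral_rV_opp n (F : 'rV[R]_n -> \bar R) :
  measurable_fun setT F -> (forall x, 0 <= F x) ->
  \int[leb n]_x F (- x)%R = \int[leb n]_x F x.
Proof.
move=> mF F0; have N1 : (-1 != 0 :> R)%R by rewrite oppr_eq0 oner_eq0.
have := integral_affine 0%R N1 mF F0.
rewrite normrN1 invr1 expr1n mul1e => <-.
by apply: eq_integral => x _; rewrite scaleN1r addr0.
Qed.

Lemma dotr_rcons m (y z : 'rV[R]_m) s t :
  (dotr (rV_rcons y s) (rV_rcons z t) = dotr y z + s * t)%R.
Proof.
rewrite /dotr big_ord_recr /=; congr (_ + _)%R; last first.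
  by rewrite !mxE !unlift_none.
apply: eq_bigr => i _; rewrite !mxE.
have -> : widen_ord (leqnSn m) i = lift ord_max i.
  by apply/val_inj; rewrite /= /bump leqNgt ltn_ord.
by rewrite !liftK.
Qed.

Lemma integral_gauss1 (t : R) : (0 < t)%R ->
  \int[mu]_x (expR (- t * x ^+ 2))%:E = (Num.sqrt (pi / t))%:E.
Proof.
move=> t0; have st : (0 < Num.sqrt t)%R by rewrite sqrtr_gt0.
transitivity (\int[mu]_x (gauss_fun (Num.sqrt t * x + 0))%:E).
  apply: eq_integral => x _; rewrite /gauss_fun addr0 exprMn sqr_sqrtr ?ltW//.
  by rewrite mulNr.
rewrite (@integral_affine1 R _ _ (fun x : R => (gauss_fun x)%:E)) ?gt_eqF//; last 2 first.
- by apply/measurable_EFinP; exact: measurable_gauss_fun.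
- by move=> x; rewrite lee_fin gauss_fun_ge0.
rewrite integralT_gauss -EFinM gtr0_norm// sqrtrM ?pi_ge0// sqrtrV ?(ltW t0)//.
by rewrite mulrC.
Qed.

Lemma integral_gauss n (t : R) : (0 < t)%R ->
  \int[leb n]_x (expR (- t * dotr x x))%:E = (Num.sqrt (pi / t) ^+ n)%:E.
Proof.
move=> t0.
have mg k : measurable_fun setT (fun x : 'rV[R]_k => (expR (- t * dotr x x))%:E).
  apply/measurable_EFinP; apply: (measurableT_comp (@measurable_expR R)).
  by apply: measurable_funM => //; exact: measurable_dotr.
elim: n => [|n IH].
  have E : forall x : 'rV[R]_0, (expR (- t * dotr x x))%:E = 1.
    by move=> x; rewrite /dotr big_ord0 mulr0 expR0.
  under eq_integral do rewrite E.
  by rewrite integral_cst//= diracT mul1e expr0.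
rewrite integral_lebesgue_rVS//.
transitivity (\int[leb n]_x ((Num.sqrt (pi / t))%:E * (expR (- t * dotr x x))%:E)).
  apply: eq_integral => y _; rewrite -integral_gauss1// muleC -ge0_integralZl//.
  - by apply: eq_integral => s _; rewrite dotr_rcons mulrDr expRD EFinM -expr2.
  - apply/measurable_EFinP; apply: (measurableT_comp (@measurable_expR R)).
    by apply: measurable_funM => //; exact: measurable_funX.
rewrite integralZl_setT//.
  by rewrite IH exprS EFinM.
exact: mg.
Qed.

(** Invariance of Lebesgue measure under a linear isometry T with T T = 1, without
determinants.  With phi a Gaussian, phi(T x) = phi(x), so
   (\int phi) (\int F o T) = \iint phi(y) F(T x + y) dx dy
                           = \iint phi(y - T x) F(y) dy dx
                           = (\int phi) (\int F),
by translation invariance and Tonelli; the finite positive factor \int phi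
cancels. *)
Lemma integral_isometric_involution n (T : 'rV[R]_n -> 'rV[R]_n)
   (F : 'rV[R]_n -> \bar R) :
  measurable_fun setT T -> involutive T -> {morph T : x y / (x - y)%R} ->
  (forall x, dotr (T x) (T x) = dotr x x) ->
  measurable_fun setT F -> (forall x, 0 <= F x) ->
  \int[leb n]_x F (T x) = \int[leb n]_x F x.
Proof.
move=> mT TK TB Tn mF F0.
(* Any even, T-invariant, integrable function of nonzero integral would do. *)
pose phi (x : 'rV[R]_n) := (expR (- 1 * dotr x x))%:E.
have mphi : measurable_fun setT phi.
  apply/measurable_EFinP; apply: (measurableT_comp (@measurable_expR R)).
  by apply: measurable_funM => //; exact: measurable_dotr.
have phi0 x : 0 <= phi x by rewrite lee_fin expR_ge0.
have phiT x : phi (T x) = phi x by rewrite /phi Tn.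
have phiN x : phi (- x)%R = phi x.
  rewrite /phi; congr (expR _)%:E; congr (_ * _)%R.
  by apply: eq_bigr => i _; rewrite !mxE mulrNN.
have T0 : T 0%R = 0%R by have := TB 0%R 0%R; rewrite !subrr.
have TD x y : (T (x + y) = T x + T y)%R.
  have TN z : (T (- z) = - T z)%R by rewrite -[(- z)%R]sub0r TB T0 sub0r.
  by rewrite -{1}(opprK y) TB TN opprK.
have phiE : \int[leb n]_x phi x = (Num.sqrt (pi / 1) ^+ n)%:E := integral_gauss n ltr01.
have phiI : \int[leb n]_x phi x \is a fin_num.
  by rewrite phiE.
have phi_neq0 : \int[leb n]_x phi x != 0.
  by rewrite phiE eqe expf_neq0// gt_eqF// sqrtr_gt0 divr_gt0// pi_gt0.
suff : \int[leb n]_x phi x * \int[leb n]_x F (T x) = \int[leb n]_x phi x * \int[leb n]_x F x.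
  rewrite -(fineK phiI); move: phi_neq0; rewrite -{1}(fineK phiI) eqe => c0 E.
  have : (fine (\int[leb n]_x phi x))^-1%:E * ((fine (\int[leb n]_x phi x))%:E * \int[leb n]_x F (T x)) =
   (fine (\int[leb n]_x phi x))^-1%:E * ((fine (\int[leb n]_x phi x))%:E * \int[leb n]_x F x).
    by rewrite E.
  by rewrite !muleA -!EFinM mulVf// !mul1e.
have mFT : measurable_fun setT (F \o T) by exact: measurableT_comp.
have mfst : measurable_fun setT (fst : 'rV[R]_n * 'rV[R]_n -> 'rV[R]_n) by exact: measurable_fst.
have msnd : measurable_fun setT (snd : 'rV[R]_n * 'rV[R]_n -> 'rV[R]_n) by exact: measurable_snd.
transitivity (\int[leb n]_y \int[leb n]_x (phi y * F (T x + y)%R)).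
  rewrite muleC -ge0_integralZl//; last exact: integral_ge0.
  apply: eq_integral => y _.
  rewrite muleC -(integral_translate (T y) mFT); last by move=> x; exact: F0.
  have mFy : measurable_fun setT (fun x : 'rV[R]_n => (F \o T) (x + T y)%R).
    by apply: (measurableT_comp mFT) => //; exact: measurable_funD_rV.
  rewrite -(ge0_integralZl (leb n) measurableT mFy (fun x _ => F0 _) (phi0 y)).
  by apply: eq_integral => x _; rewrite /= TD TK.
rewrite (fubini_tonelli (m1 := leb n) (m2 := leb n) (fun z => phi z.1 * F (T z.2 + z.1)%R))/=; last 2 first.
- apply: emeasurable_funM; first exact: (measurableT_comp mphi).
  apply: (measurableT_comp mF); apply: measurable_funD_rV => //.
  exact: (measurableT_comp mT).
- by move=> z; exact: mule_ge0.
transitivity (\int[leb n]_x \int[leb n]_y (phi (y - T x)%R * F y)).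
  apply: eq_integral => x _.
  rewrite -(@integral_translate _ (T x) (fun y => phi (y - T x)%R * F y)) /=.
  - by apply: eq_integral => y _; rewrite addrK addrC.
  - by apply: emeasurable_funM => //; apply: (measurableT_comp mphi); exact: measurable_funB_rV.
  - by move=> y; exact: mule_ge0.
rewrite (fubini_tonelli (m1 := leb n) (m2 := leb n) (fun z => phi (z.2 - T z.1)%R * F z.2))/=; last 2 first.
- apply: emeasurable_funM; last exact: (measurableT_comp mF).
  apply: (measurableT_comp mphi); apply: measurable_funB_rV => //.
  exact: (measurableT_comp mT).
- by move=> z; exact: mule_ge0.
rewrite -ge0_integralZl//; last exact: integral_ge0.
apply: eq_integral => y _.
rewrite muleC -(@integral_translate _ (- T y)%R phi)//.
have mpy : measurable_fun setT (fun x : 'rV[R]_n => phi (x - T y)%R).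
  by apply: (measurableT_comp mphi) => //; exact: measurable_funB_rV.
rewrite -(ge0_integralZl (leb n) measurableT mpy (fun x _ => phi0 _) (F0 y)).
apply: eq_integral => x _; rewrite muleC; congr (_ * _).
by rewrite -phiT TB TK -opprB phiN.
Qed.

(** The balls of the sup norm, written with coordinates. *)
Definition cube n (a : 'rV[R]_n) (d : R) : set 'rV[R]_n :=
  [set x | forall i, (`|x ord0 i - a ord0 i| < d)%R].

Lemma measurable_cube n (a : 'rV[R]_n) d : measurable (cube a d).
Proof.
have -> : cube a d = \bigcap_(i in [set: 'I_n]) ((fun x => x ord0 i) @^-1` (ball (a ord0 i) d)).
  apply/seteqP; split => x /= H i; first by move=> _; rewrite /= /ball /= distrC.
  by have := H i I; rewrite /= /ball /= distrC.
apply: fin_bigcap_measurable => [|i _]; first exact: finite_finset.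
rewrite -[X in measurable X]setTI.
by apply: measurable_coord => //; exact: measurable_ball.
Qed.

Lemma lebesgue_cube n (a : 'rV[R]_n) d : (0 <= d)%R ->
  leb n (cube a d) = ((d *+ 2) ^+ n)%:E.
Proof.
move=> d0; elim: n a => [|n IH] a.
  rewrite expr0 /= (_ : cube a d = setT) ?diracT//.
  by apply/seteqP; split => // x _ [].
rewrite /= /lebesgue_rV_step /pushforward.
rewrite (_ : _ @^-1` _ = cube (rV_belast a) d `*` ball (rV_last a) d); last first.
  apply/seteqP; split => -[y t] /=.
    move=> H; split => [i|]; last first.
      by have := H ord_max; rewrite mxE unlift_none /ball /= distrC.
    by have := H (lift ord_max i); rewrite !mxE liftK.
  move=> [H1 H2] i; rewrite !mxE; case: unliftP => [j ->|->]/=.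
    by have := H1 j; rewrite mxE.
  by rewrite distrC.
rewrite product_measure1E//; [|exact: measurable_cube|exact: measurable_ball].
rewrite exprSr EFinM; congr (_ * _); first exact: IH.
exact: lebesgue_measure_ball.
Qed.

End lebesgue_rV_theory.

(** * The Gamma function and the integral of (1 + |u|^2)^-s *)

Section gamma.
Context {R : realType}.
Local Notation leb := (lebesgue_rV R).
Local Notation mu := (@lebesgue_measure R).

Lemma integral_if d (T : measurableType d) (m : {measure set T -> \bar R})
    (P : pred T) (f : T -> R) :
  (\int[m]_x (if P x then f x else 0)%:E = \int[m]_(x in [set x | P x]) (f x)%:E)%E.
Proof.
rewrite [RHS]integral_mkcond; apply: eq_integral => x _; rewrite patchE.
by case: (boolP (P x)) => [Px|/negP Px]; [rewrite mem_set|rewrite memNset].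
Qed.

Lemma integral_if_ge (a : R) (f : R -> R) :
  (\int[mu]_x (if (a <= x)%R then f x else 0%R)%:E = \int[mu]_(x in `[a, +oo[) (f x)%:E)%E.
Proof.
rewrite [LHS](integral_if mu (fun x : R => a <= x)).
rewrite (_ : [set x | _] = `[a, +oo[%classic)//.
by apply/seteqP; split => x /=; rewrite in_itv/= andbT.
Qed.

Definition gamma_fun (s t : R) : R :=
  if 0 < t then t `^ (s - 1) * expR (- t) else 0.

(** The Gamma integral as an extended real, so that Tonelli's theorem applies
without a preliminary proof of convergence. *)
Definition egamma (s : R) : \bar R := (\int[mu]_t (gamma_fun s t)%:E)%E.

Lemma GammaE s : Gamma s = fine (egamma s).
Proof.
rewrite /Gamma /Rintegral /egamma; congr (fine _).
rewrite [RHS](integral_if mu (fun t : R => 0 < t) (fun t => t `^ (s - 1) * expR (- t))).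
rewrite (_ : `]0, +oo[%classic = [set x : R | 0 < x])//.
by apply/seteqP; split => x /=; rewrite in_itv/= andbT.
Qed.

Lemma gamma_fun_ge0 s t : 0 <= gamma_fun s t.
Proof. by rewrite /gamma_fun; case: ifP => // _; rewrite mulr_ge0 ?powR_ge0 ?expR_ge0. Qed.

Lemma measurable_if_gt0 d (T : measurableType d) (g h : T -> R) :
  measurable_fun setT g -> measurable_fun setT h ->
  measurable_fun setT (fun x => if 0 < g x then h x else 0).
Proof.
move=> mg mh; apply: measurable_fun_ifT => //.
exact: measurable_fun_ltr.
Qed.

Lemma measurable_funpowR d (T : measurableType d) (g : T -> R) (a : R) :
  measurable_fun setT g -> measurable_fun setT (fun x => g x `^ a).
Proof. by move=> mg; apply: (measurableT_comp (@measurable_powR R a)). Qed.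

Lemma measurable_funexpR d (T : measurableType d) (g : T -> R) :
  measurable_fun setT g -> measurable_fun setT (fun x => expR (g x)).
Proof. by move=> mg; apply: (measurableT_comp (@measurable_expR R)). Qed.

Lemma measurable_gamma_fun s : measurable_fun setT (gamma_fun s).
Proof.
apply: measurable_if_gt0 => //; apply: measurable_funM.
  exact: measurable_funpowR.
by apply: measurable_funexpR; exact: measurable_funN.
Qed.

(** The form of the fundamental theorem on a half-line used below: a primitive with
a limit at infinity. *)
Lemma integral_FTCy (f F : R -> R) (a l : R) :
  (forall x, a <= x -> 0 <= f x) ->
  (forall x, a <= x -> is_derive x 1 F (f x)) ->
  (forall x, a <= x -> derivable f x 1) ->
  F x @[x --> +oo] --> l ->
  (\int[mu]_(x in `[a, +oo[) (f x)%:E = (l - F a)%:E)%E.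
Proof.
move=> f0 dF df Fl; rewrite (ge0_continuous_FTC2y f0 _ Fl) ?EFinB//.
- apply: derivable_within_continuous => x; rewrite in_itv/= andbT; exact: df.
- by move=> x /ltW ax; apply: ex_derive; exact: dF.
- apply: cvg_at_right_filter; apply: differentiable_continuous.
  by apply/derivable1_diffP; apply: ex_derive; apply: dF.
- move=> x; rewrite in_itv/= andbT => /ltW ax; rewrite derive1E.
  by have [_ ->] := dF x ax.
Qed.

Lemma is_derive_expRNM (l x : R) :
  is_derive x 1 (fun t => expR (- (l * t))) (- l * expR (- (l * x))).
Proof.
have dl : is_derive x 1 (fun t : R => - (l * t)) (- l).
  have -> : (fun t : R => - (l * t)) = (- l \*: id).
    by apply/funext => t /=; rewrite -mulNr.
  by apply: is_derive_eq; rewrite /= /GRing.scale/= mulr1.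
have := @is_derive1_comp _ expR (fun t : R => - (l * t)) x _ _ (is_derive_expR _) dl.
by rewrite mulrC.
Qed.

Lemma cvg_expRNM (l : R) : 0 < l -> expR (- (l * x)) @[x --> +oo] --> (0 : R).
Proof.
move=> l0; apply: (@cvg_comp _ _ _ (fun x => l * x) (fun y => expR (- y)) _ (pinfty_nbhs R)).
  under eq_fun do rewrite mulrC; apply: (@gt0_cvgMly _ (pinfty_nbhs R) _ _ id) => //.
exact: cvgr_expR.
Qed.

Lemma integral_expR_y (a l : R) : 0 < l ->
  (\int[mu]_(t in `[a, +oo[) (expR (- (l * t)))%:E = (expR (- (l * a)) / l)%:E)%E.
Proof.
move=> l0.
transitivity (0 - (- l^-1 * expR (- (l * a))))%:E; last first.
  by rewrite sub0r mulNr opprK mulrC.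
apply: (@integral_FTCy _ (fun t => - l^-1 * expR (- (l * t)))).
- by move=> x _; exact: expR_ge0.
- move=> x _; have dE := is_derive_expRNM l x.
  rewrite (_ : (fun t => _) = (- l^-1 \*: (fun t => expR (- (l * t)))))//.
  by apply: is_derive_eq; rewrite /GRing.scale/= mulrA mulrNN mulVf ?mul1r// gt_eqF.
- by move=> x _; apply: ex_derive; exact: is_derive_expRNM.
- rewrite -[X in _ --> X](mulr0 (- l^-1)); apply: cvgM; first exact: cvg_cst.
  exact: cvg_expRNM.
Qed.

Lemma cvg_powRN (a : R) : 0 < a -> x `^ (- a) @[x --> +oo] --> (0 : R).
Proof.
move=> a0; apply/cvgrPdist_le => e e0; near=> x.
rewrite sub0r normrN ger0_norm ?powR_ge0// powRN invf_ple ?posrE//; last first.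
  by rewrite powR_gt0//; near: x; exact: nbhs_pinfty_gt.
have -> : e^-1 = ((e^-1) `^ a^-1) `^ a.
  by rewrite -powRrM mulVf ?gt_eqF// powRr1// invr_ge0 ltW.
apply: ge0_ler_powR; rewrite ?nnegrE ?powR_ge0 ?(ltW a0)//.
Unshelve. all: by end_near. Qed.

Lemma integral_powRN_1y (s : R) : 1 < s ->
  (\int[mu]_(x in `[1%R, +oo[) (x `^ (- s))%:E = ((s - 1)^-1)%:E)%E.
Proof.
move=> s1; have s10 : s - 1 != 0 by rewrite gt_eqF// subr_gt0.
transitivity (0 - (- (s - 1)^-1 * 1 `^ (- (s - 1))))%:E; last first.
  by rewrite powR1 mulr1 sub0r opprK.
apply: (@integral_FTCy (fun x => x `^ (- s)) (fun t => - (s - 1)^-1 * t `^ (- (s - 1))) 1 0).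
- by move=> x _; exact: powR_ge0.
- move=> x x1; have x0 : 0 < x by exact: lt_le_trans x1.
  have dE := is_derive1_powR (- (s - 1)) x0.
  rewrite (_ : (fun t => _) = (- (s - 1)^-1 \*: (@powR R ^~ (- (s - 1)))))//.
  apply: is_derive_eq; rewrite /GRing.scale/= mulrA mulrNN mulVf// mul1r.
  by congr (_ `^ _); ring.
- move=> x x1; have x0 : 0 < x by exact: lt_le_trans x1.
  by apply: ex_derive; exact: is_derive1_powR.
- rewrite -[X in _ --> X](mulr0 (- (s - 1)^-1)); apply: cvgM; first exact: cvg_cst.
  by apply: cvg_powRN; rewrite subr_gt0.
Qed.

Lemma gamma_fun_scale (s l t : R) : 0 < l ->
  gamma_fun s (l * t) = l `^ (s - 1) * (if 0 < t then t `^ (s - 1) * expR (- (l * t)) else 0).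
Proof.
move=> l0; rewrite /gamma_fun pmulr_rgt0//; case: ifPn => [t0|_]; last by rewrite mulr0.
by rewrite powRM ?ltW// mulrA.
Qed.

Lemma egamma_scale (s l : R) : 0 < l ->
  (\int[mu]_t (if (0 < t)%R then (t `^ (s - 1) * expR (- (l * t)))%R else 0%R)%:E =
   (l `^ (- s))%:E * egamma s)%E.
Proof.
move=> l0.
have E := @integral_affine1 R l 0 (fun t => (gamma_fun s t)%:E) (lt0r_neq0 l0).
rewrite /egamma.
transitivity ((l `^ (1 - s))%:E * \int[mu]_t (gamma_fun s (l * t + 0))%:E)%E.
  rewrite -integralZl_setT ?powR_ge0//.
  - apply: eq_integral => t _; rewrite addr0 gamma_fun_scale// -EFinM mulrA.
    rewrite -powRD; last by rewrite (gt_eqF l0) implybT.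
    by rewrite (_ : 1 - s + (s - 1) = 0) ?powRr0 ?mul1r//; ring.
  - apply/measurable_EFinP; apply: (measurableT_comp (measurable_gamma_fun s)).
    exact: measurable_affine1.
  - by move=> t; rewrite lee_fin gamma_fun_ge0.
rewrite E; last 2 first.
- by apply/measurable_EFinP; exact: measurable_gamma_fun.
- by move=> t; rewrite lee_fin gamma_fun_ge0.
rewrite muleA -EFinM; congr (_%:E * _)%E; rewrite gtr0_norm// -powR_inv1 ?ltW//.
rewrite -powRD; last by rewrite (gt_eqF l0) implybT.
by congr (_ `^ _); ring.
Qed.

Lemma egamma_ge0 s : (0 <= egamma s)%E.
Proof. by apply: integral_ge0 => t _; rewrite lee_fin gamma_fun_ge0. Qed.

(** The functional equation of Gamma by Tonelli instead of integration by parts: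
1 / (s - 1) = \int_1^oo x^-s dx and Gamma(s) x^-s = \int t^(s - 1) exp(- x t) dt;
integrating in x over [1, oo[ first leaves \int t^(s - 2) exp(- t) dt. *)
Lemma egamma_sub1 (s : R) : 1 < s ->
  (egamma (s - 1) = egamma s * ((s - 1)^-1)%:E)%E.
Proof.
move=> s1; rewrite -integral_powRN_1y// -ge0_integralZl//; last 3 first.
- by apply/measurable_EFinP; apply: measurable_funTS; exact: measurable_funpowR.
- by move=> x _; rewrite lee_fin powR_ge0.
- exact: egamma_ge0.
(* The Tonelli integrand: z.1 is the variable of the power integral, z.2 that of
   the Gamma integral. *)
pose h (z : R * R) := if 1 <= z.1 then (if 0 < z.2 then z.2 `^ (s - 1) * expR (- (z.1 * z.2)) else 0) else 0.
have h0 z : 0 <= h z.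
  by rewrite /h; do 2 case: ifP => // _; rewrite mulr_ge0 ?powR_ge0 ?expR_ge0.
have mfst : measurable_fun setT (fst : measurableTypeR R * measurableTypeR R -> R) by exact: measurable_fst.
have msnd : measurable_fun setT (snd : measurableTypeR R * measurableTypeR R -> R) by exact: measurable_snd.
have mh : measurable_fun setT (fun z : measurableTypeR R * measurableTypeR R => (h z)%:E).
  apply/measurable_EFinP; apply: measurable_fun_ifT => //.
    exact: measurable_fun_ler.
  apply: measurable_if_gt0 => //; apply: measurable_funM.
    exact: measurable_funpowR.
  apply: measurable_funexpR; apply: measurable_funN.
  exact: measurable_funM.
transitivity (\int[mu]_x \int[mu]_t (h (x, t))%:E)%E; last first.
  rewrite [RHS]integral_mkcond; apply: eq_integral => x _; rewrite patchE /h /=.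
  rewrite mem_setE in_itv/= andbT; case: ifPn => x1.
    have x0 : 0 < x by exact: lt_le_trans x1.
    by rewrite egamma_scale// muleC.
  by rewrite integral0.
rewrite (fubini_tonelli (m1 := mu) (m2 := mu) (fun z => (h z)%:E))//.
apply: eq_integral => t _; rewrite /h/= /gamma_fun; case: ifPn => t0; last first.
  by under [RHS]eq_integral do rewrite if_same; rewrite integral0.
rewrite integral_if_ge.
under eq_integral do rewrite EFinM [X in expR (- X)]mulrC.
rewrite ge0_integralZl//; last 2 first.
- apply/measurable_EFinP; apply: measurable_funTS; apply: measurable_funexpR.
  by apply: measurable_funN; exact: measurable_funM.
- by rewrite lee_fin powR_ge0.
rewrite integral_expR_y// mulr1 -EFinM mulrA [in RHS]mulrAC; congr (_ * _)%:E.
rewrite -[t^-1]powR_inv1 ?ltW// -powRD//.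
by rewrite (gt_eqF t0) implybT.
Qed.

(** From t / (2 k) <= exp (t / (2 k)), raised to the power k. *)
Lemma powR_le_expR (k t : R) : 0 < k -> 0 <= t -> t `^ k <= (2 * k) `^ k * expR (t / 2).
Proof.
move=> k0 t0; have -> : t / 2 = (t / (2 * k)) * k by field; rewrite gt_eqF.
have -> : expR (t / (2 * k) * k) = (expR (t / (2 * k))) `^ k by rewrite expRM.
rewrite -powRM ?expR_ge0//; last by rewrite mulr_ge0// ltW.
apply: ge0_ler_powR; rewrite ?nnegrE//; first exact: ltW.
  by rewrite mulr_ge0 ?expR_ge0// mulr_ge0// ltW.
rewrite mulrC -ler_pdivrMr ?mulr_gt0//.
by apply: le_trans (expR_ge1Dx _); rewrite lerDr.
Qed.

(** The integrand is dominated by a multiple of exp(- t / 2). *)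
Lemma egamma_fin (s : R) : 1 < s -> egamma s \is a fin_num.
Proof.
move=> s1; rewrite ge0_fin_numE ?egamma_ge0//.
have k0 : 0 < s - 1 by rewrite subr_gt0.
set C := (2 * (s - 1)) `^ (s - 1).
apply: (@le_lt_trans _ _ (\int[mu]_t (C%:E * (if 0 <= t then expR (- (2^-1 * t)) else 0)%:E))%E).
  apply: ge0_le_integral => //.
  - by move=> t _; rewrite lee_fin gamma_fun_ge0.
  - by apply/measurable_EFinP; exact: measurable_gamma_fun.
  - apply: measurable_funeM; apply/measurable_EFinP; apply: measurable_fun_ifT => //.
      exact: measurable_fun_ler.
    by apply: measurable_funexpR; apply: measurable_funN; exact: measurable_funM.
  - move=> t _; rewrite -EFinM lee_fin /gamma_fun; case: ifPn => t0; last first.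
      by rewrite mulr_ge0 ?powR_ge0//; case: ifP => // _; exact: expR_ge0.
    rewrite (ltW t0).
    apply: le_trans (ler_wpM2r (expR_ge0 _) (powR_le_expR k0 (ltW t0))) _.
    rewrite -mulrA -expRD /C ler_wpM2l ?powR_ge0// ler_expR.
    by rewrite (_ : t / 2 - t = - (2^-1 * t))//; field.
rewrite integralZl_setT; last 3 first.
- apply/measurable_EFinP; apply: measurable_fun_ifT => //.
    exact: measurable_fun_ler.
  by apply: measurable_funexpR; apply: measurable_funN; exact: measurable_funM.
- by move=> t; rewrite lee_fin; case: ifP => // _; exact: expR_ge0.
- exact: powR_ge0.
rewrite integral_if_ge.
by rewrite integral_expR_y// -EFinM ltry.
Qed.

Lemma GammaS (s : R) : 1 < s -> Gamma (s + 1) = s * Gamma s.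
Proof.
move=> s1; have s2 : 1 < s + 1 by rewrite ltrDr; exact: lt_trans s1.
have := egamma_sub1 s2; rewrite addrK !GammaE => ->.
rewrite fineM//; last exact: egamma_fin.
by rewrite /= mulrC mulfVK// gt_eqF//; exact: lt_trans s1.
Qed.

(** For t >= 1 the integrand is at least exp(- t). *)
Lemma Gamma_gt0 (s : R) : 1 < s -> 0 < Gamma s.
Proof.
move=> s1; rewrite GammaE; apply: fine_gt0; rewrite -ge0_fin_numE ?egamma_ge0//.
rewrite egamma_fin// andbT.
apply: (@lt_le_trans _ _ (\int[mu]_t (if 1 <= t then expR (- (1 * t)) else 0)%:E)%E).
  rewrite integral_if_ge.
  by rewrite integral_expR_y// lte_fin divr_gt0// expR_gt0.
apply: ge0_le_integral => //.
- by move=> t _; rewrite lee_fin; case: ifP => // _; exact: expR_ge0.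
- apply/measurable_EFinP; apply: measurable_fun_ifT => //.
    exact: measurable_fun_ler.
  by apply: measurable_funexpR; apply: measurable_funN; exact: measurable_funM.
- by apply/measurable_EFinP; exact: measurable_gamma_fun.
- move=> t _; rewrite lee_fin; case: ifPn => t1; last exact: gamma_fun_ge0.
  rewrite /gamma_fun (lt_le_trans ltr01 t1) mul1r ler_peMl ?expR_ge0//.
  rewrite -[leLHS](powRr0 t); apply: ler_powR => //.
  by rewrite subr_ge0 ltW.
Qed.

(** Write sqrt t as the length of ]0, sqrt t] and exchange the integrals: the
integral of exp(- t) over t >= u^2 is exp(- u^2), so Gamma(3/2) is the Gaussian
integral over the half-line. *)
Lemma Gamma32 : Gamma (3 / 2) = Num.sqrt pi / 2 :> R.
Proof.
rewrite GammaE; suff -> : egamma (3 / 2) = (Num.sqrt pi / 2)%:E by [].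
(* z.1 is the variable of the Gamma integral, z.2 ranges over ]0, sqrt z.1]. *)
pose h (z : R * R) := if 0 < z.2 then (if z.2 ^+ 2 <= z.1 then expR (- (1 * z.1)) else 0) else 0.
have h0 z : 0 <= h z.
  by rewrite /h; do 2 case: ifP => // _; rewrite expR_ge0.
have mfst : measurable_fun setT (fst : measurableTypeR R * measurableTypeR R -> R) by exact: measurable_fst.
have msnd : measurable_fun setT (snd : measurableTypeR R * measurableTypeR R -> R) by exact: measurable_snd.
have mh : measurable_fun setT (fun z : measurableTypeR R * measurableTypeR R => (h z)%:E).
  apply/measurable_EFinP; apply: measurable_if_gt0 => //.
  apply: measurable_fun_ifT => //.
    by apply: measurable_fun_ler => //; exact: measurable_funX.
  apply: measurable_funexpR; apply: measurable_funN.
  exact: measurable_funM.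
transitivity (\int[mu]_t \int[mu]_u (h (t, u))%:E)%E.
  apply: eq_integral => t _.
  transitivity (\int[mu]_u ((expR (- t))%:E * (\1_(`]0, Num.sqrt t]%classic : set R) u)%:E))%E.
    rewrite integralZl_setT ?expR_ge0//; last first.
      by apply/measurable_EFinP; exact: measurable_indic.
    have -> : (\int[mu]_u (\1_(`]0%R, Num.sqrt t]%classic : set R) u)%:E = (Num.sqrt t)%:E)%E.
      rewrite integral_indic// setIT.
      apply: (eq_trans (lebesgue_measure_itv `]0, Num.sqrt t])).
      rewrite /= lte_fin sqrtr_gt0; case: ltP => t0; first by rewrite -EFinB subr0.
      by rewrite ler0_sqrtr.
    rewrite /gamma_fun -EFinM; case: ltP => t0; last by rewrite ler0_sqrtr// mulr0.
    rewrite mulrC; congr (_ * _)%:E.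
    by rewrite -powR12_sqrt ?ltW//; congr (_ `^ _); field.
  apply: eq_integral => u _; rewrite -EFinM /h/= indicE mem_setE in_itv/=.
  congr _%:E; case: (ltP 0 u) => u0/=; last by rewrite mulr0.
  have -> : (u <= Num.sqrt t) = (u ^+ 2 <= t).
    have [t0|t0] := ltP t 0.
      rewrite ltr0_sqrtr// leNgt u0/=; apply/esym/negbTE; rewrite -ltNge.
      by rewrite (lt_le_trans t0)// sqr_ge0.
    by rewrite -(@ler_sqrt _ (u ^+ 2))// sqrtr_sqr gtr0_norm.
  by case: ifP => _; rewrite ?mulr1 ?mul1r ?mulr0.
rewrite (fubini_tonelli (m1 := mu) (m2 := mu) (fun z => (h z)%:E))//.
rewrite -(@integral0y_gauss R) -integral_itv_obnd_cbnd//; last first.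
  by apply/measurable_EFinP; apply: measurable_funTS; exact: measurable_gauss_fun.
rewrite [RHS]integral_mkcond; apply: eq_integral => u _.
rewrite patchE mem_setE in_itv/= andbT /h/=; case: ifPn => u0; last by rewrite integral0.
rewrite integral_if_ge.
by rewrite integral_expR_y// mul1r divr1.
Qed.

(** A power of the Japanese bracket of u. *)
Definition japan m (s : R) (u : 'rV[R]_m) : R := (1 + dotr u u) `^ (- s).

Lemma dotr_ge0 m (u : 'rV[R]_m) : 0 <= dotr u u.
Proof. by apply: sumr_ge0 => i _; rewrite -expr2 sqr_ge0. Qed.

(** Gamma(s) (1 + |u|^2)^-s = \int t^(s - 1) exp(- (1 + |u|^2) t) dt; integrating in
u first gives the Gaussian factor (pi / t)^(m / 2). *)
Lemma integral_japan m (s : R) : 0 < s ->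
  (egamma s * \int[leb m]_u (japan s u)%:E =
   ((Num.sqrt pi) ^+ m)%:E * egamma (s - m%:R / 2))%E.
Proof.
move=> s0.
have mj : measurable_fun setT (fun u : 'rV[R]_m => 1 + dotr u u).
  by apply: measurable_funD => //; exact: measurable_dotr.
rewrite -ge0_integralZl//; last 3 first.
- by apply/measurable_EFinP; exact: measurable_funpowR.
- by move=> u _; rewrite lee_fin powR_ge0.
- exact: egamma_ge0.
pose h (z : 'rV[R]_m * R) := if 0 < z.2 then z.2 `^ (s - 1) * expR (- ((1 + dotr z.1 z.1) * z.2)) else 0.
have h0 z : 0 <= h z.
  by rewrite /h; case: ifP => // _; rewrite mulr_ge0 ?powR_ge0 ?expR_ge0.
have mfst : measurable_fun setT (fst : 'rV[R]_m * measurableTypeR R -> 'rV[R]_m) by exact: measurable_fst.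
have msnd : measurable_fun setT (snd : 'rV[R]_m * measurableTypeR R -> R) by exact: measurable_snd.
have mh : measurable_fun setT (fun z : 'rV[R]_m * measurableTypeR R => (h z)%:E).
  apply/measurable_EFinP; apply: measurable_if_gt0 => //.
  apply: measurable_funM; first exact: measurable_funpowR.
  apply: measurable_funexpR; apply: measurable_funN.
  by apply: measurable_funM => //; exact: (measurableT_comp mj).
transitivity (\int[leb m]_u \int[mu]_t (h (u, t))%:E)%E.
  apply: eq_integral => u _; rewrite /h/= egamma_scale; last first.
    by rewrite (lt_le_trans ltr01)// lerDl dotr_ge0.
  by rewrite muleC.
rewrite (fubini_tonelli (m1 := leb m) (m2 := mu) (fun z => (h z)%:E))//.
rewrite -integralZl_setT; last 3 first.
- by apply/measurable_EFinP; exact: measurable_gamma_fun.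
- by move=> t; rewrite lee_fin gamma_fun_ge0.
- by rewrite exprn_ge0// sqrtr_ge0.
apply: eq_integral => t _; rewrite /h/= /gamma_fun; case: ifPn => t0; last first.
  by rewrite mule0 integral0.
transitivity (\int[leb m]_u ((t `^ (s - 1) * expR (- t))%:E * (expR (- t * dotr u u))%:E))%E.
  apply: eq_integral => u _; rewrite -EFinM -mulrA -expRD.
  by congr (_ * expR _)%:E; ring.
rewrite integralZl_setT; last 3 first.
- apply/measurable_EFinP; apply: measurable_funexpR.
  by apply: measurable_funM => //; exact: measurable_dotr.
- by move=> u; rewrite lee_fin expR_ge0.
- by rewrite mulr_ge0 ?powR_ge0 ?expR_ge0.
rewrite integral_gauss// -!EFinM; congr _%:E.
rewrite sqrtrM ?pi_ge0// exprMn mulrCA -!mulrA; congr (_ * _).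
rewrite mulrCA [RHS]mulrC; congr (_ * _).
rewrite -powR12_sqrt ?invr_ge0 ?(ltW t0)// -powR_inv1 ?(ltW t0)// -powRrM.
rewrite -powR_mulrn ?powR_ge0// -powRrM -powRD; last by rewrite (gt_eqF t0) implybT.
by congr (_ `^ _); field.
Qed.

End gamma.

(** * Euclidean geometry of row vectors *)

Section euclid.
Context {R : realType}.

Lemma dotrC n (u v : 'rV[R]_n) : dotr u v = dotr v u.
Proof. by apply: eq_bigr => i _; rewrite mulrC. Qed.

Lemma dotrDl n (u v w : 'rV[R]_n) : dotr (u + v) w = dotr u w + dotr v w.
Proof. by rewrite /dotr -big_split/=; apply: eq_bigr => i _; rewrite mxE mulrDl. Qed.

Lemma dotrZl n a (u w : 'rV[R]_n) : dotr (a *: u) w = a * dotr u w.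
Proof. by rewrite /dotr mulr_sumr; apply: eq_bigr => i _; rewrite mxE mulrA. Qed.

Lemma dotrNl n (u w : 'rV[R]_n) : dotr (- u) w = - dotr u w.
Proof. by rewrite -scaleN1r dotrZl mulN1r. Qed.

Lemma dotrBl n (u v w : 'rV[R]_n) : dotr (u - v) w = dotr u w - dotr v w.
Proof. by rewrite dotrDl dotrNl. Qed.

Lemma dotrDr n (w u v : 'rV[R]_n) : dotr w (u + v) = dotr w u + dotr w v.
Proof. by rewrite dotrC dotrDl !(dotrC w). Qed.

Lemma dotrZr n a (w u : 'rV[R]_n) : dotr w (a *: u) = a * dotr w u.
Proof. by rewrite dotrC dotrZl dotrC. Qed.

Lemma dotrNr n (w u : 'rV[R]_n) : dotr w (- u) = - dotr w u.
Proof. by rewrite dotrC dotrNl dotrC. Qed.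

Lemma dotrBr n (w u v : 'rV[R]_n) : dotr w (u - v) = dotr w u - dotr w v.
Proof. by rewrite dotrDr dotrNr. Qed.

Lemma dotr_eq0 n (u : 'rV[R]_n) : dotr u u = 0 -> u = 0.
Proof.
move=> /eqP; rewrite psumr_eq0 => [/allP H|i _]; last by rewrite -expr2 sqr_ge0.
apply/rowP => i; rewrite mxE; have := H i (mem_index_enum _).
by rewrite -expr2 sqrf_eq0 => /eqP.
Qed.

Lemma enorm_ge0 n (u : 'rV[R]_n) : 0 <= enorm u.
Proof. exact: sqrtr_ge0. Qed.

Lemma enorm_sqr n (u : 'rV[R]_n) : enorm u ^+ 2 = dotr u u.
Proof. by rewrite sqr_sqrtr// dotr_ge0. Qed.

Lemma enorm_eq0 n (u : 'rV[R]_n) : (enorm u == 0) = (u == 0).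
Proof.
apply/eqP/eqP => [u0|->]; first by apply: dotr_eq0; rewrite -enorm_sqr u0 expr0n.
by rewrite /enorm /dotr big1 ?sqrtr0// => i _; rewrite mxE mul0r.
Qed.

Lemma enorm_gt0 n (u : 'rV[R]_n) : (0 < enorm u) = (u != 0).
Proof. by rewrite lt_neqAle enorm_ge0 andbT eq_sym enorm_eq0. Qed.

Lemma enormZ n a (u : 'rV[R]_n) : enorm (a *: u) = `|a| * enorm u.
Proof. by rewrite /enorm dotrZl dotrZr mulrA -expr2 sqrtrM ?sqr_ge0// sqrtr_sqr. Qed.

Lemma enormN n (u : 'rV[R]_n) : enorm (- u) = enorm u.
Proof. by rewrite /enorm dotrNl dotrNr opprK. Qed.

(** The squared norm of u minus its projection on v is nonnegative. *)
Lemma Cauchy_Schwarz_dotr n (u v : 'rV[R]_n) : `|dotr u v| <= enorm u * enorm v.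
Proof.
have [->|v0] := eqVneq v 0.
  rewrite /dotr big1 ?normr0 ?mulr_ge0 ?enorm_ge0// => i _.
  by rewrite mxE mulr0.
have v2 : 0 < dotr v v by rewrite -enorm_sqr exprn_gt0// enorm_gt0.
rewrite -(@ler_pXn2r _ 2)// ?nnegrE ?mulr_ge0 ?enorm_ge0//.
rewrite exprMn !enorm_sqr -normrX ger0_norm ?sqr_ge0//.
have := dotr_ge0 (u - (dotr u v / dotr v v) *: v).
rewrite dotrBl !dotrBr !dotrZl !dotrZr (dotrC v u) => H.
rewrite -ler_pdivrMr// -subr_ge0; apply: le_trans H _.
rewrite le_eqVlt; apply/orP; left; apply/eqP.
by field; rewrite gt_eqF.
Qed.

Lemma rV_lastE m (x : 'rV[R]_m.+1) : dotr x (e_last R m) = rV_last x.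
Proof.
rewrite /dotr (bigD1 ord_max)//= big1 => [|i /negbTE i_max].
  by rewrite mxE !eqxx mulr1 addr0.
by rewrite mxE i_max andbF mulr0.
Qed.

Lemma dotr_e_last m : dotr (e_last R m) (e_last R m) = 1.
Proof. by rewrite rV_lastE /rV_last mxE !eqxx. Qed.

Lemma enorm_e_last m : enorm (e_last R m) = 1.
Proof. by rewrite /enorm dotr_e_last sqrtr1. Qed.

Lemma rV_lastZ m c (x : 'rV[R]_m.+1) : rV_last (c *: x) = c * rV_last x.
Proof. by rewrite /rV_last mxE. Qed.

Lemma rV_lastN m (x : 'rV[R]_m.+1) : rV_last (- x) = - rV_last x.
Proof. by rewrite /rV_last mxE. Qed.

Lemma rV_last_le_enorm m (x : 'rV[R]_m.+1) : `|rV_last x| <= enorm x.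
Proof.
by rewrite -rV_lastE; apply: le_trans (Cauchy_Schwarz_dotr _ _) _; rewrite enorm_e_last mulr1.
Qed.

Lemma radial_projZ n c (x : 'rV[R]_n) : 0 < c -> radial_proj (c *: x) = radial_proj x.
Proof.
move=> c0; rewrite /radial_proj enormZ gtr0_norm// scalerA invfM.
by rewrite mulrAC mulVf ?mul1r// gt_eqF.
Qed.

Lemma radial_projN n (x : 'rV[R]_n) : radial_proj (- x) = - radial_proj x.
Proof. by rewrite /radial_proj enormN scalerN. Qed.

Lemma enorm_radial_proj n (x : 'rV[R]_n) : x != 0 -> enorm (radial_proj x) = 1.
Proof.
move=> x0; rewrite /radial_proj enormZ ger0_norm ?invr_ge0 ?enorm_ge0//.
by rewrite mulVf// enorm_eq0.
Qed.

Lemma rV_last_radial_proj m (x : 'rV[R]_m.+1) : rV_last (radial_proj x) = rV_last x / enorm x.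
Proof. by rewrite rV_lastZ mulrC. Qed.

Lemma hemisphere_radial_proj m (x : 'rV[R]_m.+1) :
  (radial_proj x \in hemisphere R m) = (0 < rV_last x).
Proof.
apply/idP/idP; rewrite inE /hemisphere /sphere /halfspace/=.
  move=> [_]; rewrite rV_last_radial_proj.
  have [->|x0] := eqVneq x 0; first by rewrite /rV_last mxE mul0r.
  by rewrite pmulr_lgt0// invr_gt0 enorm_gt0.
move=> x_gt0; have x0 : x != 0.
  by apply: contraTneq x_gt0 => ->; rewrite /rV_last mxE ltxx.
split; first exact: enorm_radial_proj.
by rewrite rV_last_radial_proj divr_gt0// enorm_gt0.
Qed.

Lemma measurable_funlast d (T : measurableType d) m (f : T -> 'rV[R]_m.+1) :
  measurable_fun setT f -> measurable_fun setT (fun t => rV_last (f t)).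
Proof. by move=> mf; apply: (measurableT_comp (@measurable_coord R m.+1 ord_max)). Qed.

Lemma measurable_funenorm d (T : measurableType d) m (f : T -> 'rV[R]_m) :
  measurable_fun setT f -> measurable_fun setT (fun t => enorm (f t)).
Proof. by move=> mf; apply: (measurableT_comp (@measurable_enorm R m)). Qed.

Lemma measurable_hemisphere m : measurable (hemisphere R m).
Proof.
apply: measurableI.
  have -> : sphere R m.+1 = @enorm R m.+1 @^-1` [set 1] by [].
  by rewrite -[X in measurable X]setTI; exact: measurable_enorm.
have -> : halfspace R m = @rV_last R m @^-1` `]0, +oo[.
  by apply/seteqP; split => x /=; rewrite /halfspace /= in_itv/= andbT.
by rewrite -[X in measurable X]setTI; exact: measurable_coord.
Qed.

End euclid.

(** * Householder reflections *)

Section householder.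
Context {R : realType} (n : nat).
Implicit Types x y z w e : 'rV[R]_n.

(** The reflection in the hyperplane orthogonal to w; the identity for w = 0, since
division by 0 gives 0. *)
Definition householder w x := x - (2 * dotr x w / dotr w w) *: w.

Lemma householder_dotr w x y : dotr (householder w x) (householder w y) = dotr x y.
Proof.
rewrite /householder dotrBl !dotrBr !dotrZl !dotrZr (dotrC w y).
have [->|w0] := eqVneq (dotr w w) 0; first by rewrite invr0 !(mulr0,mul0r,subr0).
by field.
Qed.

Lemma householder_sym w x y : dotr (householder w x) y = dotr x (householder w y).
Proof.
rewrite /householder dotrBl dotrBr dotrZl dotrZr (dotrC w y).
by ring.
Qed.

Lemma householderB w : {morph householder w : x y / x - y}.
Proof.
move=> x y; rewrite /householder dotrBl mulrBr mulrBl scalerBl.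
by rewrite opprB opprB addrACA [in RHS]addrACA; congr (_ + _); rewrite addrC.
Qed.

Lemma householderK w : involutive (householder w).
Proof.
move=> x; rewrite /householder dotrBl dotrZl.
have [w0|w0] := eqVneq (dotr w w) 0.
  by rewrite w0 invr0 !mulr0 !scale0r !subr0.
rewrite mulfVK// -addrA -opprD -scalerDl.
have -> : 2 * dotr x w / dotr w w + 2 * (dotr x w - 2 * dotr x w) / dotr w w = 0.
  by field.
by rewrite scale0r subr0.
Qed.

(** The reflection that exchanges two unit vectors; it also covers z = e. *)
Lemma householderE z e : dotr z z = 1 -> dotr e e = 1 -> householder (z - e) z = e.
Proof.
move=> z1 e1.
have zw : dotr z (z - e) = 1 - dotr z e by rewrite dotrBr z1.
have ww : dotr (z - e) (z - e) = 2 * (1 - dotr z e).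
  by rewrite dotrBl !dotrBr z1 e1 (dotrC e z); ring.
rewrite /householder; have [w0|w0] := eqVneq (dotr (z - e) (z - e)) 0.
  rewrite w0 invr0 mulr0 scale0r subr0; apply/eqP; rewrite -subr_eq0.
  exact/eqP/dotr_eq0.
by rewrite zw -ww divff// scale1r subKr.
Qed.

Lemma measurable_householder w : measurable_fun setT (householder w).
Proof.
apply: measurable_funB_rV => //; apply: measurable_funZ_rV => //.
apply: measurable_funM => //; apply: measurable_funM => //.
exact: measurable_dotr.
Qed.

End householder.

(** * Integration over the hemisphere *)

Section surface.
Context {R : realType}.
Local Notation leb := (lebesgue_rV R).
Local Notation mu := (@lebesgue_measure R).
Local Open Scope ereal_scope.

Lemma ge0_integral_mrestr d (T : measurableType d) (m : {measure set T -> \bar R})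
    (D : set T) (mD : measurable D) (f : T -> \bar R) :
  measurable_fun setT f -> (forall x, 0 <= f x) ->
  \int[mrestr m mD]_x f x = \int[m]_(x in D) f x.
Proof.
move=> mf f0; rewrite -(setUv D) ge0_integral_setU//=; last 3 first.
- exact: measurableC.
- by rewrite setUv.
- by rewrite disj_set2E setICr.
rewrite [X in _ + X]null_set_integral; last 3 first.
- exact: measurableC.
- exact: measurable_funTS.
- by rewrite /= /mrestr setICl measure0.
rewrite adde0; apply: eq_measure_integral => A mA AD.
by rewrite /= /mrestr; congr (m _); exact/setIidPl.
Qed.

(** Surface measure is n times the image of Lebesgue measure on the unit ball under
radial projection. *)
Lemma integral_surface n (G : 'rV[R]_n -> \bar R) :
  measurable_fun setT G -> (forall x, 0 <= G x) ->
  \int[surface_measure R n]_x G x =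
  n%:R%:E * \int[leb n]_(x in unit_ball R n) G (radial_proj x).
Proof.
move=> mG G0.
pose nu1 : {measure set 'rV[R]_n -> \bar R} := mrestr (leb n) (@measurable_unit_ball R n).
pose nu2 : {measure set 'rV[R]_n -> \bar R} :=
  measure_function_pushforward__canonical__measure_function_Measure nu1 (@measurable_radial_proj R n).
have n0 : (0 <= n%:R :> R)%R by [].
transitivity (\int[mscale (NngNum n0) nu2]_x G x).
  by apply: eq_measure_integral => A mA _.
rewrite ge0_integral_mscale//.
transitivity (n%:R%:E * \int[nu1]_x G (radial_proj x)).
  congr (_ * _); rewrite -(ge0_integral_pushforward (@measurable_radial_proj R n) nu1 measurableT)//.
congr (_ * _); rewrite ge0_integral_mrestr//.
exact: (measurableT_comp mG (@measurable_radial_proj R n)).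
Qed.

(** The function whose integral, times the dimension, is the integral of G over the
hemisphere. *)
Definition cap_fun m (G : 'rV[R]_m.+1 -> \bar R) (x : 'rV[R]_m.+1) :=
  if (0 < rV_last x)%R && (enorm x <= 1)%R then G (radial_proj x) else 0.

Lemma cap_fun_ge0 m (G : 'rV[R]_m.+1 -> \bar R) : (forall x, 0 <= G x) ->
  forall x, 0 <= cap_fun G x.
Proof. by move=> G0 x; rewrite /cap_fun; case: ifP. Qed.

Lemma measurable_cap_fun m (G : 'rV[R]_m.+1 -> \bar R) :
  measurable_fun setT G -> measurable_fun setT (cap_fun G).
Proof.
move=> mG; apply: measurable_fun_ifT => //.
  apply: measurable_and.
    by apply: measurable_fun_ltr => //; exact: measurable_funlast.
  by apply: measurable_fun_ler => //; exact: measurable_funenorm.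
exact: (measurableT_comp mG (@measurable_radial_proj R m.+1)).
Qed.

Lemma integral_hemisphere m (G : 'rV[R]_m.+1 -> \bar R) :
  measurable_fun setT G -> (forall x, 0 <= G x) ->
  \int[surface_measure R m.+1]_(x in hemisphere R m) G x =
  m.+1%:R%:E * \int[leb m.+1]_x cap_fun G x.
Proof.
move=> mG G0; rewrite [LHS]integral_mkcond integral_surface; last 2 first.
- by apply/(measurable_restrictT _ _).1; [exact: measurable_hemisphere|exact: measurable_funTS].
- by move=> x; rewrite patchE; case: ifP.
congr (_ * _); rewrite [LHS]integral_mkcond; apply: eq_integral => x _.
rewrite !patchE hemisphere_radial_proj /cap_fun.
rewrite (_ : (x \in unit_ball R m.+1) = (enorm x <= 1)%R); last first.
  by apply/idP/idP; rewrite inE.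
by case: ifP => _; rewrite ?andbF ?andbT.
Qed.

Lemma integral_exprn_if (k : nat) (a : R) : (0 < a)%R ->
  \int[mu]_t (if (0 < t <= a)%R then (t ^+ k)%R else 0%R)%:E = (a ^+ k.+1 / k.+1%:R)%:E.
Proof.
move=> a0; rewrite [LHS](integral_if mu (fun t : R => (0 < t <= a)%R)).
rewrite (_ : [set x | _] = `]0%R, a]%classic); last by apply/seteqP; split => x /=; rewrite in_itv.
have mX (D : set R) : measurable D -> measurable_fun D (fun x : R => (x ^+ k)%:E).
  by move=> mD; apply/measurable_EFinP; apply: measurable_funTS; exact: measurable_funX.
rewrite integral_itv_obnd_cbnd; last exact: mX.
have dF (x : R) : is_derive x (1%R:R) (fun t : R => k.+1%:R^-1 * t ^+ k.+1)%R (x ^+ k)%R.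
  have -> : (fun t => k.+1%:R^-1 * t ^+ k.+1)%R = (k.+1%:R^-1 \*: ((id : R -> R) ^+ k.+1))%R.
    by rewrite exprfctE.
  apply: is_derive_eq; rewrite /GRing.scale/= mulr1 mulrA mulVf ?mul1r// ?pnatr_eq0//.
have cF (x : R) : {for x, continuous (fun t : R => k.+1%:R^-1 * t ^+ k.+1)%R}.
  by apply: differentiable_continuous; apply/derivable1_diffP; exact: ex_derive.
rewrite (@continuous_FTC2 _ _ (fun t => k.+1%:R^-1 * t ^+ k.+1)%R 0%R a a0).
- by rewrite expr0n/= mulr0 sube0 mulrC.
- by apply: continuous_subspaceT => x; exact: exprn_continuous.
- split; first by move=> x _; exact: ex_derive.
  + by apply: cvg_at_right_filter; exact: cF.
  + by apply: cvg_at_left_filter; exact: cF.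
- by move=> x _; rewrite derive1E; have [_ ->] := dF x.
Qed.

Lemma rcons_neq0 m (u : 'rV[R]_m) : rV_rcons u 1 != 0%R.
Proof.
apply/eqP => /(congr1 (@rV_last R m)); rewrite rV_lastK /rV_last mxE => /eqP.
by rewrite oner_eq0.
Qed.

(** Slice the half-ball at height t and scale the slice by t: the point (t u, t) has
the direction of (u, 1), lies in the ball when t <= |(u, 1)|^-1, and dy = t^m du.
The integral of t^m over that range is |(u, 1)|^-(m + 1) / (m + 1), whose
denominator cancels the factor m + 1 of the cone measure. *)
Lemma integral_gnomonic m (G : 'rV[R]_m.+1 -> \bar R) :
  measurable_fun setT G -> (forall x, 0 <= G x) ->
  \int[surface_measure R m.+1]_(x in hemisphere R m) G x =
  \int[leb m]_u ((enorm (rV_rcons u 1) ^- m.+1)%:E * G (radial_proj (rV_rcons u 1))).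
Proof.
move=> mG G0; rewrite integral_hemisphere// integral_lebesgue_rVS_swap; last 2 first.
- exact: measurable_cap_fun.
- exact: cap_fun_ge0.
have mrc1 : measurable_fun setT (fun u : 'rV[R]_m => rV_rcons u 1%R).
  by apply: measurable_fun_rcons.
have e0 u : (0 < enorm (rV_rcons u 1%R : 'rV[R]_m.+1))%R by rewrite enorm_gt0 rcons_neq0.
(* The cap at height z.2 after scaling: t^m is the Jacobian of u |-> t u. *)
pose h (z : 'rV[R]_m * R) := (if (0 < z.2 <= (enorm (rV_rcons z.1 1))^-1)%R then z.2 ^+ m else 0)%R%:E
   * G (radial_proj (rV_rcons z.1 1)).
have h0 z : 0 <= h z.
  by rewrite /h mule_ge0// lee_fin; case: ifP => // /andP[/ltW z0 _]; rewrite exprn_ge0.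
have mfst : measurable_fun setT (fst : 'rV[R]_m * measurableTypeR R -> 'rV[R]_m) by exact: measurable_fst.
have msnd : measurable_fun setT (snd : 'rV[R]_m * measurableTypeR R -> R) by exact: measurable_snd.
have mh : measurable_fun setT (fun z : 'rV[R]_m * measurableTypeR R => h z).
  apply: emeasurable_funM.
    apply/measurable_EFinP; apply: measurable_fun_ifT => //; last exact: measurable_funX.
    apply: measurable_and; first exact: measurable_fun_ltr.
    apply: measurable_fun_ler => //.
    under eq_fun do rewrite -powR_inv1 ?enorm_ge0//.
    apply: measurable_funpowR; apply: measurable_funenorm.
    exact: (measurableT_comp mrc1).
  apply: (measurableT_comp mG); apply: (measurableT_comp (@measurable_radial_proj R m.+1)).
  exact: (measurableT_comp mrc1).
transitivity (m.+1%:R%:E * \int[mu]_t \int[leb m]_u h (u, t)).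
  congr (_ * _); apply: eq_integral => t _.
  have [t0|t0] := ltP 0%R t; last first.
    rewrite [LHS]integral0_eq; last first.
      by move=> u _; rewrite /cap_fun rV_lastK ltNge t0.
    rewrite [RHS]integral0_eq// => u _.
    by rewrite /h/= ltNge t0/= mul0e.
  transitivity ((t ^+ m)%:E * \int[leb m]_u cap_fun G (rV_rcons (t *: u + 0)%R t)).
    rewrite (@integral_affine _ m t 0%R (fun y => cap_fun G (rV_rcons y t))); last 3 first.
    - by rewrite gt_eqF.
    - apply: (measurableT_comp (measurable_cap_fun mG)).
      exact: measurable_fun_rcons.
    - by move=> u; exact: cap_fun_ge0.
    rewrite muleA -EFinM gtr0_norm// -exprMn mulfV ?gt_eqF// expr1n mul1e//.
  rewrite -ge0_integralZl//; last 3 first.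
  - apply: (measurableT_comp (measurable_cap_fun mG)).
    apply: measurable_fun_rcons => //; apply: measurable_funD_rV => //.
    exact: measurable_funZ_rV.
  - by move=> u _; exact: cap_fun_ge0.
  - by rewrite lee_fin exprn_ge0// ltW.
  apply: eq_integral => u _; rewrite /h/= t0/= addr0.
  have -> : rV_rcons (t *: u) t = (t *: rV_rcons u 1)%R.
    by apply/rowP => i; rewrite !mxE; case: unliftP => [j _|_] /=; rewrite ?mxE ?mulr1.
  rewrite /cap_fun rV_lastZ rV_lastK mulr1 t0/= enormZ gtr0_norm// radial_projZ//.
  rewrite -ler_pdivlMr// div1r; case: ifP => _; first by [].
  by rewrite mule0 mul0e.
rewrite -(fubini_tonelli (m1 := leb m) (m2 := mu) h)//.
rewrite -ge0_integralZl//; last 2 first.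
- exact: measurable_fun_fubini_tonelli_F.
- by move=> u _; exact: integral_ge0.
apply: eq_integral => u _; rewrite /h/=.
under eq_integral do rewrite muleC.
rewrite ge0_integralZl//; last 2 first.
- apply/measurable_EFinP; apply: measurable_fun_ifT => //.
  by apply: measurable_and; [exact: measurable_fun_ltr|exact: measurable_fun_ler].
- by move=> t _; rewrite lee_fin; case: ifP => // /andP[/ltW z0 _]; rewrite exprn_ge0.
rewrite integral_exprn_if ?invr_gt0// muleCA muleC; congr (_ * _).
rewrite -EFinM; congr _%:E; by rewrite mulrC -mulrA mulVf ?mulr1 ?exprVn// ?pnatr_eq0.
Qed.

Lemma enorm_rcons1 m (u : 'rV[R]_m) : enorm (rV_rcons u 1%R) = Num.sqrt (1 + dotr u u)%R.
Proof. by rewrite /enorm dotr_rcons mulr1 addrC. Qed.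

Lemma integral_hemisphere_japan m (b : R) :
  \int[surface_measure R m.+1]_(s in hemisphere R m) (rV_last s `^ b)%:E =
  \int[leb m]_u (japan ((m.+1%:R + b) / 2) u)%:E.
Proof.
rewrite integral_gnomonic; last 2 first.
- by apply/measurable_EFinP; apply: measurable_funpowR; exact: measurable_funlast.
- by move=> x; rewrite lee_fin powR_ge0.
apply: eq_integral => u _; rewrite -EFinM; congr _%:E.
rewrite rV_last_radial_proj rV_lastK div1r enorm_rcons1 /japan.
have X0 : (0 < 1 + dotr u u)%R by rewrite (lt_le_trans ltr01)// lerDl dotr_ge0.
rewrite -powR12_sqrt ?(ltW X0)// -!powR_inv1 ?powR_ge0// -powR_mulrn ?powR_ge0//.
rewrite -!powRrM -powRD; last by rewrite (gt_eqF X0) implybT.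
by congr (_ `^ _)%R; field.
Qed.

(** Up to the factor n, the integral of g over the whole sphere: the reflections
that move z to e_n do not preserve the hemisphere. *)
Definition ball_integral m (g : 'rV[R]_m.+1 -> R) :=
  \int[leb m.+1]_x (if enorm x <= 1 then g (radial_proj x) else 0)%R%:E.

Lemma measurable_ball_fun m (g : 'rV[R]_m.+1 -> R) : measurable_fun setT g ->
  measurable_fun setT (fun x => if enorm x <= 1 then g (radial_proj x) else 0)%R.
Proof.
move=> mg; apply: measurable_fun_ifT => //.
  by apply: measurable_fun_ler => //; exact: measurable_funenorm.
exact: (measurableT_comp mg (@measurable_radial_proj R m.+1)).
Qed.

Lemma ball_fun_ge0 m (g : 'rV[R]_m.+1 -> R) : (forall x, 0 <= g x)%R ->
  forall x, 0 <= (if (enorm x <= 1)%R then g (radial_proj x) else 0)%:E.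
Proof. by move=> g0 x; rewrite lee_fin; case: ifP. Qed.

(** For an even g the two hemispheres contribute equally.  The equator is harmless
because g is assumed to vanish there. *)
Lemma integral_hemisphere_even m (g : 'rV[R]_m.+1 -> R) :
  measurable_fun setT g -> (forall x, 0 <= g x)%R -> (forall x, g (- x) = g x)%R ->
  (forall x, rV_last x = 0 -> g x = 0)%R ->
  \int[surface_measure R m.+1]_(s in hemisphere R m) (g s)%:E =
  (m.+1%:R / 2)%:E * ball_integral g.
Proof.
move=> mg g0 gN gz.
have meg : measurable_fun setT (EFin \o g) by exact/measurable_EFinP.
have eg0 x : 0 <= (EFin \o g) x by rewrite lee_fin.
rewrite integral_hemisphere//.
(* The full ball is the half-ball and its image under x |-> - x. *)
suff -> : ball_integral g = 2%:E * \int[leb m.+1]_x cap_fun (EFin \o g) x.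
  by rewrite muleA -EFinM divfK.
have mc := measurable_cap_fun meg; have c0 := cap_fun_ge0 eg0.
have mN : measurable_fun setT (fun x : 'rV[R]_m.+1 => - x)%R.
  under eq_fun do rewrite -sub0r; exact: measurable_funB_rV.
rewrite -[2%R]/(1 + 1)%R EFinD ge0_muleDl// !mul1e -[X in _ + X]integral_rV_opp//.
rewrite -ge0_integralD//; last exact: (measurableT_comp mc).
apply: eq_integral => x _; rewrite /cap_fun enormN rV_lastN radial_projN /= gN oppr_gt0.
case: (enorm x <= 1)%R; last by rewrite !andbF adde0.
rewrite !andbT; case: ltgtP => x0; rewrite ?adde0 ?add0e//.
by rewrite gz// rV_last_radial_proj -x0 mul0r.
Qed.

Lemma integral_ball_householder m (g : 'rV[R]_m.+1 -> R) w :
  measurable_fun setT g -> (forall x, 0 <= g x)%R ->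
  ball_integral (g \o householder w) = ball_integral g.
Proof.
move=> mg g0; rewrite /ball_integral.
rewrite -[RHS](@integral_isometric_involution _ _ (householder w)).
- apply: eq_integral => x _; rewrite /= {2}/enorm householder_dotr -/(enorm x).
  suff -> : radial_proj (householder w x) = householder w (radial_proj x) by [].
  rewrite /radial_proj {1}/enorm householder_dotr -/(enorm x) /householder.
  by rewrite dotrZl scalerBr scalerA; congr (_ - _ *: _)%R; ring.
- exact: measurable_householder.
- exact: householderK.
- exact: householderB.
- by move=> x; rewrite householder_dotr.
- by apply/measurable_EFinP; exact: measurable_ball_fun.
- exact: ball_fun_ge0.
Qed.

Lemma measurable_absdotr m (z : 'rV[R]_m) (b : R) :
  measurable_fun setT (fun s : 'rV[R]_m => `|dotr s z| `^ b)%R.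
Proof.
apply: measurable_funpowR; apply: measurableT_comp => //.
exact: measurable_dotr.
Qed.

Lemma integral_ball_dotr m (z : 'rV[R]_m.+1) (b : R) : enorm z = 1%R ->
  ball_integral (fun s : 'rV[R]_m.+1 => `|dotr s z| `^ b)%R = ball_integral (fun s : 'rV[R]_m.+1 => `|rV_last s| `^ b)%R.
Proof.
move=> z1; have zz : dotr z z = 1%R by rewrite -enorm_sqr z1 expr1n.
rewrite -(@integral_ball_householder _ _ (z - e_last R m)); last 2 first.
- exact: measurable_absdotr.
- by move=> x; exact: powR_ge0.
congr ball_integral; apply/funext => s /=; rewrite householder_sym householderE ?dotr_e_last//.
by rewrite rV_lastE.
Qed.

(** Young's inequality with the conjugate exponents (a + q) / a and (a + q) / q. *)
Lemma young_powR (x y a q : R) : (0 <= x -> 0 <= y -> 0 < a -> 0 < q ->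
  x `^ a * y `^ q <= a / (a + q) * x `^ (a + q) + q / (a + q) * y `^ (a + q))%R.
Proof.
move=> x0 y0 a0 q0; have aq : (0 < a + q)%R by exact: addr_gt0.
have := @conjugate_powR R (x `^ a)%R (y `^ q)%R ((a + q) / a)%R ((a + q) / q)%R
  (powR_ge0 _ _) (powR_ge0 _ _).
rewrite !invf_div -!powRrM => H.
apply: le_trans (H _ _ _) _; rewrite ?divr_gt0//.
  by rewrite -mulrDl divff// gt_eqF.
rewrite (_ : a * ((a + q) / a) = a + q)%R; last by field; rewrite gt_eqF.
rewrite (_ : q * ((a + q) / q) = a + q)%R; last by field; rewrite gt_eqF.
by rewrite le_eqVlt; apply/orP; left; apply/eqP; field; rewrite gt_eqF.
Qed.

(** Why e_n is the best direction: Young's inequality bounds the integrand by a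
convex combination of |s_n|^(a + q) and |(s, z)|^(a + q), and a reflection
exchanging z and e_n shows that these have equal integrals. *)
Lemma le_integral_hemisphere_dotr m (z : 'rV[R]_m.+1) (a q : R) : enorm z = 1%R ->
  (0 < a)%R -> (0 < q)%R ->
  \int[surface_measure R m.+1]_(s in hemisphere R m)
     (`|rV_last s| `^ a * `|dotr s z| `^ q)%:E <=
  \int[surface_measure R m.+1]_(s in hemisphere R m) (`|rV_last s| `^ (a + q))%:E.
Proof.
move=> z1 a0 q0; have aq : (0 < a + q)%R by exact: addr_gt0.
have ml (c : R) : measurable_fun setT (fun s : 'rV[R]_m.+1 => `|rV_last s| `^ c)%R.
  apply: measurable_funpowR; apply: measurableT_comp => //; exact: measurable_funlast.
have mz (c : R) := @measurable_absdotr m.+1 z c.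
have mf : measurable_fun setT (fun s : 'rV[R]_m.+1 => `|rV_last s| `^ a * `|dotr s z| `^ q)%R.
  exact: measurable_funM.
rewrite integral_hemisphere_even//; last 2 first.
- by move=> x; rewrite rV_lastN dotrNl !normrN.
- by move=> x ->; rewrite normr0 powR0 ?mul0r// gt_eqF.
rewrite integral_hemisphere_even//; last 2 first.
- by move=> x; rewrite rV_lastN normrN.
- by move=> x ->; rewrite normr0 powR0// gt_eqF.
rewrite lee_pmul2l ?lte_fin ?divr_gt0//.
have ca : (0 <= a / (a + q))%R by rewrite divr_ge0// ltW.
have cq : (0 <= q / (a + q))%R by rewrite divr_ge0// ltW.
apply: (@le_trans _ _ ((a / (a + q))%:E * ball_integral (fun s : 'rV[R]_m.+1 => `|rV_last s| `^ (a + q))%R +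
   (q / (a + q))%:E * ball_integral (fun s : 'rV[R]_m.+1 => `|dotr s z| `^ (a + q))%R)).
  rewrite /ball_integral -!integralZl_setT//; last 4 first.
  - by apply/measurable_EFinP; exact: (measurable_ball_fun (mz _)).
  - by apply: (@ball_fun_ge0 _ (fun s : 'rV[R]_m.+1 => `|dotr s z| `^ (a + q))%R) => s; exact: powR_ge0.
  - by apply/measurable_EFinP; exact: (measurable_ball_fun (ml _)).
  - by apply: (@ball_fun_ge0 _ (fun s : 'rV[R]_m.+1 => `|rV_last s| `^ (a + q))%R) => s; exact: powR_ge0.
  rewrite -ge0_integralD//; last 4 first.
  - by move=> x _; rewrite mule_ge0// lee_fin; case: ifP => // _; exact: powR_ge0.
  - by apply: measurable_funeM; apply/measurable_EFinP; exact: (measurable_ball_fun (ml _)).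
  - by move=> x _; rewrite mule_ge0// lee_fin; case: ifP => // _; exact: powR_ge0.
  - by apply: measurable_funeM; apply/measurable_EFinP; exact: (measurable_ball_fun (mz _)).
  apply: ge0_le_integral => //.
  - by move=> x _; rewrite lee_fin; case: ifP => // _; rewrite mulr_ge0 ?powR_ge0.
  - by apply/measurable_EFinP; exact: (measurable_ball_fun mf).
  - by apply: emeasurable_funD; apply: measurable_funeM; apply/measurable_EFinP;
      [exact: (measurable_ball_fun (ml _))|exact: (measurable_ball_fun (mz _))].
  - move=> x _; rewrite -!EFinM -EFinD lee_fin; case: ifP => _; last by rewrite !mulr0 addr0.
    exact: young_powR.
rewrite integral_ball_dotr// -ge0_muleDl ?lee_fin// -EFinD -mulrDl divff ?mul1e//.
by rewrite gt_eqF.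
Qed.

End surface.

(** * Functions with bounded partial derivatives *)

Section partials.
Context {R : realType} (n : nat).
Local Notation V := 'rV[R]_n.+1.
Local Notation e_ i := (delta_mx ord0 i : V).
Implicit Types (x y w : V) (u : V -> R).

(** Directional derivatives are derivatives along a line, so that one-variable
calculus applies to them. *)
Lemma is_derive_line x (v : V) u (t d : R) :
  is_derive (x + t *: v) v u d <-> is_derive t 1 (fun s : R => u (x + s *: v)) d.
Proof.
have E : (fun h : R => h^-1 *: ((u \o shift (x + t *: v)) (h *: v) - u (x + t *: v))) =
  (fun h : R => h^-1 *: (((fun s : R => u (x + s *: v)) \o shift t) (h *: 1) - u (x + t *: v))).
  apply/funext => h /=; congr (_ *: (u _ - _)).
  have -> : h *: (1 : R) = h by rewrite /GRing.scale/= mulr1.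
  by rewrite scalerDl addrCA.
have Ed : derivable u (x + t *: v) v = derivable (fun s : R => u (x + s *: v)) t 1.
  exact: (congr1 (fun F : R -> R => cvg (F @ 0^')) E).
have ED : 'D_v u (x + t *: v) = 'D_1 (fun s : R => u (x + s *: v)) t.
  exact: (congr1 (fun F : R -> R => lim (F @ 0^')) E).
by split => -[H1 H2]; split; [rewrite -Ed|rewrite -ED|rewrite Ed|rewrite ED].
Qed.

Lemma nbhs_cube x (d : R) : 0 < d -> nbhs x (cube x d).
Proof.
move=> d0; apply/nbhs_ballP; exists d => // y H i.
by have [_ /(_ ord0 i)] := H; rewrite /ball/= distrC.
Qed.

Lemma mvt_bound (phi dphi : R -> R) (b M : R) :
  (forall s : R, `|s| <= `|b| -> is_derive s 1 phi (dphi s)) ->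
  (forall s : R, `|s| <= `|b| -> `|dphi s| <= M) ->
  `|phi b - phi 0| <= M * `|b|.
Proof.
move=> dp bM.
have [b0|b0] := leP 0 b.
- have Hs s : s \in `[0, b] -> `|s| <= `|b|.
    by rewrite in_itv/= => /andP[s0 sb]; rewrite !ger0_norm.
  have [||c cb ->] := @MVT_segment _ phi dphi 0 b b0.
  + by move=> s /subset_itv_oo_cc/Hs; exact: dp.
  + apply: derivable_within_continuous => s /Hs/dp ds; exact: ex_derive.
  + by rewrite subr0 normrM ler_wpM2r// bM// Hs.
- have Hs s : s \in `[b, 0] -> `|s| <= `|b|.
    by rewrite in_itv/= => /andP[s0 sb]; rewrite (ler0_norm sb) (ltr0_norm b0) lerN2.
  have [||c cb E] := @MVT_segment _ phi dphi b 0 (ltW b0).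
  + by move=> s /subset_itv_oo_cc/Hs; exact: dp.
  + apply: derivable_within_continuous => s /Hs/dp ds; exact: ex_derive.
  + by rewrite distrC E sub0r normrM normrN ler_wpM2r// bM// Hs.
Qed.

(** Go from x to y changing one coordinate at a time, with the mean value theorem
on each segment; the cube contains the whole path. *)
Lemma lipschitz_of_partials x (d M : R) u (du : 'I_n.+1 -> V -> R) :
  (forall i y, cube x d y -> is_derive y (e_ i) u (du i y)) ->
  (forall i y, cube x d y -> `|du i y| <= M) ->
  forall y c, cube x d y -> 0 <= c -> (forall i, `|y ord0 i - x ord0 i| <= c) ->
  `|u y - u x| <= M * c *+ n.+1.
Proof.
move=> dE dM y c yd c0 yc.
have d0 : 0 < d by have := yd ord0; apply: le_lt_trans.
have xd : cube x d x by move=> i; rewrite subrr normr0.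
have M0 : 0 <= M by apply: le_trans (dM ord0 x xd).
(* The point with the first k coordinates of y and the others of x. *)
pose path k : V := \row_i (if (i < k)%N then y ord0 i else x ord0 i).
have path0 : path 0%N = x by apply/rowP => i; rewrite mxE.
have pathn : path n.+1 = y by apply/rowP => i; rewrite mxE ltn_ord.
suff H : forall k, (k <= n.+1)%N -> `|u (path k) - u x| <= M * c *+ k.
  by rewrite -{1}pathn; exact: H.
elim=> [_|k IH kn]; first by rewrite path0 subrr normr0.
pose i := Ordinal kn; pose b := y ord0 i - x ord0 i.
have pathS : path k.+1 = path k + b *: e_ i.
  apply/rowP => j; rewrite !mxE eqxx/= ltnS leq_eqVlt.
  have [->|ji] := eqVneq j i; first by rewrite eqxx ltnn mulr1 /b addrC subrK.
  rewrite mulr0 addr0 (_ : (j == k :> nat) = false)//.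
  by apply/negbTE; apply: contraNneq ji => jk; apply/eqP/val_inj.
have pathcube s : `|s| <= `|b| -> cube x d (path k + s *: e_ i).
  move=> sb j; rewrite !mxE eqxx/=.
  have [->|ji] := eqVneq j i.
    rewrite ltnn mulr1 addrC addrK; apply: le_lt_trans sb _; exact: yd.
  by rewrite mulr0 addr0; case: ifP => _; [exact: yd|exact: xd].
have step : `|u (path k.+1) - u (path k)| <= M * c.
  have := @mvt_bound (fun s => u (path k + s *: e_ i)) (fun s => du i (path k + s *: e_ i)) b M.
  rewrite scale0r addr0 -pathS => H.
  apply: le_trans (H _ _) _.
  - by move=> s sb; apply/is_derive_line; apply: dE; exact: pathcube.
  - by move=> s sb; apply: dM; exact: pathcube.
  - by rewrite ler_wpM2l// yc.
rewrite mulrS -[X in `|X|](subrKA (u (path k))).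
by apply: le_trans (ler_normD _ _) _; rewrite lerD// IH// ltnW.
Qed.

Lemma continuous_of_partials x (d M : R) u (du : 'I_n.+1 -> V -> R) : 0 < d ->
  (forall i y, cube x d y -> is_derive y (e_ i) u (du i y)) ->
  (forall i y, cube x d y -> `|du i y| <= M) ->
  {for x, continuous u}.
Proof.
move=> d0 dE dM; apply/(@cvgrPdist_le _ _ _ (nbhs x) (nbhs_filter x)) => e e0.
have xd : cube x d x by move=> i; rewrite subrr normr0.
have M0 : 0 <= M by apply: le_trans (dM ord0 x xd).
(* The summand 1 keeps the denominator positive when M = 0. *)
pose c := Num.min d (e / (M *+ n.+1 + 1)).
have Mn0 : 0 <= M *+ n.+1 by rewrite mulrn_wge0.
have c0 : 0 < c by rewrite lt_min d0 divr_gt0// ltr_wpDl.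
apply: filterS (nbhs_cube x c0) => y yc.
rewrite distrC; apply: le_trans (lipschitz_of_partials dE dM (c := c) _ _ _) _.
- by move=> i; apply: lt_le_trans (yc i) _; rewrite ge_min lexx.
- exact: ltW.
- by move=> i; exact: ltW.
- have : c <= e / (M *+ n.+1 + 1) by rewrite ge_min lexx orbT.
  rewrite ler_pdivlMr ?ltr_wpDl// mulrDr mulr1 => H; apply: le_trans H.
  by rewrite mulrC mulrnAr lerDl ltW.
Qed.

End partials.

(** * Kernels of polynomial decay on the half-space *)

Section halfspace.
Context {R : realType} (m : nat).
Local Notation V := 'rV[R]_m.+1.
Local Notation e_ i := (delta_mx ord0 i : V).
Implicit Types (x y w : V) (g h u : V -> R).

Lemma halfspace_cube x : 0 < rV_last x ->
  forall y, cube x (rV_last x / 2) y -> rV_last x / 2 <= rV_last y.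
Proof.
move=> x0 y /(_ ord_max); rewrite -!/(rV_last _) ltr_norml => /andP[H _].
by move: H; lra.
Qed.

Lemma near_halfspace x : halfspace R m x -> \forall y \near x, halfspace R m y.
Proof.
rewrite /halfspace /= => x0; have x20 : 0 < rV_last x / 2 by rewrite divr_gt0.
apply: filterS (nbhs_cube x x20) => y /(halfspace_cube x0).
exact: lt_le_trans.
Qed.

Lemma is_derive_halfspace x (v : V) g h d : halfspace R m x ->
  (forall y, halfspace R m y -> g y = h y) -> is_derive x v g d -> is_derive x v h d.
Proof.
move=> x0 gh; apply: near_eq_is_derive; near=> y; apply: gh.
by near: y; exact: near_halfspace.
Unshelve. all: by end_near. Qed.

(** [decay k s g] says that g is O(|w|^(- 2 s)) on the half-space, together with its
partial derivatives up to order k, each derivative improving s by 1/2.  The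
class is closed under products, which reduces all estimates on the derivatives
of the Poisson kernel to those of the coordinates and of the powers of |w|. *)
Fixpoint decay (k : nat) (s : R) g : Prop :=
  [/\ measurable_fun setT g,
     exists2 C, 0 <= C & forall w, halfspace R m w -> `|g w| <= C * dotr w w `^ (- s) &
     if k is k'.+1 then exists dg : 'I_m.+1 -> V -> R, forall i,
        decay k' (s + 2^-1) (dg i) /\
        forall w, halfspace R m w -> is_derive w (e_ i) g (dg i w)
     else True].

Lemma halfspace_dotr w : halfspace R m w -> 0 < dotr w w.
Proof.
move=> w0; rewrite -enorm_sqr exprn_gt0// enorm_gt0; apply: contraTneq w0 => ->.
by apply/negP; rewrite /halfspace/= /rV_last mxE ltxx.
Qed.

Lemma decayW k s g : decay k.+1 s g -> decay k s g.
Proof.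
elim: k s g => [|k IH] s g; first by move=> [? ? _].
move=> [mg bg [dg Hdg]]; split => //; exists dg => i.
by have [/IH ? ?] := Hdg i.
Qed.

Lemma decay_cst0 k s : decay k s (cst 0).
Proof.
elim: k s => [|k IH] s; split => //.
- by exists 0 => // w _; rewrite normr0 mul0r.
- by exists 0 => // w _; rewrite normr0 mul0r.
- by exists (fun=> cst 0) => i; split => // w _; exact: is_derive_cst.
Qed.

Lemma decay_cst k c : decay k 0 (cst c).
Proof.
have b : exists2 C, 0 <= C & forall w, halfspace R m w -> `|cst c w| <= C * dotr w w `^ (- 0).
  by exists `|c| => // w _; rewrite oppr0 powRr0 mulr1.
case: k => [|k]; split => //.
by exists (fun=> cst 0) => i; split => [|w _]; [exact: decay_cst0|exact: is_derive_cst].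
Qed.

Lemma decayD k s g h : decay k s g -> decay k s h -> decay k s (g \+ h).
Proof.
elim: k s g h => [|k IH] s g h [mg [C C0 bg] Hg] [mh [D D0 bh] Hh].
- split => //; first exact: measurable_funD.
  exists (C + D) => [|w w0]; first exact: addr_ge0.
  by rewrite mulrDl; apply: le_trans (ler_normD _ _) _; rewrite lerD ?bg ?bh.
- split; first exact: measurable_funD.
    exists (C + D) => [|w w0]; first exact: addr_ge0.
    by rewrite mulrDl; apply: le_trans (ler_normD _ _) _; rewrite lerD ?bg ?bh.
  have [dg Hdg] := Hg; have [dh Hdh] := Hh.
  exists (fun i => dg i \+ dh i) => i; have [? dgE] := Hdg i; have [? dhE] := Hdh i.
  split => [|w w0]; first exact: IH.
  by apply: is_deriveD; [exact: dgE|exact: dhE].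
Qed.

Lemma decayM k s t g h : decay k s g -> decay k t h -> decay k (s + t) (g \* h).
Proof.
elim: k s t g h => [|k IH] s t g h Hg Hh.
- move: Hg Hh => [mg [C C0 bg] _] [mh [D D0 bh] _]; split => //; first exact: measurable_funM.
  exists (C * D) => [|w w0]; first exact: mulr_ge0.
  rewrite opprD powRD; last by rewrite (gt_eqF (halfspace_dotr w0)) implybT.
  by rewrite mulrACA normrM; apply: ler_pM => //; [exact: bg|exact: bh].
- have [mg _ [dg Hdg]] := Hg; have [mh _ [dh Hdh]] := Hh.
  have gk := decayW Hg; have hk := decayW Hh.
  have [_ bgh _] : decay 0 (s + t) (g \* h).
    have : decay k (s + t) (g \* h) by exact: IH.
    by case: (k) => [|?] [? ? _]; split.
  split => //; first exact: measurable_funM.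
  exists (fun i => (dg i \* h) \+ (g \* dh i)) => i.
  have [? dgE] := Hdg i; have [? dhE] := Hdh i.
  split => [|w w0].
    apply: decayD; first by rewrite addrAC; exact: IH.
    by rewrite -addrA; exact: IH.
  have D := is_deriveM (dgE _ w0) (dhE _ w0).
  by apply: (is_derive_eq D); rewrite /GRing.scale/= addrC mulrC.
Qed.

Lemma is_derive_coord (i j : 'I_m.+1) w :
  is_derive w (e_ i) (fun w : V => w ord0 j) (i == j)%:R.
Proof.
have -> : w = w + 0 *: e_ i by rewrite scale0r addr0.
apply/is_derive_line.
have -> : (fun s : R => (w + s *: e_ i) ord0 j) = cst (w ord0 j) + (i == j)%:R \*: (id : R -> R).
  by apply/funext => s; rewrite !mxE eqxx/= eq_sym !fctE /= /GRing.scale/= mulrC.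
by apply: is_derive_eq; rewrite add0r /GRing.scale/= mulr1.
Qed.

(** Coordinates grow at most like |w|, hence the exponent - 1/2. *)
Lemma decay_coord k j : decay k (- 2^-1) (fun w : V => w ord0 j).
Proof.
have b : exists2 C, 0 <= C & forall w, halfspace R m w -> `|w ord0 j| <= C * dotr w w `^ (- - 2^-1).
  exists 1 => // w w0; rewrite opprK mul1r powR12_sqrt ?dotr_ge0//.
  rewrite -sqrtr_sqr ler_sqrt ?dotr_ge0// /dotr (bigD1 j)//= expr2 lerDl.
  by apply: sumr_ge0 => i _; rewrite -expr2 sqr_ge0.
case: k => [|k]; split => //; try exact: measurable_coord.
exists (fun i => cst (i == j)%:R) => i; split => [|w _].
  by rewrite addNr; exact: decay_cst.
exact: is_derive_coord.
Qed.

(** The power |w|^(- 2 a). *)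
Definition rpow (a : R) w : R := dotr w w `^ (- a).

Lemma is_derive_dotr i w : is_derive w (e_ i) (fun w : V => dotr w w) (2 * w ord0 i).
Proof.
have -> : (fun w : V => dotr w w) = \sum_(j < m.+1) ((fun w : V => w ord0 j) * (fun w : V => w ord0 j)).
  by apply/funext => v; rewrite fct_sumE.
have H (j : 'I_m.+1) := is_deriveM (is_derive_coord i j w) (is_derive_coord i j w).
apply: is_derive_eq; rewrite (bigD1 i)//= big1 ?addr0 => [|j ji].
  by rewrite eqxx /GRing.scale/= mulr1; ring.
by rewrite eq_sym (negbTE ji) /GRing.scale/= mulr0 addr0.
Qed.

Lemma is_derive_rpow a i w : halfspace R m w ->
  is_derive w (e_ i) (rpow a) (- (2 * a) * (w ord0 i * rpow (a + 1) w)).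
Proof.
move=> w0; have w00 : w = w + 0 *: e_ i by rewrite scale0r addr0.
have := is_derive_dotr i w; rewrite {1}w00 => /is_derive_line dl.
rewrite {1}w00; apply/is_derive_line.
have P : 0 < dotr (w + 0 *: e_ i) (w + 0 *: e_ i) by rewrite -w00; exact: halfspace_dotr.
have D := @is_derive1_comp _ (@powR R ^~ (- a)) _ _ _ _ (is_derive1_powR (- a) P) dl.
apply: (is_derive_eq D); rewrite -w00 /rpow opprD; ring.
Qed.

Lemma measurable_rpow a : measurable_fun setT (rpow a).
Proof. by apply: measurable_funpowR; exact: measurable_dotr. Qed.

Lemma decay_rpow k a : decay k a (rpow a).
Proof.
elim: k a => [|k IH] a.
  split => //; first exact: measurable_rpow.
  by exists 1 => // w _; rewrite mul1r ger0_norm ?powR_ge0.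
split => //; first exact: measurable_rpow.
  by exists 1 => // w _; rewrite mul1r ger0_norm ?powR_ge0.
exists (fun i => cst (- (2 * a)) \* ((fun w => w ord0 i) \* rpow (a + 1))) => i.
split => [|w w0]; last exact: is_derive_rpow.
have -> : a + 2^-1 = 0 + (- 2^-1 + (a + 1)) by field.
by apply: decayM; [exact: decay_cst|apply: decayM; [exact: decay_coord|exact: IH]].
Qed.

End halfspace.

(** * Differentiation of potentials under the integral sign *)

Section potential.
Context {R : realType} (m : nat).
Local Notation V := 'rV[R]_m.+1.
Local Notation e_ i := (delta_mx ord0 i : V).
Local Notation leb := (lebesgue_rV R m).
Local Notation a := (m.+1%:R / 2 : R).
Implicit Types (x w : V) (y : 'rV[R]_m) (g h u : V -> R).

Lemma rV_last_sub_rcons x (y : 'rV[R]_m) : rV_last (x - rV_rcons y 0) = rV_last x.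
Proof. by rewrite /rV_last !mxE unlift_none/= subr0. Qed.

Lemma halfspace_sub_rcons x (y : 'rV[R]_m) : halfspace R m x -> halfspace R m (x - rV_rcons y 0).
Proof. by rewrite /halfspace/= rV_last_sub_rcons. Qed.

Lemma dotr_sub_le n (p q : 'rV[R]_n) :
  dotr (p - q) (p - q) <= 2 * dotr p p + 2 * dotr q q.
Proof.
rewrite -subr_ge0; apply: le_trans (dotr_ge0 (p + q)) _.
rewrite !dotrBl !dotrBr !dotrDl !dotrDr (dotrC q p).
by rewrite le_eqVlt; apply/orP; left; apply/eqP; ring.
Qed.

(** The uniform domination behind all differentiations under the integral sign.
When x' stays near x, its height is at least t = x_n / 2, so w = x' - (y, 0)
satisfies |w| >= t, and |y| <= |x'| + |w| gives 1 + |y|^2 <= B |w|^2 with B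
depending on x only. *)
Lemma rpow_le_japan x (s : R) : halfspace R m x -> a <= s ->
  exists2 K, 0 <= K & forall x', cube x (rV_last x / 2) x' ->
    forall y, rpow s (x' - rV_rcons y 0) <= K * japan a y.
Proof.
move=> x0 a_s; pose t := rV_last x / 2.
have t0 : 0 < t by rewrite divr_gt0.
have a0 : 0 < a by rewrite divr_gt0.
have s0 : 0 < s by exact: lt_le_trans a_s.
pose M := \sum_(i < m.+1) (`|x ord0 i| + t) ^+ 2.
have M0 : 0 <= M by apply: sumr_ge0 => i _; exact: sqr_ge0.
(* From |y|^2 <= 2 |x'|^2 + 2 |w|^2, |x'|^2 <= M and t^2 <= |w|^2. *)
pose B := (1 + 2 * M) / t ^+ 2 + 2.
have B0 : 0 < B.
  by rewrite ltr_wpDl// divr_ge0 ?sqr_ge0// addr_ge0// mulr_ge0.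
exists (B `^ s) => [|x' xx' y]; first exact: powR_ge0.
set w := x' - rV_rcons y 0.
have lw : t <= rV_last w by rewrite rV_last_sub_rcons; exact: halfspace_cube.
have ww : t ^+ 2 <= dotr w w.
  rewrite -enorm_sqr ler_pXn2r ?nnegrE ?enorm_ge0 ?(ltW t0)//.
  apply: le_trans lw _; exact: le_trans (ler_norm _) (rV_last_le_enorm _).
have w0 : 0 < dotr w w by apply: lt_le_trans ww; rewrite exprn_gt0.
have x'M : dotr x' x' <= M.
  apply: ler_sum => i _; rewrite -expr2 -[_ ^+ 2]ger0_norm ?sqr_ge0// normrX.
  rewrite ler_pXn2r ?nnegrE ?addr_ge0 ?(ltW t0)//.
  rewrite -[x' _ _](subrK (x ord0 i)) addrC; apply: le_trans (ler_normD _ _) _.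
  by rewrite lerD2l ltW.
have yB : 1 + dotr y y <= B * dotr w w.
  have -> : dotr y y = dotr (x' - w) (x' - w).
    by rewrite /w subKr dotr_rcons mul0r addr0.
  have H := dotr_sub_le x' w.
  have H2 : 1 + 2 * M <= (1 + 2 * M) / t ^+ 2 * dotr w w.
    rewrite mulrAC ler_pdivlMr ?exprn_gt0// ler_wpM2l// addr_ge0// mulr_ge0//.
  rewrite /B mulrDl; apply: le_trans (lerD H2 (lexx _)).
  by rewrite -addrA lerD2l; apply: le_trans H _; rewrite lerD2r ler_wpM2l.
have y1 : 1 <= 1 + dotr y y by rewrite lerDl dotr_ge0.
have y0 : 0 < 1 + dotr y y by exact: lt_le_trans y1.
apply: (@le_trans _ _ (((1 + dotr y y) / B) `^ (- s))).
  rewrite /rpow !powRN lef_pV2 ?posrE ?powR_gt0 ?divr_gt0//.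
  apply: ge0_ler_powR; rewrite ?nnegrE ?(ltW s0) ?(ltW w0) ?divr_ge0 ?(ltW y0) ?(ltW B0)//.
  by rewrite ler_pdivrMr// mulrC.
rewrite powRM ?(ltW y0) ?invr_ge0 ?(ltW B0)//.
have -> : B^-1 `^ (- s) = B `^ s.
  by rewrite -powR_inv1 ?(ltW B0)// -powRrM mulrNN mul1r.
rewrite mulrC ler_wpM2l ?powR_ge0// /japan; apply: ler_powR => //.
by rewrite lerN2.
Qed.

Variable f : 'rV[R]_m -> R.
Hypothesis mf : measurable_fun setT f.
Hypothesis intf : leb.-integrable setT (fun y => (japan a y * f y)%:E).

(** The convolution of the density f on the boundary with the kernel g. *)
Definition potential g x : R := \int[leb]_y (g (x - rV_rcons y 0) * f y).

Lemma measurable_potential_fun g x : measurable_fun setT g ->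
  measurable_fun setT (fun y => g (x - rV_rcons y 0) * f y).
Proof.
move=> mg; apply: measurable_funM => //; apply: (measurableT_comp mg).
by apply: measurable_funB_rV => //; exact: measurable_fun_rcons.
Qed.

Lemma decay_dominated s g x : decay 0 s g -> a <= s -> halfspace R m x ->
  exists2 K, 0 <= K & forall x', cube x (rV_last x / 2) x' ->
    forall y, `|g (x' - rV_rcons y 0) * f y| <= K * `|japan a y * f y|.
Proof.
move=> [mg [C C0 bg] _] a_s x0; have [K K0 HK] := rpow_le_japan x0 a_s.
exists (C * K) => [|x' xx' y]; first exact: mulr_ge0.
have x'0 : halfspace R m x'.
  by apply: lt_le_trans (halfspace_cube x0 xx'); rewrite divr_gt0.
have j0 : 0 <= japan a y by exact: powR_ge0.
rewrite !normrM mulrA ler_wpM2r// (ger0_norm j0).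
apply: le_trans (bg _ (halfspace_sub_rcons _ x'0)) _.
by rewrite -mulrA ler_wpM2l// HK.
Qed.

Lemma cube_self x d : 0 < d -> cube x d x.
Proof. by move=> d0 i; rewrite subrr normr0. Qed.

Lemma integrable_scaled K : leb.-integrable setT (fun y => (K * `|japan a y * f y|)%:E).
Proof.
under eq_fun do rewrite EFinM.
apply: integrableZl => //.
rewrite (_ : (fun y => _) = abse \o (fun y => (japan a y * f y)%:E))//.
exact: integrable_abse.
Qed.

Lemma integrable_potential s g x : decay 0 s g -> a <= s -> halfspace R m x ->
  leb.-integrable setT (fun y => (g (x - rV_rcons y 0) * f y)%:E).
Proof.
move=> dg a_s x0; have [K K0 HK] := decay_dominated dg a_s x0.
have [mg _ _] := dg.
apply: (le_integrable measurableT _ _ (integrable_scaled K)).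
  by apply/measurable_EFinP; exact: measurable_potential_fun.
move=> y _; rewrite lee_fin [leRHS]ger0_norm ?mulr_ge0//; apply: HK.
by apply: cube_self; rewrite divr_gt0.
Qed.

(** Differentiation under the integral sign along the i-th axis, with the dominating
function of [decay_dominated]. *)
Lemma is_derive_potential s g i dg x : decay 0 s g -> decay 0 (s + 2^-1) dg ->
  (forall w, halfspace R m w -> is_derive w (e_ i) g (dg w)) ->
  a <= s -> halfspace R m x ->
  is_derive x (e_ i) (potential g) (potential dg x).
Proof.
move=> dcg dcdg gE a_s x0.
have a_s2 : a <= s + 2^-1 by rewrite (le_trans a_s)// lerDl.
have [K K0 HK] := decay_dominated dcdg a_s2 x0.
pose t := rV_last x / 2; have t0 : 0 < t by rewrite divr_gt0.
(* The integrand along the line through x; domination holds for |r| < t. *)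
pose F (r : R) (y : 'rV[R]_m) := g (x + r *: e_ i - rV_rcons y 0) * f y.
have cubeI r : r \in `](- t), t[ -> cube x t (x + r *: e_ i).
  rewrite in_itv/= => /andP[r1 r2] j; rewrite !mxE eqxx/= addrAC subrr add0r.
  have rt : `|r| < t by rewrite ltr_norml r1.
  by case: eqP => _; rewrite ?mulr1 ?mulr0 ?normr0.
have hI r : r \in `](- t), t[ -> halfspace R m (x + r *: e_ i).
  by move=> /cubeI/(halfspace_cube x0); exact: lt_le_trans.
have dF r y : r \in `](- t), t[ ->
    is_derive r 1 (fun r => F r y) (dg (x + r *: e_ i - rV_rcons y 0) * f y).
  move=> rI.
  have : is_derive r 1 (fun r : R => g ((x - rV_rcons y 0) + r *: e_ i))
     (dg (x + r *: e_ i - rV_rcons y 0)).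
    apply/is_derive_line; rewrite addrAC; apply: gE.
    by apply: halfspace_sub_rcons; exact: hI.
  move=> /(is_deriveZ (f y)) D.
  rewrite (_ : (fun r => F r y) = f y \*: (fun r : R => g (x - rV_rcons y 0 + r *: e_ i))).
    by apply: (is_derive_eq D); rewrite /GRing.scale/= mulrC.
  by apply/funext => r'; rewrite /F /GRing.scale/= mulrC addrAC.
have I0 : 0 \in `](- t), t[ by rewrite in_itv/= oppr_lt0 t0.
rewrite (_ : x = x + 0 *: e_ i); last by rewrite scale0r addr0.
apply/is_derive_line.
have iF (r : R) : `](- t), t[%classic r -> leb.-integrable setT (EFin \o F r).
  by move=> rI; exact: (integrable_potential dcg a_s (hI _ rI)).
have deF (r : R) y : `](- t), t[%classic r -> [set: 'rV[R]_m] y -> derivable (F ^~ y) r 1.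
  by move=> rI _; apply: ex_derive; exact: dF.
have bF (r : R) y : `](- t), t[%classic r -> [set: 'rV[R]_m] y ->
    `|partial1of2 F r y| <= K * `|japan a y * f y|.
  move=> rI _; rewrite partial1of2E.
  have [_ ->] := dF r y rI; apply: HK; exact: cubeI.
have G0 y : 0 <= K * `|japan a y * f y| by exact: mulr_ge0.
split.
  exact: (derivable_under_integral measurableT I0 iF deF G0 (integrable_scaled K) bF).
rewrite -derive1E (differentiation_under_integral measurableT I0 iF deF G0 (integrable_scaled K) bF).
apply: eq_Rintegral => y _; rewrite partial1of2E.
by have [_ ->] := dF 0 y I0.
Qed.

Lemma potential_bounded s g x : decay 0 s g -> a <= s -> halfspace R m x ->
  exists M, forall x', cube x (rV_last x / 2) x' -> `|potential g x'| <= M.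
Proof.
move=> dg a_s x0; have [K K0 HK] := decay_dominated dg a_s x0.
exists (\int[leb]_y (K * `|japan a y * f y|)) => x' xx'.
have x'0 : halfspace R m x'.
  by apply: lt_le_trans (halfspace_cube x0 xx'); rewrite divr_gt0.
have ig := integrable_potential dg a_s x'0.
apply: le_trans (le_normr_Rintegral measurableT ig) _.
apply: le_Rintegral => //.
- exact: (integrable_abse ig).
- exact: integrable_scaled.
- by move=> y _; exact: HK.
Qed.

(** The partial derivatives of the potential are potentials, locally bounded by the
same domination. *)
Lemma continuous_potential s g x : decay 1 s g -> a <= s -> halfspace R m x ->
  {for x, continuous (potential g)}.
Proof.
move=> dg a_s x0; have dg0 := decayW dg.
have [_ _ [g' Hg]] := dg.
have a_s2 : a <= s + 2^-1 by rewrite (le_trans a_s)// lerDl.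
have /choice[M HM] : forall i, exists M, forall x', cube x (rV_last x / 2) x' ->
    `|potential (g' i) x'| <= M.
  by move=> i; have [dgi _] := Hg i; exact: potential_bounded dgi a_s2 x0.
have t0 : 0 < rV_last x / 2 by rewrite divr_gt0.
apply: (@continuous_of_partials _ _ x (rV_last x / 2) (\sum_i `|M i|) (potential g) (fun i => potential (g' i))) => //.
- move=> i y yx; have [dgi gE] := Hg i.
  apply: is_derive_potential dg0 dgi gE a_s _.
  exact: lt_le_trans (halfspace_cube x0 yx).
- move=> i y yx; apply: le_trans (HM i y yx) _.
  rewrite (bigD1 i)//=; apply: le_trans (ler_norm _) _.
  by rewrite lerDl; exact: sumr_ge0.
Qed.

(** Convergence of the potential, which linearity requires. *)
Definition has_potential g x : Prop :=
  leb.-integrable setT (fun y => (g (x - rV_rcons y 0) * f y)%:E).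

Lemma has_potential_sum (I : Type) (r : seq I) (g : I -> V -> R) x :
  (forall i, has_potential (g i) x) -> has_potential (fun w => \sum_(i <- r) g i w) x.
Proof.
move=> ig; rewrite /has_potential.
rewrite (_ : (fun y => _) = (fun y => (\sum_(i <- r) (g i (x - rV_rcons y 0) * f y)%:E)%E)).
  by apply: integrable_sum => // i _; exact: ig.
by apply/funext => y; rewrite mulr_suml sumEFin.
Qed.

Lemma potential_sum (I : Type) (r : seq I) (g : I -> V -> R) x :
  (forall i, has_potential (g i) x) ->
  \sum_(i <- r) potential (g i) x = potential (fun w => \sum_(i <- r) g i w) x.
Proof.
move=> ig; elim: r => [|i r IH].
  rewrite big_nil /potential; under eq_Rintegral do rewrite big_nil mul0r.
  by rewrite Rintegral_cst// mul0r.
rewrite big_cons IH /potential -RintegralD//.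
- by apply: eq_Rintegral => y _; rewrite big_cons mulrDl.
- exact: ig.
- exact: has_potential_sum.
Qed.

Lemma potentialD g h x : has_potential g x -> has_potential h x ->
  potential (fun w => g w + h w) x = potential g x + potential h x.
Proof.
move=> ig ih; rewrite /potential -RintegralD//.
by apply: eq_Rintegral => y _; rewrite mulrDl.
Qed.

Lemma potentialZ g x c : has_potential g x ->
  potential (fun w => c * g w) x = c * potential g x.
Proof.
move=> ig; rewrite /potential -RintegralZl//.
by apply: eq_Rintegral => y _; rewrite mulrA.
Qed.

Lemma has_potentialZ g x c : has_potential g x -> has_potential (fun w => c * g w) x.
Proof.
move=> ig; rewrite /has_potential.
rewrite (_ : (fun y => _) = (fun y => c%:E * (g (x - rV_rcons y 0) * f y)%:E)%E).
  exact: integrableZl.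
by apply/funext => y; rewrite -mulrA.
Qed.

End potential.

(** * The Poisson integral: harmonicity and gradient *)

Section poisson_kernel.
Context {R : realType} (m : nat).
Local Notation V := 'rV[R]_m.+1.
Local Notation e_ i := (delta_mx ord0 i : V).
Local Notation leb := (lebesgue_rV R m).
Local Notation a := (m.+1%:R / 2 : R).
Local Notation c := (2 / omega R m.+1).
Implicit Types (x w : V) (y : 'rV[R]_m) (g h u : V -> R).

Definition drpow (i : 'I_m.+1) w : R := - (2 * a) * (w ord0 i * rpow (a + 1) w).

Definition ddrpow (i j : 'I_m.+1) w : R :=
  - (2 * a) * ((j == i)%:R * rpow (a + 1) w +
    w ord0 i * (- (2 * (a + 1)) * (w ord0 j * rpow (a + 1 + 1) w))).

Lemma decay_drpow k i : decay k (a + 2^-1) (drpow i).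
Proof.
have -> : a + 2^-1 = 0 + (- 2^-1 + (a + 1)) by field.
apply: (decayM (g := cst (- (2 * a))) (h := (fun w => w ord0 i) \* rpow (a + 1))).
  exact: decay_cst.
by apply: decayM; [exact: decay_coord|exact: decay_rpow].
Qed.

Lemma decay_ddrpow k i j : decay k (a + 2^-1 + 2^-1) (ddrpow i j).
Proof.
have -> : a + 2^-1 + 2^-1 = 0 + (a + 1) by field.
apply: (decayM (g := cst (- (2 * a))) (h := (cst (j == i)%:R \* rpow (a + 1)) \+
  ((fun w => w ord0 i) \* (cst (- (2 * (a + 1))) \* ((fun w => w ord0 j) \* rpow (a + 1 + 1)))))).
  exact: decay_cst.
apply: decayD.
  rewrite -[a + 1]add0r; apply: decayM; [exact: decay_cst|].
  by rewrite add0r; exact: decay_rpow.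
have -> : a + 1 = - 2^-1 + (0 + (- 2^-1 + (a + 1 + 1))) by field.
apply: decayM; first exact: decay_coord.
have -> : - 2^-1 + (0 + (- 2^-1 + (a + 1 + 1))) = a + 1 by field.
apply: decayM; first exact: decay_cst.
by apply: decayM; [exact: decay_coord|exact: decay_rpow].
Qed.

Lemma is_derive_drpow i j w : halfspace R m w ->
  is_derive w (e_ j) (drpow i) (ddrpow i j w).
Proof.
move=> w0.
have D := is_deriveZ (- (2 * a))
  (is_deriveM (is_derive_coord j i w) (is_derive_rpow (a + 1) j w0)).
apply: (is_derive_eq D); rewrite /GRing.scale/= /ddrpow; congr (_ * _).
by rewrite addrC; congr (_ + _); rewrite mulrC.
Qed.

Section with_density.
Variable f : 'rV[R]_m -> R.
Hypothesis mf : measurable_fun setT f.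
Hypothesis intf : leb.-integrable setT (fun y => (japan a y * f y)%:E).
Local Notation pot g := (potential f g).

Lemma has_potential_rpow x : halfspace R m x -> has_potential f (rpow a) x.
Proof. by move=> x0; exact: (integrable_potential mf intf (decay_rpow _ 0 _) (lexx _) x0). Qed.

Lemma has_potential_drpow i x : halfspace R m x -> has_potential f (drpow i) x.
Proof. by move=> x0; apply: (integrable_potential mf intf (decay_drpow 0 i)) => //; rewrite lerDl. Qed.

Lemma has_potential_ddrpow i j x : halfspace R m x -> has_potential f (ddrpow i j) x.
Proof.
by move=> x0; apply: (integrable_potential mf intf (decay_ddrpow 0 i j)) => //; rewrite -addrA lerDl.
Qed.

Lemma is_derive_pot_rpow i x : halfspace R m x ->
  is_derive x (e_ i) (pot (rpow a)) (pot (drpow i) x).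
Proof.
move=> x0; apply: (is_derive_potential mf intf (s := a)) => //.
- exact: decay_rpow.
- exact: decay_drpow.
- by move=> w w0; exact: is_derive_rpow.
Qed.

Lemma is_derive_pot_drpow i j x : halfspace R m x ->
  is_derive x (e_ j) (pot (drpow i)) (pot (ddrpow i j) x).
Proof.
move=> x0; apply: (is_derive_potential mf intf (s := a + 2^-1)) => //.
- exact: decay_drpow.
- exact: decay_ddrpow.
- by move=> w w0; exact: is_derive_drpow.
- by rewrite lerDl.
Qed.

(** The Poisson kernel is the product of x_n, constant along the boundary, and of
|x - y|^-n; only the second factor has to be differentiated under the integral. *)
Lemma poissonE x : halfspace R m x ->
  poisson f x = c * (rV_last x * pot (rpow a) x).
Proof.
move=> x0; rewrite /poisson -(potentialZ _ (has_potential_rpow x0)).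
congr (_ * _); apply: eq_Rintegral => y _; congr (_ * _ * _).
rewrite -enormN opprB -powR_mulrn ?enorm_ge0// /enorm -powR12_sqrt ?dotr_ge0//.
rewrite -powRrM -powRN /rpow; congr (_ `^ (- _)).
by rewrite mulrC.
Qed.

(** The candidates for the first and second partial derivatives of the Poisson
integral, by Leibniz' rule for x_n u. *)
Definition dpoisson i x : R :=
  c * ((i == ord_max)%:R * pot (rpow a) x + rV_last x * pot (drpow i) x).

Definition ddpoisson i j x : R :=
  c * ((i == ord_max)%:R * pot (drpow j) x +
    ((j == ord_max)%:R * pot (drpow i) x + rV_last x * pot (ddrpow i j) x)).

Lemma is_derive_poisson i x : halfspace R m x ->
  is_derive x (e_ i) (poisson f) (dpoisson i x).
Proof.
move=> x0; apply: (is_derive_halfspace x0 (g := fun x => c * (rV_last x * pot (rpow a) x))).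
  by move=> y y0; rewrite poissonE.
have D := is_deriveZ c (is_deriveM (is_derive_coord i ord_max x) (is_derive_pot_rpow i x0)).
apply: (is_derive_eq D); rewrite /GRing.scale/= /dpoisson; congr (_ * _).
by rewrite addrC; congr (_ + _); rewrite mulrC.
Qed.

Lemma is_derive_dpoisson i j x : halfspace R m x ->
  is_derive x (e_ j) (dpoisson i) (ddpoisson i j x).
Proof.
move=> x0.
have D1 := is_deriveZ (i == ord_max)%:R (is_derive_pot_rpow j x0).
have D2 := is_deriveM (is_derive_coord j ord_max x) (is_derive_pot_drpow i j x0).
apply: (is_derive_eq (is_deriveZ c (is_deriveD D1 D2))).
rewrite /GRing.scale/= /ddpoisson; congr (_ * (_ + _)).
by rewrite addrC; congr (_ + _); rewrite mulrC.
Qed.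

Lemma continuous_rV_last x : {for x, continuous (@rV_last R m)}.
Proof. exact: coord_continuous. Qed.

Lemma continuous_ddpoisson i j x : halfspace R m x ->
  {for x, continuous (ddpoisson i j)}.
Proof.
move=> x0.
have c1 k : {for x, continuous (pot (drpow k))}.
  by apply: (continuous_potential mf intf (s := a + 2^-1)) => //; [exact: decay_drpow|rewrite lerDl].
have c2 : {for x, continuous (pot (ddrpow i j))}.
  apply: (continuous_potential mf intf (s := a + 2^-1 + 2^-1)) => //; first exact: decay_ddrpow.
  by rewrite -addrA lerDl.
apply: continuousM; first exact: cst_continuous.
apply: continuousD; first by apply: continuousM; [exact: cst_continuous|exact: c1].
apply: continuousD; first by apply: continuousM; [exact: cst_continuous|exact: c1].
by apply: continuousM; [exact: continuous_rV_last|exact: c2].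
Qed.

Lemma continuous_halfspace x g h : halfspace R m x ->
  (forall w, halfspace R m w -> g w = h w) ->
  {for x, continuous g} -> {for x, continuous h}.
Proof.
move=> x0 gh cg; have {}cg : g @ x --> h x by rewrite -(gh x x0).
suff : h @ x --> h x by [].
apply: (cvg_trans _ cg); apply: (@near_eq_cvg _ _ (nbhs x) (nbhs_filter x)); near=> y.
apply: gh.
by near: y; exact: near_halfspace.
Unshelve. all: by end_near. Qed.

(** With the exponent - n of |w| one has Delta |w|^-n = 2 n |w|^(- n - 2). *)
Lemma laplacian_rpow w : halfspace R m w ->
  \sum_i ddrpow i i w = 2 * a * (2 * rpow (a + 1) w).
Proof.
move=> w0; rewrite -mulr_sumr.
under eq_bigr => i _ do rewrite eqxx mul1r [w ord0 i * (_ * _)]mulrCA [w ord0 i * (_ * _)]mulrA.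
rewrite big_split/= sumr_const card_ord -mulr_sumr -mulr_suml -/(dotr w w).
have -> : dotr w w * rpow (a + 1 + 1) w = rpow (a + 1) w.
  have d0 := halfspace_dotr w0.
  rewrite /rpow -[X in X * _]powRr1 ?dotr_ge0// -powRD ?(gt_eqF d0) ?implybT//.
  by congr (_ `^ _); ring.
by rewrite -mulr_natl; field.
Qed.

(** Delta (x_n u) = 2 d_n u + x_n Delta u, and for the kernel |w|^-n the two terms
cancel: d_n |w|^-n = - n w_n |w|^(- n - 2), where w_n = x_n. *)
Lemma harmonic_poisson : harmonic_on (halfspace R m) (poisson f).
Proof.
have E1 i x : halfspace R m x -> dpoisson i x = partial i (poisson f) x.
  by move=> x0; have [_ <-] := is_derive_poisson i x0.
have D1 i j x : halfspace R m x -> is_derive x (e_ j) (partial i (poisson f)) (ddpoisson i j x).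
  by move=> x0; apply: (is_derive_halfspace x0 (E1 i)); exact: is_derive_dpoisson.
have E2 i j x : halfspace R m x -> ddpoisson i j x = partial j (partial i (poisson f)) x.
  by move=> x0; have [_ <-] := D1 i j x x0.
move=> x x0; split.
- by move=> i; apply: ex_derive; exact: is_derive_poisson.
- by move=> i j; apply: ex_derive; exact: D1.
- move=> i j; apply: (continuous_halfspace x0 (E2 i j)); exact: continuous_ddpoisson.
- rewrite /laplacian; under eq_bigr => i _ do rewrite -E2//.
  rewrite -mulr_sumr big_split/= big_split/=.
  have pick : \sum_i (i == ord_max :> 'I_m.+1)%:R * pot (drpow i) x = pot (drpow ord_max) x.
    rewrite (bigD1 ord_max)//= eqxx mul1r big1 ?addr0// => i /negbTE ->.
    by rewrite mul0r.
  rewrite !pick -mulr_sumr potential_sum; last by move=> i; exact: has_potential_ddrpow.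
  have hs : has_potential f (fun w => \sum_i ddrpow i i w) x.
    by apply: has_potential_sum => i; exact: has_potential_ddrpow.
  rewrite -(potentialZ _ hs) addrA.
  (* The two first-order terms and the Laplacian become one potential, whose kernel
     vanishes identically. *)
  have -> : pot (drpow ord_max) x + pot (drpow ord_max) x = pot (fun w => 2 * drpow ord_max w) x.
    by rewrite potentialZ; [ring|exact: has_potential_drpow].
  rewrite -potentialD; last 2 first.
  + by apply: has_potentialZ; exact: has_potential_drpow.
  + exact: has_potentialZ.
  rewrite (_ : pot _ x = 0) ?mulr0// /potential.
  transitivity (\int[leb]_y (0 : R)); last by rewrite Rintegral_cst// mul0r.
  apply: eq_Rintegral => y _; have hw := halfspace_sub_rcons y x0.
  have lw : (x - rV_rcons y 0) ord0 ord_max = rV_last x := rV_last_sub_rcons x y.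
  by rewrite laplacian_rpow// /drpow lw; ring.
Qed.

(** The kernel k_z, as a function of w = x - y. *)
Definition grad_kernel (alpha : R) (z : V) w : R :=
  rpow a w * direction_form alpha (radial_proj w) z.

Lemma direction_formE alpha (s z : V) : direction_form alpha s z =
  alpha * rV_last z - rV_last s * dotr s z.
Proof.
by rewrite /direction_form dotrBl !dotrZl (dotrC (e_last R m) z) !rV_lastE.
Qed.

Lemma grad_kernelE alpha z w : halfspace R m w ->
  grad_kernel alpha z w = alpha * rV_last z * rpow a w - rV_last w * dotr w z * rpow (a + 1) w.
Proof.
move=> w0; rewrite /grad_kernel direction_formE rV_last_radial_proj.
rewrite /radial_proj dotrZl.
have d0 := halfspace_dotr w0.
have -> : rpow (a + 1) w = rpow a w * ((enorm w)^-1 ^+ 2).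
  rewrite exprVn enorm_sqr /rpow -[(dotr w w)^-1]powR_inv1 ?dotr_ge0//.
  rewrite -powRD ?(gt_eqF d0) ?implybT//.
  by congr (_ `^ _); ring.
by ring.
Qed.

Lemma is_derive_rV_last_powR b i x : halfspace R m x ->
  is_derive x (e_ i) (fun w => rV_last w `^ b) (b * rV_last x `^ (b - 1) * (i == ord_max)%:R).
Proof.
move=> x0; have x00 : x = x + 0 *: e_ i by rewrite scale0r addr0.
have := is_derive_coord i ord_max x; rewrite {1}x00 => /is_derive_line dl.
rewrite {1}x00; apply/is_derive_line.
have P : 0 < (x + 0 *: e_ i) ord0 ord_max by rewrite -x00.
have D := @is_derive1_comp _ (@powR R ^~ b) _ _ _ _ (is_derive1_powR b P) dl.
by apply: (is_derive_eq D); rewrite -x00.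
Qed.

(** Leibniz' rule for x_n^(n alpha) u gives n alpha x_n^(n alpha - 1) u e_n plus
x_n^(n alpha) grad u, and grad |w|^-n = - n |w|^(- n - 2) w.  With w_n = x_n both
terms contain the factor n x_n^(n alpha - 1), and what is left is the form
(alpha e_n - (e_s, e_n) e_s, z) at e_s = w / |w|. *)
Lemma dotr_grad (alpha : R) v z x : halfspace R m x ->
  (forall x, halfspace R m x -> v x = poisson f x) ->
  dotr (grad (fun w => rV_last w `^ (m.+1%:R * alpha - 1) * v w) x) z =
  c * m.+1%:R * rV_last x `^ (m.+1%:R * alpha - 1) * pot (grad_kernel alpha z) x.
Proof.
move=> x0 vE; set b := m.+1%:R * alpha; set F := fun w => _.
have dF i : is_derive x (e_ i) F (c * (rV_last x `^ b * pot (drpow i) x +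
    pot (rpow a) x * (b * rV_last x `^ (b - 1) * (i == ord_max)%:R))).
  apply: (is_derive_halfspace x0 (g := fun w => c * (rV_last w `^ b * pot (rpow a) w))).
    move=> w w0; rewrite /F vE// poissonE// [RHS]mulrCA; congr (_ * _); rewrite [RHS]mulrA.
    congr (_ * _); rewrite -[X in _ * X]powRr1 ?ltW// -powRD ?subrK//.
    by rewrite (gt_eqF w0) implybT.
  have D := is_deriveZ c (is_deriveM (is_derive_rV_last_powR b i x0) (is_derive_pot_rpow i x0)).
  by apply: (is_derive_eq D).
have gE i : grad F x ord0 i = c * (rV_last x `^ b * pot (drpow i) x +
    pot (rpow a) x * (b * rV_last x `^ (b - 1) * (i == ord_max)%:R)).
  by rewrite mxE /partial; have [_ ->] := dF i.
(* The kernel of (grad u, z). *)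
pose S w := \sum_i z ord0 i * drpow i w.
have hS : has_potential f S x.
  by apply: has_potential_sum => i; apply: has_potentialZ; exact: has_potential_drpow.
have SE : \sum_i z ord0 i * pot (drpow i) x = pot S x.
  rewrite -potential_sum; last by move=> i; apply: has_potentialZ; exact: has_potential_drpow.
  by apply: eq_bigr => i _; rewrite potentialZ//; exact: has_potential_drpow.
have -> : dotr (grad F x) z = c * (rV_last x `^ b * pot S x +
    pot (rpow a) x * (b * rV_last x `^ (b - 1)) * rV_last z).
  rewrite /dotr -SE mulr_sumr.
  rewrite [X in _ + X](_ : _ = \sum_(i < m.+1) pot (rpow a) x * (b * rV_last x `^ (b - 1) * (i == ord_max)%:R) * z ord0 i); last first.
    rewrite (bigD1 ord_max)//= big1 ?addr0 ?eqxx ?mulr1// => i /negbTE ->.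
    by rewrite !mulr0 mul0r.
  rewrite -big_split/= mulr_sumr; apply: eq_bigr => i _; rewrite gE; ring.
have -> : pot (grad_kernel alpha z) x =
    pot (fun w => alpha * rV_last z * rpow a w + rV_last x / m.+1%:R * S w) x.
  apply: eq_Rintegral => y _; congr (_ * _).
  set w := x - rV_rcons y 0.
  have lw : rV_last w = rV_last x := rV_last_sub_rcons x y.
  rewrite grad_kernelE; last by rewrite /halfspace/= lw.
  rewrite lw; congr (_ + _).
  have -> : S w = - (2 * a) * (dotr w z * rpow (a + 1) w).
    rewrite /S /drpow /dotr mulr_suml mulr_sumr; apply: eq_bigr => i _; ring.
  by field; rewrite addrC natr1 pnatr_eq0.
rewrite potentialD; last 2 first.
- by apply: has_potentialZ; exact: has_potential_rpow.
- exact: has_potentialZ.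
rewrite (potentialZ _ (has_potential_rpow x0)) (potentialZ _ hS).
have -> : rV_last x `^ b = rV_last x `^ (b - 1) * rV_last x.
  rewrite -[X in _ * X]powRr1 ?ltW// -powRD ?subrK//.
  by rewrite (gt_eqF x0) implybT.
rewrite /b; move: (2 / omega R m.+1) => C; field.
by rewrite addrC natr1 pnatr_eq0.
Qed.

End with_density.

Lemma measurable_direction_form alpha (z : V) d (T : measurableType d) (s : T -> V) :
  measurable_fun setT s -> measurable_fun setT (fun t => direction_form alpha (s t) z).
Proof.
move=> ms; under eq_fun do rewrite direction_formE.
apply: measurable_funB => //; apply: measurable_funM; first exact: measurable_funlast.
exact: measurable_dotr.
Qed.

Lemma direction_form_le alpha (s z : V) : enorm s = 1 -> enorm z = 1 ->
  `|direction_form alpha s z| <= `|alpha| + 1.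
Proof.
move=> s1 z1; rewrite direction_formE; apply: le_trans (ler_normB _ _) _.
rewrite !normrM lerD//.
  by rewrite ler_piMr// (le_trans (rV_last_le_enorm _))// z1.
rewrite mulr_ile1//; first by rewrite (le_trans (rV_last_le_enorm _))// s1.
by rewrite (le_trans (Cauchy_Schwarz_dotr _ _))// s1 z1 mulr1.
Qed.

Lemma decay_grad_kernel alpha (z : V) : enorm z = 1 -> decay 0 a (grad_kernel alpha z).
Proof.
move=> z1; split => //.
  apply: measurable_funM; first exact: measurable_rpow.
  by apply: measurable_direction_form; exact: measurable_radial_proj.
exists (`|alpha| + 1) => [|w w0]; first exact: addr_ge0.
rewrite normrM mulrC ler_pM//; last by rewrite ger0_norm ?powR_ge0.
apply: direction_form_le => //; apply: enorm_radial_proj.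
by rewrite -enorm_gt0 -(@ltr_pXn2r _ 2)// ?nnegrE ?enorm_ge0// expr0n enorm_sqr halfspace_dotr.
Qed.

End poisson_kernel.

(** * Hoelder's inequality and its converse *)

Section Lp_duality.
Context d {T : measurableType d} {R : realType}.
Variable mu : {measure set T -> \bar R}.
Implicit Types (k f : T -> R) (r q : R) (p : \bar R).

Lemma mem_LfunP p f : f \in Lfun mu p <->
  measurable_fun setT f /\ ('N[mu]_p[EFin \o f] < +oo)%E.
Proof.
split; first by move=> /andP[]; rewrite !inE.
by move=> [mf nf]; apply/andP; rewrite !inE.
Qed.

Lemma integral_indicT (A : set T) : measurable A ->
  (\int[mu]_x ((\1_A : T -> R) x)%:E = mu A)%E.
Proof. by move=> mA; rewrite integral_indic// setIT. Qed.

Lemma LnormE_real q f :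
  ('N[mu]_(q%:E)[EFin \o f] = (\int[mu]_x (`|f x| `^ q)%:E) `^ q^-1)%E.
Proof.
by rewrite unlock; congr (_ `^ _)%E; apply: eq_integral => x _; rewrite /= poweR_EFin.
Qed.

Lemma integral_powR_ge0 q k : (0 <= \int[mu]_x (`|k x| `^ q)%:E)%E.
Proof. by apply: integral_ge0 => x _; rewrite lee_fin powR_ge0. Qed.

Lemma measurable_fun_normpowR q k : measurable_fun setT k ->
  measurable_fun setT (fun x => `|k x| `^ q).
Proof. by move=> mk; apply: measurable_funpowR; exact: measurableT_comp. Qed.

Lemma integrable_of_Lnorm1 k :
  measurable_fun setT k -> ('N[mu]_1[EFin \o k] < +oo)%E -> mu.-integrable setT (EFin \o k).
Proof.
move=> mk; rewrite Lnorm1 => kf; apply/integrableP; split => //.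
exact/measurable_EFinP.
Qed.

Lemma norm_Rintegral_Lnorm1 k (A : R) : mu.-integrable setT (EFin \o k) ->
  ('N[mu]_1[EFin \o k] <= A%:E)%E -> `|\int[mu]_x k x| <= A.
Proof.
move=> ik; rewrite Lnorm1 => kA.
apply: le_trans (le_normr_Rintegral measurableT ik) _.
rewrite -lee_fin /Rintegral fineK//.
by have := integrable_fin_num measurableT (integrable_abse ik).
Qed.

Lemma hoelder_Rintegral r k f : 1 < r -> measurable_fun setT k ->
  (\int[mu]_x (`|k x| `^ (r / (r - 1)))%:E)%E \is a fin_num ->
  f \in Lfun mu r%:E ->
  mu.-integrable setT (fun x => (k x * f x)%:E) /\
  `|\int[mu]_x (k x * f x)| <=
    (\int[mu]_x (`|k x| `^ (r / (r - 1)))) `^ ((r - 1) / r) *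
    fine 'N[mu]_(r%:E)[EFin \o f].
Proof.
move=> r1 mk kfin /mem_LfunP[mf ffin].
have r0 : 0 < r by exact: lt_trans r1.
have r10 : 0 < r - 1 by rewrite subr_gt0.
pose q := r / (r - 1); have q0 : 0 < q by rewrite divr_gt0.
have := @hoelder _ _ _ mu k f q r mk mf q0 r0.
rewrite LnormE_real -/q in kfin *.
have -> : (r - 1) / r = q^-1 by rewrite invf_div.
rewrite -[X in (X `^ _)%E](fineK kfin) -[X in _ -> (_ <= _ * X)%E]fineK; last first.
  by rewrite ge0_fin_numE// Lnorm_ge0.
rewrite poweR_EFin -EFinM => H.
have {}H := H _.
have qr : q^-1 + r^-1 = 1 by rewrite /q invf_div; field; rewrite gt_eqF.
have mkf : measurable_fun setT (k \* f)%R by exact: measurable_funM.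
have ikf : mu.-integrable setT (EFin \o (k \* f)%R).
  apply: integrable_of_Lnorm1 => //; apply: le_lt_trans (H qr) _.
  by rewrite ltry.
by split => //; exact: (norm_Rintegral_Lnorm1 ikf (H qr)).
Qed.

(** The case p = oo of Hoelder's inequality; |f| is bounded by its norm only almost
everywhere. *)
Lemma Linfty_Rintegral k f : (0 < mu [set: T])%E -> mu.-integrable setT (EFin \o k) ->
  f \in Lfun mu +oo%E ->
  mu.-integrable setT (fun x => (k x * f x)%:E) /\
  `|\int[mu]_x (k x * f x)| <= (\int[mu]_x `|k x|) * fine 'N[mu]_(+oo%E)[EFin \o f].
Proof.
move=> mu0 ik /mem_LfunP[mf ffin].
have mk : measurable_fun setT k by apply/measurable_EFinP; exact: (measurable_int mu).
have Nfin : 'N[mu]_+oo[EFin \o f]%E \is a fin_num by rewrite ge0_fin_numE// Lnorm_ge0.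
set N := fine _; have NE : 'N[mu]_+oo[EFin \o f]%E = N%:E by rewrite fineK.
have N0 : 0 <= N by rewrite fine_ge0// Lnorm_ge0.
have fN : {ae mu, forall x, `|f x| <= N}.
  have : ('N[mu]_+oo[EFin \o f] <= N%:E)%E by rewrite NE.
  rewrite unlock mu0 => /ess_supP.
  by apply: filterS => x /=; rewrite lee_fin.
have mkf : measurable_fun setT (k \* f)%R by exact: measurable_funM.
have iK : (\int[mu]_x `|(k x)%:E|)%E \is a fin_num.
  exact: (integrable_fin_num measurableT (integrable_abse ik)).
have H : ('N[mu]_1[EFin \o (k \* f)%R] <= (\int[mu]_x `|k x| * N)%:E)%E.
  have mak : measurable_fun setT (fun x => `|k x|%:E) by apply/measurable_EFinP; exact: measurableT_comp.
  rewrite Lnorm1 EFinM /Rintegral fineK// -ge0_integralZr//.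
  apply: ae_ge0_le_integral => //.
  - by apply: measurableT_comp => //; exact/measurable_EFinP.
  - by move=> x _; rewrite mule_ge0.
  - exact: emeasurable_funM.
  - by apply: filterS fN => x fx _; rewrite /= normrM lee_fin ler_wpM2l.
have ikf : mu.-integrable setT (EFin \o (k \* f)%R).
  apply: integrable_of_Lnorm1 => //; apply: le_lt_trans H _.
  by rewrite ltry.
by split => //; exact: (norm_Rintegral_Lnorm1 ikf H).
Qed.

(** The case p = 1 of Hoelder's inequality; a pointwise bound of k suffices. *)
Lemma L1_Rintegral k f (A : R) : measurable_fun setT k -> (forall x, `|k x| <= A) ->
  f \in Lfun mu 1%:E ->
  mu.-integrable setT (fun x => (k x * f x)%:E) /\
  `|\int[mu]_x (k x * f x)| <= A * fine 'N[mu]_(1%:E)[EFin \o f].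
Proof.
move=> mk kA /mem_LfunP[mf ffin].
have Nfin : 'N[mu]_1[EFin \o f]%E \is a fin_num by rewrite ge0_fin_numE// Lnorm_ge0.
have mkf : measurable_fun setT (k \* f)%R by exact: measurable_funM.
have H : ('N[mu]_1[EFin \o (k \* f)%R] <= (A * fine 'N[mu]_(1%:E)[EFin \o f])%:E)%E.
  rewrite EFinM fineK// !Lnorm1.
  have [x0|/= T0] := pselect (exists x : T, True); last first.
    rewrite !integral0_eq ?mule0// => x; by exfalso; apply: T0; exists x.
  have A0 : 0 <= A by have [x _] := x0; apply: le_trans (kA x).
  rewrite -ge0_integralZl//; last first.
    by apply: measurableT_comp => //; exact/measurable_EFinP.
  apply: ge0_le_integral => //.
  - by apply: measurableT_comp => //; exact/measurable_EFinP.
  - by apply: measurable_funeM; apply: measurableT_comp => //; exact/measurable_EFinP.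
  - by move=> x _; rewrite /= normrM lee_fin ler_wpM2r.
have ikf : mu.-integrable setT (EFin \o (k \* f)%R).
  apply: integrable_of_Lnorm1 => //; apply: le_lt_trans H _.
  by rewrite ltry.
by split => //; exact: (norm_Rintegral_Lnorm1 ikf H).
Qed.

(** Supplies one function of positive norm, which forces admissible constants to be
nonnegative. *)
Lemma Lfun_indic p (A : set T) : (1 <= p)%E -> measurable A -> (0 < mu A < +oo)%E ->
  (\1_A : T -> R) \in Lfun mu p /\ 0 < fine 'N[mu]_p[EFin \o (\1_A : T -> R)].
Proof.
move=> p1 mA /andP[A0 Afin].
have m1 : measurable_fun setT (\1_A : T -> R) by exact: measurable_indic.
have muT : (0 < mu [set: T])%E by apply: lt_le_trans A0 _; apply: le_measure; rewrite ?inE.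
have fin : ('N[mu]_p[EFin \o (\1_A : T -> R)] < +oo)%E.
  case: p p1 => [r|_|]; last by rewrite leeNy_eq.
  - rewrite lee_fin => r1; have r0 : 0 < r by exact: lt_le_trans r1.
    rewrite LnormE_real.
    have -> : (\int[mu]_x (`|\1_A x| `^ r)%:E = mu A)%E.
      rewrite -[RHS]integral_indicT//; apply: eq_integral => x _.
      rewrite indicE; case: (x \in A); rewrite ?normr1 ?powR1 ?normr0 ?powR0//.
      by rewrite gt_eqF.
    by rewrite -(@fineK _ (mu A)) ?ge0_fin_numE// poweR_EFin ltry.
  - rewrite unlock muT; apply: (@le_lt_trans _ _ 1%:E); last by rewrite ltry.
    apply/ess_supP; apply: aeW => x /=; rewrite lee_fin indicE.
    by case: (x \in A); rewrite ?normr1 ?normr0.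
split; first by apply/mem_LfunP.
rewrite fine_gt0// fin andbT lt_neqAle Lnorm_ge0 andbT eq_sym; apply/eqP.
have p0 : (0 < p)%E by apply: lt_le_trans p1.
move=> /(Lnorm_eq0_eq0 _ p0) H.
have {}H := H (proj2 (measurable_EFinP _ _) m1).
have : mu A = 0%E.
  have [N [mN N0 sub]] := H.
  apply/eqP; rewrite eq_le measure_ge0 andbT -N0; apply: le_measure; rewrite ?inE//.
  move=> x Ax; apply: sub => /= /(_ I); rewrite indicE mem_set//= => /eqP.
  by rewrite eqe oner_eq0.
by move=> E; rewrite E ltxx in A0.
Qed.

Lemma measurable_sg k : measurable_fun setT k -> measurable_fun setT (fun x => Num.sg (k x)).
Proof.
move=> mk.
rewrite (_ : (fun x => _) = (fun x => if 0 < k x then 1 else if k x < 0 then -1 else 0)).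
  apply: measurable_fun_ifT => //; first exact: measurable_fun_ltr.
  by apply: measurable_fun_ifT => //; exact: measurable_fun_ltr.
by apply/funext => x; case: sgrP => // _; rewrite ?ltxx.
Qed.

(** Equality holds in Hoelder's inequality for f = sign(k) |k|^(q - 1): then k f and
|f|^r are both |k|^q. *)
Lemma duality_ge_Lr r k (K : R) : 1 < r -> measurable_fun setT k ->
  (\int[mu]_x (`|k x| `^ (r / (r - 1)))%:E)%E \is a fin_num -> 0 <= K ->
  (forall f, f \in Lfun mu r%:E -> `|\int[mu]_x (k x * f x)| <= K * fine 'N[mu]_(r%:E)[EFin \o f]) ->
  (\int[mu]_x (`|k x| `^ (r / (r - 1)))) `^ ((r - 1) / r) <= K.
Proof.
move=> r1 mk kfin K0 H.
have r0 : 0 < r by exact: lt_trans r1.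
have r10 : 0 < r - 1 by rewrite subr_gt0.
pose q := r / (r - 1); have q0 : 0 < q by rewrite divr_gt0.
rewrite -/q in kfin *.
have qV : (r - 1) / r = q^-1 by rewrite invf_div.
set I := \int[mu]_x _; have I0 : 0 <= I by rewrite fine_ge0// integral_powR_ge0.
have IE : (\int[mu]_x (`|k x| `^ q)%:E = I%:E)%E by rewrite fineK.
pose f x := Num.sg (k x) * `|k x| `^ (q - 1).
have q10 : 0 < q - 1.
  have -> : q - 1 = (r - 1)^-1 by rewrite /q; field; rewrite gt_eqF.
  by rewrite invr_gt0.
have mf : measurable_fun setT f.
  by apply: measurable_funM; [exact: measurable_sg|exact: measurable_fun_normpowR].
have fr x : `|f x| `^ r = `|k x| `^ q.
  rewrite /f normrM normr_sg (ger0_norm (powR_ge0 _ _)).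
  have [->|k0] := eqVneq (k x) 0.
    by rewrite mul0r normr0 !powR0 ?gt_eqF.
  rewrite mul1r -powRrM; congr (_ `^ _).
  by rewrite /q; field; rewrite gt_eqF.
have NE : 'N[mu]_(r%:E)[EFin \o f]%E = (I `^ r^-1)%:E.
  by rewrite LnormE_real; under eq_integral do rewrite fr; rewrite IE poweR_EFin.
have fL : f \in Lfun mu r%:E by apply/mem_LfunP; split => //; rewrite NE ltry.
have kf x : k x * f x = `|k x| `^ q.
  rewrite /f mulrA [k x * _]mulrC -normrEsg.
  have [->|k0] := eqVneq (k x) 0; first by rewrite normr0 mul0r powR0// gt_eqF.
  by rewrite mulr_powRB1.
have := H f fL; rewrite NE /=.
have -> : \int[mu]_x (k x * f x) = I by apply: eq_Rintegral => x _; exact: kf.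
rewrite ger0_norm// qV => IK.
(* I <= K I^(1/r) gives I^(1/q) <= K after division, unless I = 0. *)
have [->|I_neq0] := eqVneq I 0; first by rewrite powR0// invr_neq0// gt_eqF.
have I_gt0 : 0 < I by rewrite lt_neqAle eq_sym I_neq0.
rewrite -(ler_pM2r (powR_gt0 r^-1 I_gt0)) -powRD ?(gt_eqF I_gt0) ?implybT//.
have -> : q^-1 + r^-1 = 1 by rewrite /q invf_div; field; rewrite gt_eqF.
by rewrite powRr1.
Qed.

(** Test with f = sign(k), of norm at most 1. *)
Lemma duality_ge_Linfty k (K : R) : measurable_fun setT k -> (0 < mu [set: T])%E -> 0 <= K ->
  (forall f, f \in Lfun mu +oo%E -> `|\int[mu]_x (k x * f x)| <= K * fine 'N[mu]_(+oo%E)[EFin \o f]) ->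
  \int[mu]_x `|k x| <= K.
Proof.
move=> mk mu0 K0 H; pose f x := Num.sg (k x).
have N1 : ('N[mu]_+oo[EFin \o f] <= 1%:E)%E.
  rewrite unlock mu0; apply/ess_supP; apply: aeW => x /=.
  by rewrite lee_fin /f normr_sg; case: (_ != _).
have fL : f \in Lfun mu +oo%E.
  by apply/mem_LfunP; split; [exact: measurable_sg|apply: le_lt_trans N1 _; rewrite ltry].
have := H f fL.
have -> : \int[mu]_x (k x * f x) = \int[mu]_x `|k x|.
  by apply: eq_Rintegral => x _; rewrite /f mulrC -normrEsg.
rewrite ger0_norm; last by apply: Rintegral_ge0 => x _.
move=> /le_trans; apply; rewrite ler_piMr//.
have : 'N[mu]_+oo[EFin \o f]%E \is a fin_num.
  by rewrite ge0_fin_numE ?Lnorm_ge0//; apply: le_lt_trans N1 _; rewrite ltry.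
by move=> /fineK E; rewrite -lee_fin E.
Qed.

(** Test with f = sign(k) on A.  The essential supremum of |k| is approached by
choosing for A a small neighbourhood of a point where |k| is large. *)
Lemma duality_ge_L1 k (K b : R) (A : set T) : measurable_fun setT k ->
  measurable A -> (0 < mu A < +oo)%E -> 0 <= K -> (forall x, A x -> b <= `|k x|) ->
  (exists M, forall x, `|k x| <= M) ->
  (forall f, f \in Lfun mu 1%:E -> `|\int[mu]_x (k x * f x)| <= K * fine 'N[mu]_(1%:E)[EFin \o f]) ->
  b <= K.
Proof.
move=> mk mA /[dup] HA /andP[A0 Afin] K0 kb [M kM] H.
have Af : mu A \is a fin_num by rewrite ge0_fin_numE.
pose f x := Num.sg (k x) * \1_A x.
have mf : measurable_fun setT f.
  by apply: measurable_funM; [exact: measurable_sg|exact: measurable_indic].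
have N1 : ('N[mu]_1[EFin \o f] <= mu A)%E.
  rewrite Lnorm1 -[leRHS]integral_indicT//; apply: ge0_le_integral => //.
  - by apply: measurableT_comp => //; exact/measurable_EFinP.
  - by apply/measurable_EFinP; exact: measurable_indic.
  - move=> x _; rewrite lee_fin /f normrM normr_sg indicE.
    by case: (x \in A); case: (_ != _); rewrite ?normr1 ?normr0 ?mulr0 ?mul0r ?mulr1 ?mul1r.
have fL : f \in Lfun mu 1%:E.
  by apply/mem_LfunP; split => //; apply: le_lt_trans N1 Afin.
have Nf : 'N[mu]_1[EFin \o f]%E \is a fin_num.
  by rewrite ge0_fin_numE ?Lnorm_ge0//; apply: le_lt_trans N1 Afin.
have := H f fL; have [ikf _] := L1_Rintegral mk kM fL.
have a0 : 0 < fine (mu A) by rewrite fine_gt0// A0.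
have NA : fine 'N[mu]_1[EFin \o f]%E <= fine (mu A) by rewrite -lee_fin !fineK.
have kf x : k x * f x = `|k x| * \1_A x by rewrite /f mulrA [k x * _]mulrC -normrEsg.
have iA : mu.-integrable setT (EFin \o (\1_A : T -> R)).
  apply/integrableP; split; first by apply/measurable_EFinP; exact: measurable_indic.
  rewrite (eq_integral (fun x => ((\1_A : T -> R) x)%:E)) => [|x _]; first by rewrite integral_indicT.
  by rewrite /= indicE normr_nat.
have bI : b * fine (mu A) <= \int[mu]_x (k x * f x).
  have -> : b * fine (mu A) = \int[mu]_x (b * \1_A x).
    by rewrite RintegralZl// /Rintegral integral_indicT.
  apply: le_Rintegral => //.
  - rewrite (_ : EFin \o _ = (fun x => b%:E * (\1_A x)%:E)%E)//.
    exact: integrableZl.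
  - move=> x _; rewrite kf indicE; case: (boolP (x \in A)) => [|_]; last by rewrite !mulr0.
    by rewrite inE => /kb; rewrite !mulr1.
move=> H2; rewrite -(ler_pM2r a0); apply: le_trans bI _.
by apply: le_trans (ler_norm _) _; apply: le_trans H2 _; rewrite ler_wpM2l.
Qed.

Lemma duality_ge0 p (A : set T) k (K : R) : (1 <= p)%E -> measurable A -> (0 < mu A < +oo)%E ->
  (forall f, f \in Lfun mu p -> `|\int[mu]_x (k x * f x)| <= K * fine 'N[mu]_p[EFin \o f]) ->
  0 <= K.
Proof.
move=> p1 mA A0 H; have [fL N0] := Lfun_indic p1 mA A0.
by have := le_trans (normr_ge0 _) (H _ fL); rewrite pmulr_lge0.
Qed.

End Lp_duality.

(** * Norms of the gradient kernel as hemisphere integrals *)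

Section kernel_norms.
Context {R : realType} (m : nat).
Local Notation V := 'rV[R]_m.+1.
Local Notation leb := (lebesgue_rV R m).
Local Notation n := (m.+1).
Local Notation a := (m.+1%:R / 2 : R).
Local Notation hemi := (hemisphere R m).
Local Notation sigma := (surface_measure R m.+1).
Implicit Types (x w s z : V) (y u : 'rV[R]_m) (alpha q r : R).

(** The direction of x - (y, 0) is that of (u, 1) with y = x' - x_n u, so an affine
substitution reduces the claim to the gnomonic projection. *)
Lemma integral_halfspace_hemisphere x (G : V -> \bar R) :
  halfspace R m x -> measurable_fun setT G -> (forall s, 0 <= G s)%E ->
  (\int[leb]_y G (radial_proj (x - rV_rcons y 0)) =
   (rV_last x ^+ m)%:E * \int[sigma]_(s in hemi) (G s * (`|rV_last s| `^ (- n%:R))%:E))%E.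
Proof.
move=> x0 mG G0; have X0 : 0 < rV_last x by [].
have ml : measurable_fun setT (fun s : V => (`|rV_last s| `^ (- n%:R))%:E).
  apply/measurable_EFinP; apply: measurable_funpowR; apply: measurableT_comp => //.
  exact: measurable_funlast.
rewrite integral_gnomonic; last 2 first.
- exact: emeasurable_funM.
- by move=> s; rewrite mule_ge0// lee_fin powR_ge0.
transitivity ((rV_last x ^+ m)%:E * \int[leb]_u G (radial_proj (rV_rcons u 1)))%E; last first.
  congr (_ * _)%E; apply: eq_integral => u _.
  have e0 : 0 < enorm (rV_rcons u 1) by rewrite enorm_gt0 rcons_neq0.
  rewrite rV_last_radial_proj rV_lastK div1r gtr0_norm ?invr_gt0//.
  rewrite muleCA -EFinM -[(enorm _)^-1]powR_inv1 ?ltW// -powRrM mulrNN mul1r powR_mulrn ?ltW//.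
  by rewrite mulVf ?mule1// expf_neq0// gt_eqF.
have mF : measurable_fun setT (fun y => G (radial_proj (x - rV_rcons y 0))).
  apply: (measurableT_comp mG); apply: (measurableT_comp (@measurable_radial_proj R n)).
  by apply: measurable_funB_rV => //; exact: measurable_fun_rcons.
have NX : - rV_last x != 0 by rewrite oppr_eq0 gt_eqF.
have := integral_affine (rV_belast x) NX mF (fun y => G0 _).
rewrite normrN gtr0_norm// => E.
transitivity ((rV_last x ^+ m)%:E * ((rV_last x)^-1 ^+ m)%:E *
   \int[leb]_y G (radial_proj (x - rV_rcons y 0)))%E.
  by rewrite -EFinM -exprMn divff ?gt_eqF// expr1n mul1e.
rewrite -muleA -E; congr (_ * _)%E; apply: eq_integral => u _.
have -> : x - rV_rcons (- rV_last x *: u + rV_belast x) 0 = rV_last x *: rV_rcons u 1.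
  apply/rowP => i; rewrite !mxE; case: unliftP => [j ->|->] /=.
    by rewrite !mxE; ring.
  by rewrite subr0 mulr1.
by rewrite radial_projZ.
Qed.

(** The unit ball is contained in a cube. *)
Lemma surface_hemisphere_fin : (sigma hemi < +oo)%E.
Proof.
have mh := @measurable_hemisphere R m.
have -> : sigma hemi = (\int[sigma]_(s in hemi) 1)%E by rewrite integral_cst// mul1e.
rewrite integral_hemisphere//.
have -> : (n%:R%:E * \int[lebesgue_rV R n]_x cap_fun (fun=> 1) x <=
     n%:R%:E * lebesgue_rV R n (cube 0 2))%E -> (n%:R%:E * \int[lebesgue_rV R n]_x cap_fun (fun=> 1) x < +oo)%E.
  by move=> /le_lt_trans; apply; rewrite lebesgue_cube// -EFinM ltry.
  by [].
rewrite lee_wpmul2l ?lee_fin//.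
have mc := @measurable_cube R n 0 2.
rewrite -[leRHS]integral_indicT//; apply: ge0_le_integral => //.
- by move=> x _; apply: cap_fun_ge0.
- by apply: measurable_cap_fun.
- by apply/measurable_EFinP; exact: measurable_indic.
- move=> x _; rewrite /cap_fun indicE; case: ifP => [/andP[_ x1]|_]; last by rewrite lee_fin.
  rewrite mem_set// => i; rewrite mxE subr0.
  apply: (@le_lt_trans _ _ (enorm x)); last by rewrite (le_lt_trans x1)// ltr1n.
  rewrite -sqrtr_sqr /enorm ler_sqrt ?dotr_ge0// /dotr (bigD1 i)//= expr2 lerDl.
  by apply: sumr_ge0 => j _; rewrite -expr2 sqr_ge0.
Qed.

Lemma integral_hemisphere_bounded (g : V -> R) (M : R) : measurable_fun setT g ->
  (forall s, hemi s -> 0 <= g s <= M) ->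
  (0 <= \int[sigma]_(s in hemi) (g s)%:E <= M%:E * sigma hemi)%E.
Proof.
move=> mg gM; have mh := @measurable_hemisphere R m.
apply/andP; split.
  by apply: integral_ge0 => s /gM/andP[s0 _]; rewrite lee_fin.
rewrite -integral_cst//; apply: ge0_le_integral => //.
- by move=> s /gM/andP[s0 _]; rewrite lee_fin.
- by apply/measurable_EFinP; exact: measurable_funTS.
- by move=> s /gM/andP[_ s0]; rewrite lee_fin.
Qed.

Lemma integral_hemisphere_fin (g : V -> R) (M : R) : measurable_fun setT g ->
  (forall s, hemi s -> 0 <= g s <= M) ->
  (\int[sigma]_(s in hemi) (g s)%:E)%E \is a fin_num.
Proof.
move=> mg gM; have /andP[g0 gle] := integral_hemisphere_bounded mg gM.
rewrite ge0_fin_numE//; apply: le_lt_trans gle _.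
have sf : sigma hemi \is a fin_num by rewrite ge0_fin_numE// surface_hemisphere_fin.
by rewrite -(fineK sf) -EFinM ltry.
Qed.

Lemma integral_japan_fin : (\int[leb]_y (japan a y)%:E < +oo)%E.
Proof.
have := @integral_hemisphere_japan R m 0; rewrite addr0 => <-.
under eq_integral do rewrite powRr0.
by rewrite integral_cst ?mul1e ?surface_hemisphere_fin//; exact: measurable_hemisphere.
Qed.

Lemma measurable_japan (t : R) : measurable_fun setT (@japan R m t).
Proof.
apply: measurable_funpowR; apply: measurable_funD => //; exact: measurable_dotr.
Qed.

Lemma japan_le1 y : 0 <= japan a y <= 1.
Proof.
rewrite powR_ge0/= /japan -[leRHS](powRr0 (1 + dotr y y)); apply: ler_powR.
  by rewrite lerDl dotr_ge0.
by rewrite oppr_le0 divr_ge0.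
Qed.

Lemma lebesgue_setT_gt0 : (0 < leb [set: 'rV[R]_m])%E.
Proof.
have mc := @measurable_cube R m 0 1.
apply: (@lt_le_trans _ _ (leb (cube 0 1))); last by apply: le_measure; rewrite ?inE.
by rewrite lebesgue_cube// lte_fin exprn_gt0.
Qed.

(** The density of the Poisson integral is integrable for every exponent: the weight
(1 + |y|^2)^(- n / 2) is bounded by 1 and integrable, hence in every L^q. *)
Lemma integrable_japan p (f : 'rV[R]_m -> R) : (1 <= p)%E -> f \in Lfun leb p ->
  leb.-integrable setT (fun y => (japan a y * f y)%:E).
Proof.
move=> p1 fL; have mj := measurable_japan a.
case: p p1 fL => [r|_|]; last by rewrite leeNy_eq.
- rewrite lee_fin le_eqVlt => /orP[/eqP<-|r1] fL.
    apply: (proj1 (@L1_Rintegral _ _ _ leb (japan a) f 1 mj _ fL)) => y.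
    by have /andP[j0 j1] := japan_le1 y; rewrite ger0_norm.
  apply: (proj1 (hoelder_Rintegral r1 mj _ fL)).
  rewrite ge0_fin_numE ?integral_powR_ge0//.
  apply: le_lt_trans integral_japan_fin; apply: ge0_le_integral => //.
  + by apply/measurable_EFinP; exact: measurable_fun_normpowR.
  + exact/measurable_EFinP.
  + move=> y _; have /andP[j0 j1] := japan_le1 y; rewrite lee_fin (ger0_norm j0).
    have jp : 0 < japan a y by rewrite powR_gt0// (lt_le_trans ltr01)// lerDl dotr_ge0.
    rewrite -[leRHS]powRr1//; apply: ger_powR; rewrite ?jp//.
    by rewrite ler_pdivlMr ?subr_gt0// mul1r gerBl.
- move=> fL; apply: (proj1 (Linfty_Rintegral lebesgue_setT_gt0 _ fL)).
  apply/integrableP; split; first exact/measurable_EFinP.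
  apply: le_lt_trans integral_japan_fin; rewrite le_eqVlt; apply/orP; left; apply/eqP.
  by apply: eq_integral => y _; rewrite /= ger0_norm// powR_ge0.
Qed.

Variables (alpha : R) (z : V).
Hypothesis z1 : enorm z = 1.

Definition kernel_at x y : R := grad_kernel alpha z (x - rV_rcons y 0).

Lemma measurable_grad_kernel : measurable_fun setT (grad_kernel alpha z).
Proof. by have [] := decay_grad_kernel alpha z1. Qed.

Lemma measurable_kernel_at x : measurable_fun setT (kernel_at x).
Proof.
apply: (measurableT_comp measurable_grad_kernel).
by apply: measurable_funB_rV => //; exact: measurable_fun_rcons.
Qed.

Lemma halfspace_enorm_gt0 w : halfspace R m w -> 0 < enorm w.
Proof.
by move=> w0; rewrite -(@ltr_pXn2r _ 2)// ?nnegrE ?enorm_ge0// expr0n enorm_sqr halfspace_dotr.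
Qed.

(** |w| = w_n / s_n for s = w / |w|: along the boundary, where w_n is constant, the
kernel depends on the direction s alone. *)
Lemma grad_kernel_hemisphere w : halfspace R m w ->
  grad_kernel alpha z w = rV_last w `^ (- n%:R) *
    (`|rV_last (radial_proj w)| `^ n%:R * direction_form alpha (radial_proj w) z).
Proof.
move=> w0; have e0 := halfspace_enorm_gt0 w0.
rewrite /grad_kernel mulrA; congr (_ * _).
rewrite rV_last_radial_proj gtr0_norm ?divr_gt0// powRM ?invr_ge0 ?(ltW w0) ?(ltW e0)//.
rewrite mulrA -powRD ?(gt_eqF w0) ?implybT// addNr powRr0 mul1r.
rewrite /rpow (_ : dotr w w = enorm w `^ 2%:R); last by rewrite powR_mulrn ?(ltW e0)// enorm_sqr.
have -> : (enorm w)^-1 = enorm w `^ (-1) by rewrite powR_inv1// ltW.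
rewrite -!powRrM.
by congr (_ `^ _); field.
Qed.

(** The exponents: |k|^q contributes x_n^(- n q) and s_n^(n q), the change of
variables x_n^m and s_n^(- n). *)
Lemma integral_kernel_powR x q : halfspace R m x -> 0 < q ->
  (\int[leb]_y (`|kernel_at x y| `^ q)%:E =
   (rV_last x `^ (m%:R - n%:R * q))%:E * \int[sigma]_(s in hemi)
     (`|direction_form alpha s z| `^ q * `|rV_last s| `^ (n%:R * q - n%:R))%:E)%E.
Proof.
move=> x0 q0; have X0 : 0 < rV_last x by [].
have mG : measurable_fun setT (fun s : V => (`|direction_form alpha s z| `^ q * `|rV_last s| `^ (n%:R * q))).
  apply: measurable_funM; apply: measurable_funpowR; apply: measurableT_comp => //.
    exact: measurable_direction_form.
  exact: measurable_funlast.
transitivity (\int[leb]_y ((rV_last x `^ (- (n%:R * q)))%:E *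
   (`|direction_form alpha (radial_proj (x - rV_rcons y 0)) z| `^ q *
     `|rV_last (radial_proj (x - rV_rcons y 0))| `^ (n%:R * q))%:E))%E.
  apply: eq_integral => y _; rewrite -EFinM; congr _%:E.
  have hw := halfspace_sub_rcons y x0.
  rewrite /kernel_at grad_kernel_hemisphere//.
  rewrite rV_last_sub_rcons !normrM !(ger0_norm (powR_ge0 _ _)) !powRM ?mulr_ge0 ?powR_ge0//.
  by rewrite -!powRrM mulNr [X in _ = _ * X]mulrC.
rewrite integralZl_setT ?powR_ge0//; last first.
- apply: (measurableT_comp (proj2 (measurable_EFinP _ _) mG)).
  apply: (measurableT_comp (@measurable_radial_proj R n)).
  by apply: measurable_funB_rV => //; exact: measurable_fun_rcons.
rewrite (@integral_halfspace_hemisphere x (fun s => (`|direction_form alpha s z| `^ q * `|rV_last s| `^ (n%:R * q))%:E))//; last first.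
  exact/measurable_EFinP.
have E : rV_last x `^ (- (n%:R * q)) * rV_last x ^+ m = rV_last x `^ (m%:R - n%:R * q).
  by rewrite -powR_mulrn ?ltW// -powRD ?(gt_eqF X0) ?implybT// addrC.
rewrite muleA -EFinM E; congr (_ * _)%E; apply: eq_integral => s; rewrite inE => -[_ s0].
rewrite -EFinM -mulrA -powRD//.
by rewrite normr_eq0 (gt_eqF s0) implybT.
Qed.

Lemma direction_form_hemisphere_le s : hemi s -> `|direction_form alpha s z| <= `|alpha| + 1.
Proof. by move=> [s1 _]; exact: direction_form_le. Qed.

Lemma rV_last_hemisphere s : hemi s -> 0 < rV_last s <= 1.
Proof.
move=> [s1 s0]; rewrite s0/= -s1; exact: le_trans (ler_norm _) (rV_last_le_enorm _).
Qed.

Lemma hemisphere_integrand_bounded q b s : 0 <= q -> 0 <= b -> hemi s ->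
  0 <= `|direction_form alpha s z| `^ q * `|rV_last s| `^ b <= (`|alpha| + 1) `^ q.
Proof.
move=> q0 b0 hs; rewrite mulr_ge0 ?powR_ge0//= -[leRHS]mulr1 ler_pM ?powR_ge0//.
  apply: ge0_ler_powR => //; rewrite ?nnegrE ?addr_ge0//.
  exact: direction_form_hemisphere_le.
have /andP[s0 s1] := rV_last_hemisphere hs.
by rewrite gtr0_norm// -[leRHS](powRr0 (rV_last s)); apply: ger_powR => //; rewrite s0.
Qed.

Lemma measurable_hemisphere_integrand q b : measurable_fun setT
  (fun s : V => `|direction_form alpha s z| `^ q * `|rV_last s| `^ b).
Proof.
apply: measurable_funM; apply: measurable_funpowR; apply: measurableT_comp => //.
  exact: measurable_direction_form.
exact: measurable_funlast.
Qed.

Lemma integral_kernel_fin x q : halfspace R m x -> 1 <= q ->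
  (\int[leb]_y (`|kernel_at x y| `^ q)%:E)%E \is a fin_num.
Proof.
move=> x0 q1; have q0 : 0 < q by exact: lt_le_trans q1.
rewrite integral_kernel_powR// fin_numM//.
apply: (integral_hemisphere_fin (M := (`|alpha| + 1) `^ q)).
  exact: measurable_hemisphere_integrand.
move=> s hs; apply: hemisphere_integrand_bounded => //; first exact: ltW.
by rewrite -[X in _ - X]mulr1 -mulrBr mulr_ge0// subr_ge0.
Qed.

(** The quantity whose supremum over z defines [sharp_const]. *)
Definition dir_const (p : \bar R) : R :=
  match p with
  | r%:E =>
    if r == 1 then
      sup [set `|direction_form alpha s z| * dotr s (e_last R m) ^+ n | s in hemi]
    else
      (\int[sigma]_(s in hemi)
                  (`|direction_form alpha s z| `^ (r / (r - 1)) *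
                   dotr s (e_last R m) `^ (n%:R / (r - 1))))
               `^ ((r - 1) / r)
  | +oo%E => \int[sigma]_(s in hemi) `|direction_form alpha s z|
  | -oo%E => 0
  end.

(** The exponent of x_n is (m - n q) / q = m / q - n, with 1 / q = 1 - 1 / r. *)
Lemma kernel_norm_r x r : halfspace R m x -> 1 < r ->
  (\int[leb]_y (`|kernel_at x y| `^ (r / (r - 1)))) `^ ((r - 1) / r) =
  dir_const r%:E * rV_last x `^ (- 1 - m%:R / r).
Proof.
move=> x0 r1; have X0 : 0 < rV_last x by [].
have r0 : 0 < r by exact: lt_trans r1.
have r10 : 0 < r - 1 by rewrite subr_gt0.
rewrite /= (gt_eqF r1) /Rintegral integral_kernel_powR ?divr_gt0//.
set q := r / (r - 1); set J := (X in fine (_ * X)%E).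
have qE : n%:R * q - n%:R = n%:R / (r - 1) by rewrite /q; field; rewrite gt_eqF.
have JE : (\int[sigma]_(s in hemi) (`|direction_form alpha s z| `^ q *
   dotr s (e_last R m) `^ (n%:R / (r - 1)))%:E = J)%E.
  apply: eq_integral => s; rewrite inE => -[_ s0].
  by rewrite rV_lastE qE (gtr0_norm (s0 : 0 < rV_last s)).
have Jfin : J \is a fin_num.
  apply: (integral_hemisphere_fin (M := (`|alpha| + 1) `^ q)).
    exact: measurable_hemisphere_integrand.
  move=> s hs; apply: hemisphere_integrand_bounded; [|by rewrite qE divr_ge0// ltW|exact: hs].
  by rewrite /q divr_ge0 ?ltW.
have J0 : 0 <= fine J.
  by apply: fine_ge0; apply: integral_ge0 => s _; rewrite lee_fin mulr_ge0 ?powR_ge0.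
rewrite JE; move: J {JE} Jfin J0 => J Jfin J0.
rewrite fineM// powRM ?powR_ge0//.
rewrite mulrC; congr (_ * _); rewrite -powRrM; congr (_ `^ _).
rewrite /q -natr1; field.
by rewrite !gt_eqF.
Qed.

Lemma kernel_norm_y x : halfspace R m x ->
  \int[leb]_y `|kernel_at x y| = dir_const +oo%E * rV_last x `^ (- 1).
Proof.
move=> x0; have X0 : 0 < rV_last x by [].
have E : (\int[leb]_y (`|kernel_at x y|)%:E = \int[leb]_y (`|kernel_at x y| `^ 1)%:E)%E.
  by apply: eq_integral => y _; rewrite powRr1.
rewrite /= /Rintegral E integral_kernel_powR//.
set J := (X in fine (_ * X)%E).
have JE : (\int[sigma]_(s in hemi) (`|direction_form alpha s z|)%:E = J)%E.
  apply: eq_integral => s _.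
  by rewrite mulr1 subrr powRr0 mulr1 powRr1.
rewrite JE fineM//; last first.
  apply: (integral_hemisphere_fin (M := (`|alpha| + 1) `^ 1)).
    exact: measurable_hemisphere_integrand.
  move=> s hs; apply: hemisphere_integrand_bounded => //.
  by rewrite mulr1 subrr.
rewrite mulrC; congr (_ * _ `^ _).
by rewrite -natr1; ring.
Qed.

Let S1 := [set `|direction_form alpha s z| * dotr s (e_last R m) ^+ n | s in hemi].

Lemma hemisphere_nonempty : hemi (e_last R m).
Proof.
split; first exact: enorm_e_last.
by rewrite /halfspace/= -rV_lastE dotr_e_last.
Qed.

Lemma has_sup_direction_form : has_sup S1.
Proof.
split; first by exists (`|direction_form alpha (e_last R m) z| * dotr (e_last R m) (e_last R m) ^+ n);
  exists (e_last R m) => //; exact: hemisphere_nonempty.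
exists (`|alpha| + 1) => _ [s hs <-].
have /andP[s0 s1] := rV_last_hemisphere hs.
rewrite -[leRHS]mulr1 rV_lastE ler_pM ?exprn_ge0 ?(ltW s0)//.
  exact: direction_form_hemisphere_le.
by rewrite exprn_ile1// ltW.
Qed.

Lemma kernel_le1 x y : halfspace R m x ->
  `|kernel_at x y| <= dir_const 1%:E * rV_last x `^ (- 1 - m%:R / 1).
Proof.
move=> x0; have X0 : 0 < rV_last x by [].
rewrite /= eqxx divr1.
have w0 := halfspace_sub_rcons y x0.
rewrite /kernel_at grad_kernel_hemisphere// rV_last_sub_rcons.
have -> : - 1 - m%:R = - n%:R :> R by rewrite -natr1; ring.
set s := radial_proj _.
have hs : hemi s by apply/set_mem; rewrite hemisphere_radial_proj.
have [_ s0] := hs.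
rewrite normrM ger0_norm ?powR_ge0// mulrC ler_wpM2r ?powR_ge0//.
apply: (sup_upper_bound has_sup_direction_form); exists s => //.
have s0' : 0 < rV_last s by [].
by rewrite rV_lastE normrM (gtr0_norm s0') powR_mulrn ?(ltW s0')// normrX (gtr0_norm s0') mulrC.
Qed.

(** Every direction s of the hemisphere is that of x - (y, 0) for some y, so the
supremum over the hemisphere is the supremum of |k| over the boundary. *)
Lemma kernel_attained x s : halfspace R m x -> hemi s -> exists y,
  `|kernel_at x y| = `|direction_form alpha s z| * dotr s (e_last R m) ^+ n * rV_last x `^ (- 1 - m%:R / 1).
Proof.
move=> x0 hs; have [s1 s0] := hs; have X0 : 0 < rV_last x by [].
(* The foot on the boundary of the line through x with direction s. *)
exists (rV_belast x - (rV_last x / rV_last s) *: rV_belast s).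
have E : x - rV_rcons (rV_belast x - (rV_last x / rV_last s) *: rV_belast s) 0 = (rV_last x / rV_last s) *: s.
  apply/rowP => i; rewrite !mxE; case: unliftP => [j ->|->] /=.
    by rewrite !mxE; ring.
  by rewrite subr0 -/(rV_last s) divfK// gt_eqF.
have w0 : halfspace R m ((rV_last x / rV_last s) *: s).
  by rewrite /halfspace/= rV_lastZ mulr_gt0// divr_gt0.
rewrite /kernel_at E grad_kernel_hemisphere// radial_projZ ?divr_gt0//.
have -> : radial_proj s = s by rewrite /radial_proj (_ : enorm s = 1) ?invr1 ?scale1r.
rewrite rV_lastZ divfK ?gt_eqF// divr1.
have -> : - 1 - m%:R = - n%:R :> R by rewrite -natr1; ring.
rewrite normrM ger0_norm ?powR_ge0// mulrC; congr (_ * _).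
have s0' : 0 < rV_last s by [].
by rewrite rV_lastE normrM (gtr0_norm s0') powR_mulrn ?(ltW s0')// normrX (gtr0_norm s0') mulrC.
Qed.

End kernel_norms.

(** * The sharp bound in a fixed direction *)

Section direction_constants.
Context {R : realType} (m : nat).
Local Notation V := 'rV[R]_m.+1.
Local Notation leb := (lebesgue_rV R m).
Local Notation n := (m.+1).
Local Notation a := (m.+1%:R / 2 : R).
Local Notation hemi := (hemisphere R m).
Local Notation sigma := (surface_measure R m.+1).
Implicit Types (x w s z : V) (y u : 'rV[R]_m) (alpha q r : R).

Lemma continuous_dotr_self : continuous (fun w : V => dotr w w).
Proof.
apply: (continuous_big add_continuous) => i _ w.
by apply: (@continuousM R V); exact: coord_continuous.
Qed.

Lemma continuous_dotr z : continuous (fun w : V => dotr w z).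
Proof.
apply: (continuous_big add_continuous) => i _ w.
by apply: (@continuousM R V); [exact: coord_continuous|exact: cst_continuous].
Qed.

Lemma continuous_rpow b w : halfspace R m w -> {for w, continuous (rpow b)}.
Proof.
move=> w0; have d0 := halfspace_dotr w0.
apply: (@continuous_comp _ _ _ (fun w : V => dotr w w) (@powR R ^~ (- b))).
  exact: continuous_dotr_self.
apply: differentiable_continuous; apply/derivable1_diffP.
by have [] := is_derive1_powR (- b) d0.
Qed.

Lemma continuous_grad_kernel alpha z w : halfspace R m w ->
  {for w, continuous (grad_kernel alpha z)}.
Proof.
move=> w0; apply: (@continuous_halfspace R m w
  (fun w => alpha * rV_last z * rpow a w - rV_last w * dotr w z * rpow (a + 1) w)) => //.
  by move=> w' w'0; rewrite grad_kernelE.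
apply: continuousB; apply: continuousM; try exact: continuous_rpow; first exact: cst_continuous.
by apply: continuousM; [exact: continuous_rV_last|exact: continuous_dotr].
Qed.

(** Lower semicontinuity of |k|, in the form required by [duality_ge_L1]. *)
Lemma kernel_at_near alpha z x y0 e : halfspace R m x -> 0 < e ->
  exists2 d, 0 < d & forall y, cube y0 d y ->
    `|kernel_at alpha z x y0| - e <= `|kernel_at alpha z x y|.
Proof.
move=> x0 e0; have w0 := halfspace_sub_rcons y0 x0.
have /(@cvgrPdist_le _ _ _ (nbhs _) (nbhs_filter _))/(_ _ e0) := continuous_grad_kernel (alpha := alpha) (z := z) w0.
move=> /nbhs_ballP[d d0 H]; exists d => // y yd.
have : ball (x - rV_rcons y0 0) d (x - rV_rcons y 0).
  split => // i j; rewrite ord1 /ball/= !mxE; case: unliftP => [k _|_] /=.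
    have E (b c e' : R) : b - c - (b - e') = e' - c by ring.
    by rewrite (E (x 0 j) (y0 ord0 k) (y ord0 k)); exact: yd.
  by rewrite subrr normr0.
move=> /H /=; rewrite -/(kernel_at alpha z x y) -/(kernel_at alpha z x y0) => He.
rewrite lerBlDr addrC -lerBlDr; apply: le_trans He.
exact: lerB_dist.
Qed.

Lemma lebesgue_cube_pos y (d : R) : 0 < d -> (0 < leb (cube y d) < +oo)%E.
Proof.
by move=> d0; rewrite (lebesgue_cube y (ltW d0)) lte_fin exprn_gt0 ?mulrn_wgt0// ltry.
Qed.

(** Hoelder's inequality for the gradient kernel. *)
Lemma potential_le p alpha z x f : (1 <= p)%E -> enorm z = 1 -> halfspace R m x ->
  f \in Lfun leb p ->
  `|potential f (grad_kernel alpha z) x| <=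
  dir_const alpha z p * rV_last x `^ (- 1 - dim_over m p) * Lp_norm p f.
Proof.
move=> p1 z1 x0; rewrite /potential.
change (\int[leb]_y (grad_kernel alpha z (x - rV_rcons y 0) * f y))
  with (\int[leb]_y (kernel_at alpha z x y * f y)).
have mk := measurable_kernel_at alpha z1 x.
case: p p1 => [r|_|]; last by rewrite leeNy_eq.
- rewrite lee_fin le_eqVlt => /orP[/eqP<-|r1] fL.
    apply: (proj2 (L1_Rintegral mk _ fL)) => y.
    exact: kernel_le1.
  rewrite -(kernel_norm_r alpha z1 x0 r1).
  apply: (proj2 (hoelder_Rintegral r1 mk _ fL)).
  apply: integral_kernel_fin => //.
  by rewrite ler_pdivlMr ?subr_gt0// mul1r gerBl.
- move=> fL; rewrite /dim_over subr0 -(kernel_norm_y alpha z1 x0).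
  apply: (proj2 (Linfty_Rintegral (@lebesgue_setT_gt0 R m) _ fL)).
  apply/integrableP; split; first exact/measurable_EFinP.
  have := integral_kernel_fin alpha z1 x0 (lexx 1).
  rewrite ge0_fin_numE ?integral_powR_ge0// => /le_lt_trans; apply.
  by rewrite le_eqVlt; apply/orP; left; apply/eqP/eq_integral => y _ /=; rewrite powRr1.
Qed.

(** The converse: the dual norm of the kernel is the smallest constant. *)
Lemma potential_ge p alpha z x K : (1 <= p)%E -> enorm z = 1 -> halfspace R m x ->
  (forall f, f \in Lfun leb p ->
    `|potential f (grad_kernel alpha z) x| <= K * Lp_norm p f) ->
  dir_const alpha z p * rV_last x `^ (- 1 - dim_over m p) <= K.
Proof.
move=> p1 z1 x0 H.
have {}H f : f \in Lfun leb p ->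
  `|\int[leb]_y (kernel_at alpha z x y * f y)| <= K * fine ('N[leb]_p[EFin \o f])%E by exact: H.
have mk := measurable_kernel_at alpha z1 x.
have K0 : 0 <= K := duality_ge0 p1 (measurable_cube 0 1) (lebesgue_cube_pos 0 ltr01) H.
case: p p1 H => [r|_|]; last by rewrite leeNy_eq.
- rewrite lee_fin le_eqVlt => /orP[/eqP<-|r1] H; last first.
    rewrite -(kernel_norm_r alpha z1 x0 r1); apply: duality_ge_Lr => //.
    apply: integral_kernel_fin => //.
    by rewrite ler_pdivlMr ?subr_gt0// mul1r gerBl.
  have X0 : 0 < rV_last x `^ (- 1 - m%:R / 1) by rewrite powR_gt0.
  rewrite -ler_pdivlMr//= eqxx; apply: ge_sup; first by have [] := has_sup_direction_form alpha z1.
  move=> _ [s hs <-]; rewrite ler_pdivlMr//.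
  have [y0 <-] := kernel_attained alpha z x0 hs.
  (* It suffices to reach the value of |k| at y0 up to e, on a cube around y0. *)
  apply/ler_addgt0Pr => e e0; rewrite -lerBlDr.
  have [d d0 Hd] := kernel_at_near alpha z y0 x0 e0.
  apply: (duality_ge_L1 mk (measurable_cube y0 d) (lebesgue_cube_pos y0 d0) K0 Hd _ H).
  by exists (dir_const alpha z 1%:E * rV_last x `^ (- 1 - m%:R / 1)) => y; exact: kernel_le1.
- move=> H; rewrite /dim_over subr0 -(kernel_norm_y alpha z1 x0).
  by apply: duality_ge_Linfty => //; exact: lebesgue_setT_gt0.
Qed.

(** The real supremum in [sharp_const] is genuine only for a bounded set. *)
Lemma dir_const_bounded alpha p : (1 <= p)%E ->
  exists M, forall z, enorm z = 1 -> dir_const alpha z p <= M.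
Proof.
move=> p1; have sf : sigma hemi \is a fin_num by rewrite ge0_fin_numE// surface_hemisphere_fin.
case: p p1 => [r|_|]; last by rewrite leeNy_eq.
- rewrite lee_fin le_eqVlt => /orP[/eqP<-|r1].
    exists (`|alpha| + 1) => z z1; rewrite /= eqxx.
    apply: ge_sup; first by have [] := has_sup_direction_form alpha z1.
    move=> _ [s hs <-]; have /andP[s0 s1] := rV_last_hemisphere hs.
    rewrite -[leRHS]mulr1 rV_lastE ler_pM ?exprn_ge0 ?(ltW s0)//.
      exact: direction_form_hemisphere_le.
    by rewrite exprn_ile1// ltW.
  set q := r / (r - 1); have r10 : 0 < r - 1 by rewrite subr_gt0.
  have r0 : 0 < r := lt_trans ltr01 r1.
  exists (fine (((`|alpha| + 1) `^ q)%:E * sigma hemi)%E `^ ((r - 1) / r)) => z z1.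
  rewrite /= (gt_eqF r1) -/q; apply: ge0_ler_powR; rewrite ?nnegrE.
  - by rewrite divr_ge0// ltW.
  - by apply: Rintegral_ge0 => s _; rewrite mulr_ge0 ?powR_ge0.
  - by rewrite fine_ge0// mule_ge0// lee_fin powR_ge0.
  have mg := measurable_hemisphere_integrand alpha z q (n%:R / (r - 1)).
  have bg s : hemi s -> 0 <= `|direction_form alpha s z| `^ q * `|rV_last s| `^ (n%:R / (r - 1)) <= (`|alpha| + 1) `^ q.
    move=> hs; apply: (hemisphere_integrand_bounded _ z1 _ _ hs).
      by rewrite divr_ge0 ?ltW.
    by rewrite divr_ge0 ?ltW.
  have E : (\int[sigma]_(s in hemi) (`|direction_form alpha s z| `^ q * dotr s (e_last R m) `^ (n%:R / (r - 1)))%:E =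
    \int[sigma]_(s in hemi) (`|direction_form alpha s z| `^ q * `|rV_last s| `^ (n%:R / (r - 1)))%:E)%E.
    apply: eq_integral => s; rewrite inE => -[_ s0].
    by rewrite rV_lastE (gtr0_norm (s0 : 0 < rV_last s)).
  rewrite /Rintegral E; have /andP[_ H] := integral_hemisphere_bounded mg bg.
  by apply: fine_le; [exact: (integral_hemisphere_fin mg bg)|rewrite fin_numM|exact: H].
- exists (fine ((`|alpha| + 1)%:E * sigma hemi)%E) => z z1.
  have mg : measurable_fun setT (fun s : V => `|direction_form alpha s z|).
    by apply: measurableT_comp => //; exact: measurable_direction_form.
  have bg s : hemi s -> 0 <= `|direction_form alpha s z| <= `|alpha| + 1.
    by move=> hs; rewrite normr_ge0 direction_form_hemisphere_le.
  rewrite /= /Rintegral; have /andP[_ H] := integral_hemisphere_bounded mg bg.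
  by apply: fine_le; [exact: (integral_hemisphere_fin mg bg)|rewrite fin_numM|exact: H].
Qed.

Lemma sharp_constE alpha p : (1 <= p)%E ->
  sharp_const m alpha p = 2 * n%:R / omega R n *
    sup [set dir_const alpha z p | z in sphere R n].
Proof.
move=> p1; rewrite /sharp_const; congr (_ * _).
case: p p1 => [r|_|]; last by rewrite leeNy_eq.
- by rewrite /dir_const; case: (r == 1).
- by [].
Qed.

Lemma has_sup_dir_const alpha p : (1 <= p)%E ->
  has_sup [set dir_const alpha z p | z in sphere R n].
Proof.
move=> p1; split.
  by exists (dir_const alpha (e_last R m) p); exists (e_last R m) => //; exact: enorm_e_last.
have [M HM] := dir_const_bounded alpha p1.
by exists M => _ [z z1 <-]; exact: HM.
Qed.

End direction_constants.

(** * Sharp constants *)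

Section sharpness.
Context {R : realType} (m : nat).
Local Notation V := 'rV[R]_m.+1.
Local Notation leb := (lebesgue_rV R m).
Local Notation n := (m.+1).
Local Notation hemi := (hemisphere R m).
Local Notation sigma := (surface_measure R m.+1).
Implicit Types (x w s z : V) (y u : 'rV[R]_m) (alpha q r b : R) (p : \bar R).

Lemma omega_gt0 k : (3 <= k)%N -> 0 < omega R k.
Proof.
move=> k3; rewrite /omega divr_gt0 ?mulr_gt0 ?powR_gt0 ?pi_gt0//.
by apply: Gamma_gt0; rewrite ltr_pdivlMr// mul1r ltr_nat.
Qed.

Lemma is_sharpP p (Q : (V -> R) -> R) (w C : R) : 0 < w ->
  (forall v f, hardy p v f -> Q v <= C * w * Lp_norm p f) ->
  (forall K, (forall v f, hardy p v f -> Q v <= K * Lp_norm p f) -> C * w <= K) ->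
  is_sharp p Q w C.
Proof.
move=> w0 ub lb; split; first exact: ub.
by move=> K HK; rewrite -(ler_pM2r w0); exact: lb.
Qed.

(** Every function of L^p occurs as boundary values, so that the test functions of
the duality lemmas are available. *)
Lemma hardy_poisson p f : (1 <= p)%E -> f \in Lfun leb p -> hardy p (poisson f) f.
Proof.
move=> p1 fL; split => //; move: (fL) => /mem_LfunP[mf _].
by apply: harmonic_poisson => //; exact: integrable_japan fL.
Qed.

(** The scheme common to the three inequalities.  Z is the set of directions seen by
the quantity Q: the whole sphere for the norm of the gradient, and only e_n for
the normal derivative.  The constant remains the supremum over the sphere as
long as every direction is dominated by one of Z. *)
Lemma sharp_bound alpha p x (Q : (V -> R) -> R) (A w : R) (Z : set V) :
  (1 <= p)%E -> halfspace R m x -> 0 < A ->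
  A * rV_last x `^ (- 1 - dim_over m p) = 2 * n%:R / omega R n * w ->
  (forall z, Z z -> enorm z = 1) ->
  (forall z, enorm z = 1 -> exists2 z', Z z' & dir_const alpha z p <= dir_const alpha z' p) ->
  (forall v f, hardy p v f -> exists2 z, enorm z = 1 &
     Q v <= A * `|potential f (grad_kernel alpha z) x|) ->
  (forall v f z, hardy p v f -> Z z ->
     A * `|potential f (grad_kernel alpha z) x| <= Q v) ->
  (forall v f, hardy p v f -> Q v <= sharp_const m alpha p * w * Lp_norm p f) /\
  (forall K, (forall v f, hardy p v f -> Q v <= K * Lp_norm p f) ->
     sharp_const m alpha p * w <= K).
Proof.
move=> p1 x0 A0 Aw Z1 Zmax Qle leQ.
have X0 : 0 < rV_last x `^ (- 1 - dim_over m p) by rewrite powR_gt0.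
have E : sharp_const m alpha p * w = A * rV_last x `^ (- 1 - dim_over m p) *
    sup [set dir_const alpha z p | z in sphere R n].
  by rewrite sharp_constE// Aw mulrAC.
have [ne bd] := has_sup_dir_const m alpha p1.
rewrite E; split => [v f H|K HK].
  have [z z1 Qz] := Qle v f H; have [_ fL _] := H.
  apply: le_trans Qz _; rewrite -!mulrA ler_pM2l//.
  apply: le_trans (potential_le alpha p1 z1 x0 fL) _.
  rewrite [leRHS]mulrCA -mulrA; apply: ler_wpM2r.
    by rewrite mulr_ge0 ?(ltW X0)// /Lp_norm fine_ge0// Lnorm_ge0.
  by apply: sup_upper_bound => //; exists z.
have AX : 0 < A * rV_last x `^ (- 1 - dim_over m p) by exact: mulr_gt0.
rewrite mulrC -ler_pdivlMr//; apply: ge_sup => // _ [z z1 <-].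
have [z' Zz' /le_trans] := Zmax z z1; apply.
(* An admissible K for Q yields K / A for the potential in every direction of Z. *)
rewrite invfM mulrA ler_pdivlMr//; apply: potential_ge => //; first exact: Z1.
move=> f fL; rewrite mulrAC ler_pdivlMr// mulrC.
have H := hardy_poisson p1 fL.
by apply: le_trans (leQ _ _ _ H Zz') (HK _ _ H).
Qed.

Lemma dotr_grad_hardy alpha p v f x z : (1 <= p)%E -> hardy p v f -> halfspace R m x ->
  dotr (grad (fun t : V => rV_last t `^ (n%:R * alpha - 1) * v t) x) z =
  2 / omega R n * n%:R * rV_last x `^ (n%:R * alpha - 1) *
    potential f (grad_kernel alpha z) x.
Proof.
move=> p1 [_ fL vE] x0; move: (fL) => /mem_LfunP[mf _].
by apply: dotr_grad => //; exact: integrable_japan fL.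
Qed.

(** The direction of g itself; any unit vector will do if g = 0. *)
Lemma enorm_attained (g : V) : exists2 z, enorm z = 1 & enorm g = dotr g z.
Proof.
have [->|g0] := eqVneq g 0.
  exists (e_last R m); first exact: enorm_e_last.
  by rewrite rV_lastE /rV_last mxE; apply/eqP; rewrite enorm_eq0.
exists (radial_proj g); first exact: enorm_radial_proj.
by rewrite /radial_proj dotrZr -enorm_sqr expr2 mulKf// enorm_eq0.
Qed.

Lemma gradient_weight alpha p x : halfspace R m x ->
  2 / omega R n * n%:R * rV_last x `^ (n%:R * alpha - 1) *
    rV_last x `^ (- 1 - dim_over m p) =
  2 * n%:R / omega R n * rV_last x `^ (n%:R * alpha - 2 - dim_over m p).
Proof.
move=> x0; have X0 : 0 < rV_last x by [].
rewrite -[LHS]mulrA -powRD ?(gt_eqF X0) ?implybT//.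
by congr (_ * _ `^ _); [rewrite mulrAC|ring].
Qed.

Lemma sharp_gradient alpha p x : (3 <= n)%N -> (1 <= p)%E -> halfspace R m x ->
  let Q v := enorm (grad (fun t : V => rV_last t `^ (n%:R * alpha - 1) * v t) x) in
  let w := rV_last x `^ (n%:R * alpha - 2 - dim_over m p) in
  (forall v f, hardy p v f -> Q v <= sharp_const m alpha p * w * Lp_norm p f) /\
  (forall K, (forall v f, hardy p v f -> Q v <= K * Lp_norm p f) ->
     sharp_const m alpha p * w <= K).
Proof.
move=> n3 p1 x0 Q w; have X0 : 0 < rV_last x by [].
have A0 : 0 < 2 / omega R n * n%:R * rV_last x `^ (n%:R * alpha - 1).
  by rewrite !mulr_gt0 ?invr_gt0 ?omega_gt0 ?powR_gt0.
apply: (@sharp_bound alpha p x Q _ w (sphere R n) p1 x0 A0).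
- exact: gradient_weight.
- by [].
- by move=> z z1; exists z.
- move=> v f H; rewrite /Q; set g := grad _ x.
  have [z z1 ->] := enorm_attained g; exists z => //.
  rewrite /g (dotr_grad_hardy _ _ p1 H x0) ler_wpM2l ?ler_norm//.
  exact: ltW.
- move=> v f z H z1; rewrite -[A in A * _](gtr0_norm A0) -normrM.
  rewrite -(dotr_grad_hardy alpha z p1 H x0).
  by apply: le_trans (Cauchy_Schwarz_dotr _ _) _; rewrite (_ : enorm z = 1)// mulr1.
Qed.

(** On the half-space division by x_n is multiplication by the power of exponent
n alpha - 1 at alpha = 0; gradients only depend on values near x. *)
Lemma grad_div_last v x : halfspace R m x ->
  grad (fun t : V => v t / rV_last t) x =
  grad (fun t : V => rV_last t `^ (n%:R * 0 - 1) * v t) x.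
Proof.
move=> x0; apply/rowP => i; rewrite !mxE; apply: near_eq_derive.
near=> t; have t0 : halfspace R m t by near: t; exact: near_halfspace.
by rewrite mulr0 add0r powR_inv1 ?ltW// mulrC.
Unshelve. all: by end_near. Qed.

Lemma sharp_gradient_div p x : (3 <= n)%N -> (1 <= p)%E -> halfspace R m x ->
  let Q v := enorm (grad (fun t : V => v t / rV_last t) x) in
  let w := rV_last x `^ (- 2 - dim_over m p) in
  (forall v f, hardy p v f -> Q v <= sharp_const m 0 p * w * Lp_norm p f) /\
  (forall K, (forall v f, hardy p v f -> Q v <= K * Lp_norm p f) ->
     sharp_const m 0 p * w <= K).
Proof.
move=> n3 p1 x0 Q w; have [ub lb] := sharp_gradient 0 n3 p1 x0.
have Ew : n%:R * 0 - 2 - dim_over m p = - 2 - dim_over m p :> R by rewrite mulr0 add0r.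
rewrite Ew in ub lb; split => [v f H|K HK].
  by rewrite /Q (grad_div_last v x0); exact: ub H.
by apply: lb => v f H; rewrite -(grad_div_last v x0); exact: HK H.
Qed.

Lemma dir_form0 s z : `|direction_form 0 s z| = `|rV_last s| * `|dotr s z|.
Proof. by rewrite direction_formE mul0r sub0r normrN normrM. Qed.

Lemma dir_integral0 z q b :
  (\int[sigma]_(s in hemi) (`|direction_form 0 s z| `^ q * dotr s (e_last R m) `^ b)%:E =
   \int[sigma]_(s in hemi) (`|rV_last s| `^ (q + b) * `|dotr s z| `^ q)%:E)%E.
Proof.
apply: eq_integral => s; rewrite inE => -[_ s0].
rewrite dir_form0 rV_lastE powRM// mulrAC (gtr0_norm (s0 : 0 < rV_last s)).
by rewrite -powRD// (gt_eqF s0) implybT.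
Qed.

Lemma dir_integral0_e_last q b :
  (\int[sigma]_(s in hemi) (`|direction_form 0 s (e_last R m)| `^ q *
      dotr s (e_last R m) `^ b)%:E =
   \int[leb]_u (japan ((n%:R + (q + b + q)) / 2) u)%:E)%E.
Proof.
rewrite dir_integral0 -integral_hemisphere_japan.
apply: eq_integral => s; rewrite inE => -[_ s0].
rewrite rV_lastE (gtr0_norm (s0 : 0 < rV_last s)) -powRD//.
by rewrite (gt_eqF s0) implybT.
Qed.

(** On the hemisphere |(s, e_n)| = s_n, so the exponents of s_n add up and
[le_integral_hemisphere_dotr] applies with a = q + b. *)
Lemma dir_integral0_le_e_last z q b : enorm z = 1 -> 0 < q -> 0 <= b ->
  fine (\int[sigma]_(s in hemi) (`|direction_form 0 s z| `^ q * dotr s (e_last R m) `^ b)%:E)%E <=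
  fine (\int[sigma]_(s in hemi) (`|direction_form 0 s (e_last R m)| `^ q * dotr s (e_last R m) `^ b)%:E)%E.
Proof.
move=> z1 q0 b0.
have fin z' : enorm z' = 1 -> (\int[sigma]_(s in hemi)
    (`|direction_form 0 s z'| `^ q * dotr s (e_last R m) `^ b)%:E)%E \is a fin_num.
  move=> z'1.
  rewrite (eq_integral (fun s => (`|direction_form 0 s z'| `^ q * `|rV_last s| `^ b)%:E)); last first.
    by move=> s; rewrite inE => -[_ s0]; rewrite rV_lastE (gtr0_norm (s0 : 0 < rV_last s)).
  apply: (integral_hemisphere_fin (measurable_hemisphere_integrand 0 z' q b)).
  by move=> s hs; apply: (hemisphere_integrand_bounded 0 z'1 (ltW q0) b0 hs).
apply: fine_le; [exact: fin|by apply: fin; exact: enorm_e_last|].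
rewrite !dir_integral0; apply: le_trans (le_integral_hemisphere_dotr z1 _ q0) _; first exact: ltr_wpDr.
rewrite le_eqVlt; apply/orP; left; apply/eqP; apply: eq_integral => s; rewrite inE => -[_ s0].
by rewrite rV_lastE -powRD// normr_eq0 (gt_eqF (s0 : 0 < rV_last s)) implybT.
Qed.

(** The case p = oo has the shape of the case 1 < p < oo, with exponents 1 and 0. *)
Lemma dir_const_y alpha z : dir_const alpha z +oo%E =
  fine (\int[sigma]_(s in hemi) (`|direction_form alpha s z| `^ 1 *
    dotr s (e_last R m) `^ 0)%:E)%E.
Proof.
rewrite /= /Rintegral; congr fine; apply: eq_integral => s _.
by rewrite powRr0 mulr1 powRr1.
Qed.

Lemma dir_const0_1 z : enorm z = 1 -> dir_const 0 z 1%:E <= 1.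
Proof.
move=> z1; rewrite /= eqxx; apply: ge_sup; first by have [] := has_sup_direction_form 0 z1.
move=> _ [s hs <-]; have /andP[s0 s1] := rV_last_hemisphere hs.
rewrite dir_form0 rV_lastE mulr_ile1 ?mulr_ge0 ?exprn_ge0 ?(ltW s0)//; last exact: exprn_ile1 (ltW s0) s1.
rewrite mulr_ile1//; first by rewrite gtr0_norm.
by have [e1 _] := hs; rewrite (le_trans (Cauchy_Schwarz_dotr _ _))// (_ : enorm s = 1)// z1 mulr1.
Qed.

(** The supremum is reached at the pole s = e_n. *)
Lemma dir_const0_e_last1 : dir_const 0 (e_last R m) 1%:E = 1.
Proof.
apply/eqP; rewrite eq_le dir_const0_1 ?enorm_e_last//= eqxx.
apply: sup_upper_bound; first by apply: has_sup_direction_form; exact: enorm_e_last.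
exists (e_last R m); first exact: hemisphere_nonempty.
by rewrite dir_form0 -rV_lastE dotr_e_last expr1n normr1 !mulr1.
Qed.

Lemma dir_const0_le z p : (1 <= p)%E -> enorm z = 1 ->
  dir_const 0 z p <= dir_const 0 (e_last R m) p.
Proof.
move=> p1 z1; case: p p1 => [r|_|]; last by rewrite leeNy_eq.
- rewrite lee_fin le_eqVlt => /orP[/eqP<-|r1].
    by rewrite dir_const0_e_last1 dir_const0_1.
  have r10 : 0 < r - 1 by rewrite subr_gt0.
  have r0 : 0 < r := lt_trans ltr01 r1.
  rewrite /= (gt_eqF r1); apply: ge0_ler_powR; rewrite ?nnegrE.
  + by rewrite divr_ge0// ltW.
  + by apply: Rintegral_ge0 => s _; rewrite mulr_ge0 ?powR_ge0.
  + by apply: Rintegral_ge0 => s _; rewrite mulr_ge0 ?powR_ge0.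
  + by apply: dir_integral0_le_e_last; rewrite ?divr_gt0// divr_ge0// ltW.
- by rewrite !dir_const_y; exact: dir_integral0_le_e_last.
Qed.

Lemma sharp_const0 p : (1 <= p)%E ->
  sharp_const m 0 p = 2 * n%:R / omega R n * dir_const 0 (e_last R m) p.
Proof.
move=> p1; rewrite sharp_constE//; congr (_ * _); apply/eqP; rewrite eq_le; apply/andP; split.
  apply: ge_sup; first by have [] := has_sup_dir_const m 0 p1.
  by move=> _ [z z1 <-]; exact: dir_const0_le.
apply: sup_upper_bound; first exact: has_sup_dir_const.
by exists (e_last R m) => //; exact: enorm_e_last.
Qed.

Lemma sharp_partial p x : (3 <= n)%N -> (1 <= p)%E -> halfspace R m x ->
  let Q v := `|partial ord_max (fun t : V => v t / rV_last t) x| in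
  let w := rV_last x `^ (- 2 - dim_over m p) in
  (forall v f, hardy p v f -> Q v <= sharp_const m 0 p * w * Lp_norm p f) /\
  (forall K, (forall v f, hardy p v f -> Q v <= K * Lp_norm p f) ->
     sharp_const m 0 p * w <= K).
Proof.
move=> n3 p1 x0 Q w; have X0 : 0 < rV_last x by [].
have A0 : 0 < 2 / omega R n * n%:R * rV_last x `^ (n%:R * 0 - 1).
  by rewrite !mulr_gt0 ?invr_gt0 ?omega_gt0 ?powR_gt0.
have QE v f : hardy p v f -> Q v = 2 / omega R n * n%:R * rV_last x `^ (n%:R * 0 - 1) *
    `|potential f (grad_kernel 0 (e_last R m)) x|.
  move=> H; rewrite -[A in _ = A * _](gtr0_norm A0) -normrM.
  rewrite -(dotr_grad_hardy 0 (e_last R m) p1 H x0) -(grad_div_last v x0).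
  by rewrite rV_lastE /rV_last mxE.
apply: (@sharp_bound 0 p x Q _ w [set e_last R m] p1 x0 A0).
- by rewrite gradient_weight// /w mulr0 add0r.
- by move=> z ->; exact: enorm_e_last.
- by move=> z z1; exists (e_last R m) => //; exact: dir_const0_le.
- by move=> v f H; exists (e_last R m); rewrite ?enorm_e_last// (QE v f H).
- by move=> v f z H ->; rewrite (QE v f H).
Qed.

Lemma integral_japan_Gamma b : 1 < b -> 1 < b - m%:R / 2 ->
  (\int[leb]_u (japan b u)%:E = (pi `^ (m%:R / 2) * Gamma (b - m%:R / 2) / Gamma b)%:E)%E.
Proof.
move=> b1 bm1; have b0 : 0 < b := lt_trans ltr01 b1.
have G0 := Gamma_gt0 b1.
have := @integral_japan R m b b0.
have -> : egamma b = (Gamma b)%:E by rewrite GammaE fineK// egamma_fin.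
have -> : egamma (b - m%:R / 2) = (Gamma (b - m%:R / 2))%:E by rewrite GammaE fineK// egamma_fin.
set I := (\int[leb]_u _)%E => E.
have -> : I = ((Gamma b)^-1%:E * ((Gamma b)%:E * I))%E.
  by rewrite muleA -EFinM mulVf ?mul1e// gt_eqF.
rewrite E -!EFinM.
congr _%:E; rewrite mulrC; congr (_ * _ / _).
rewrite -powR12_sqrt ?ltW ?pi_gt0// -powR_mulrn ?powR_ge0// -powRrM; congr (_ `^ _).
by rewrite mulrC.
Qed.

Lemma sharp_const0_r r : 1 < r -> sharp_const m 0 r%:E =
  2 * n%:R / omega R n *
    (pi `^ ((n%:R - 1) / 2) * Gamma ((3 * r + n%:R - 1) / (2 * (r - 1))) /
       Gamma ((n%:R + 2) * r / (2 * (r - 1)))) `^ ((r - 1) / r).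
Proof.
move=> r1; have r10 : 0 < r - 1 by rewrite subr_gt0.
have r0 : 0 < r := lt_trans ltr01 r1.
rewrite sharp_const0 ?lee_fin ?ltW//; congr (_ * _).
rewrite /= (gt_eqF r1); congr (_ `^ _).
rewrite /Rintegral dir_integral0_e_last.
set b := (_ / 2); have bE : b = (n%:R + 2) * r / (2 * (r - 1)).
  by rewrite /b; field; rewrite gt_eqF.
have bmE : b - m%:R / 2 = (3 * r + n%:R - 1) / (2 * (r - 1)).
  by rewrite bE -natr1; field; rewrite gt_eqF.
have m0 : 0 <= m%:R :> R by [].
have b1 : 1 < b by rewrite bE ltr_pdivlMr ?mulr_gt0// -natr1; nra.
have bm1 : 1 < b - m%:R / 2 by rewrite bmE ltr_pdivlMr ?mulr_gt0// -natr1; nra.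
by rewrite (integral_japan_Gamma b1 bm1) bmE bE (_ : n%:R - 1 = m%:R)// -natr1 addrK.
Qed.

(** The factors cancel by Gamma(n/2 + 1) = (n/2) Gamma(n/2) and
Gamma(3/2) = sqrt pi / 2. *)
Lemma sharp_const0_y : (3 <= n)%N -> sharp_const m (0 : R) +oo%E = 1.
Proof.
move=> n3; rewrite sharp_const0 ?leey// dir_const_y dir_integral0_e_last.
have n2 : 1 < n%:R / 2 :> R by rewrite ltr_pdivlMr// mul1r ltr_nat.
have G0 := Gamma_gt0 n2.
have bE : (n%:R + (1 + 0 + 1)) / 2 = n%:R / 2 + 1 :> R by field.
rewrite bE integral_japan_Gamma; last 2 first.
- by apply: lt_trans n2 _; rewrite ltrDl.
- by rewrite -natr1; lra.
rewrite (_ : _ + 1 - _ = 3 / 2); last by rewrite -natr1; field.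
rewrite GammaS// Gamma32 /omega /=.
have -> : pi `^ (n%:R / 2) = pi `^ (m%:R / 2) * Num.sqrt pi :> R.
  rewrite -powR12_sqrt ?ltW ?pi_gt0// -powRD ?(gt_eqF (pi_gt0 _)) ?implybT//.
  by rewrite -natr1; congr (_ `^ _); field.
have P0 : pi `^ (m%:R / 2) != 0 :> R by rewrite gt_eqF// powR_gt0// pi_gt0.
have S0 : Num.sqrt pi != 0 :> R by rewrite gt_eqF// sqrtr_gt0 pi_gt0.
field.
by rewrite P0 S0 (gt_eqF G0) nat1r pnatr_eq0.
Qed.

End sharpness.

Theorem corollary1 (R : realType) (m : nat) (alpha : R) (p : \bar R) :
  let n : nat := m.+1 in
  (3 <= n)%N -> (1 <= p)%E -> 0 <= alpha ->
  [/\ forall x : 'rV[R]_m.+1, halfspace R m x ->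
        is_sharp p
          (fun v => enorm (grad
             (fun y => rV_last y `^ (n%:R * alpha - 1) * v y) x))
          1
          (sharp_const m alpha p *
             rV_last x `^ (n%:R * alpha - 2 - dim_over m p)),
      forall x : 'rV[R]_m.+1, halfspace R m x ->
        is_sharp p
          (fun v => enorm (grad (fun y => v y / rV_last y) x))
          (rV_last x `^ (- 2 - dim_over m p))
          (sharp_const m 0 p),
      [/\ sharp_const m 0 1%:E = 2 * n%:R / omega R n,
          sharp_const m (0 : R) +oo%E = 1 &
          forall r : R, 1 < r ->
            sharp_const m 0 r%:E =
              2 * n%:R / omega R n *
              (pi `^ ((n%:R - 1) / 2) *
                 Gamma ((3 * r + n%:R - 1) / (2 * (r - 1))) /
                 Gamma ((n%:R + 2) * r / (2 * (r - 1))))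
              `^ ((r - 1) / r)] &
      forall x : 'rV[R]_m.+1, halfspace R m x ->
        is_sharp p
          (fun v => `|partial ord_max (fun y => v y / rV_last y) x|)
          (rV_last x `^ (- 2 - dim_over m p))
          (sharp_const m 0 p)].
Proof.
move=> n n3 p1 _; split.
- move=> x x0; have [ub lb] := sharp_gradient alpha n3 p1 x0.
  by apply: is_sharpP => //; rewrite mulr1.
- move=> x x0; have [ub lb] := sharp_gradient_div n3 p1 x0.
  by apply: is_sharpP => //; rewrite powR_gt0.
- split; first by rewrite sharp_const0// dir_const0_e_last1 mulr1.
    exact: sharp_const0_y.
  by move=> r r1; exact: sharp_const0_r.
- move=> x x0; have [ub lb] := sharp_partial n3 p1 x0.
  by apply: is_sharpP => //; rewrite powR_gt0.
Qed.
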